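(* Let $(\mathscr P_0,\mathscr A)$, $(\tilde{\mathscr P}_0,\tilde{\mathscr A})$ be two pairs with property (P) and assume that $$\partial_t\mu_t=L^*_{t,\mu_t}\mu_t,\qquad\partial_t\nu_t=\bar L^*_{t,\mu_t}\nu_t\qquad(\mathrm{FP})$$ is well-posed in $\big((\mathscr P_0,\mathscr A),(\tilde{\mathscr P}_0,\tilde{\mathscr A})\big)$. Let $(s,\theta,\zeta)\in[0,\infty)\times\tilde{\mathscr P}_0\times\mathscr P_0$ and $r\in[s,\infty)$, and let $p$ be a probability kernel from $\mathbb R^d$ to $C([r,\infty)\to\mathbb R^d)$ with $p(x,\{\pi_r=x\})=1$ for all $x\in\mathbb R^d$ and $$\mathbb P_{\zeta,(r,\nu_{s,r}^{\zeta,\theta})}(dw)=\int_{\mathbb R^d}p(x,dw)\,\nu_{s,r}^{\zeta,\theta}(dx).$$ Then for every bounded Borel function $g:\mathbb R^d\to\mathbb R$ and every $t\in[r,\infty)$, $$\mathbb E_{\zeta,(s,\theta)}[g(\pi_t)\,|\,\mathscr G_{s,r}]=\int g(\pi_t(w))\,p(\pi_r,dw)\qquad\mathbb P_{\zeta,(s,\theta)}\text{-a.e.}$$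
   Context: Let $d,m\in\mathbb N$. $\mathscr P$ is the set of Borel probability measures on $\mathbb R^d$ with the weak topology and Borel $\sigma$-algebra $\mathscr B(\mathscr P)$; $C([s,\infty)\to\mathscr P_0)$ denotes weakly continuous paths in $\mathscr P_0\subset\mathscr P$. $\mathscr L_X$ is the law of $X$. $b,\bar b:[0,\infty)\times\mathbb R^d\times\mathscr P\to\mathbb R^d$ and $\sigma,\bar\sigma:[0,\infty)\times\mathbb R^d\times\mathscr P\to\mathbb R^d\otimes\mathbb R^m$ are Borel measurable, $L_{t,\mu}h(x)=\frac12\sum_{i,j}(\sigma\sigma^* )_{ij}(t,x,\mu)\partial_i\partial_jh(x)+\sum_ib_i(t,x,\mu)\partial_ih(x)$, and $\bar L_{t,\mu}$ the same with $\bar b,\bar\sigma$. Property (P) for $(\mathscr P_0,\mathscr A)$ with $\mathscr P_0\in\mathscr B(\mathscr P)$, $\mathscr A\subset C([0,\infty)\to\mathscr P_0)$: if $\tilde\mu\in\mathscr P$ with $\tilde\mu\le C\mu$ for some $\mu\in\mathscr P_0$, $C\in(0,\infty)$, then $\tilde\mu\in\mathscr P_0$; if $(\lambda_t)_{t\ge0}\in\mathscr A$, then $(\lambda_{s+t})_{t\ge0}\in\mathscr A$ for all $s\ge0$, and $(\tilde\lambda_t)_{t\ge0}\in\mathscr A$ whenever $(\tilde\lambda_t)_{t\ge0}\in C([0,\infty)\to\mathscr P_0)$ and $\tilde\lambda_t\le C\lambda_t$ for all $t\ge0$ and some $C\in(0,\infty)$. Solutions (from time $s$): $(\mu_t)_{t\ge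 s}\in C([s,\infty)\to\mathscr P)$ solves the first equation if for all $t\ge s$, $\int_s^tdr\int(|b|+\|\sigma\|^2)(r,x,\mu_r)\mu_r(dx)<\infty$ and $\int h\,d\mu_t=\int h\,d\mu_s+\int_s^tdr\int L_{r,\mu_r}h\,d\mu_r$ for all $h\in C_0^\infty(\mathbb R^d)$. Given $(\mu_t)_{t\ge s}$, $(\nu_t)_{t\ge s}\in C([s,\infty)\to\mathscr P)$ solves the second equation if for all $t\ge s$, $\int_s^tdr\int(|\bar b|+\|\bar\sigma\|^2)(r,x,\mu_r)\nu_r(dx)<\infty$ and $\int h\,d\nu_t=\int h\,d\nu_s+\int_s^tdr\int\bar L_{r,\mu_r}h\,d\nu_r$ for all $h\in C_0^\infty(\mathbb R^d)$. (FP) is well-posed in $((\mathscr P_0,\mathscr A),(\tilde{\mathscr P}_0,\tilde{\mathscr A}))$ if: (a) for every $(s,\zeta)\in[0,\infty)\times\mathscr P_0$ there is a unique solution $(\mu_{s,t}^\zeta)_{t\ge s}$ of the first equation from time $s$ with $\mu_{s,s}^\zeta=\zeta$ and $(\mu_{s,s+t}^\zeta)_{t\ge0}\in\mathscr A$, and $\zeta\mapsto\mu_{s,t}^\zeta$ is Borel measurable for all $t\ge s$; (b) for every $(s,\theta,\zeta)\in[0,\infty)\times\tilde{\mathscr P}_0\times\mathscr P_0$ there is a unique solution $(\nu_{s,t}^{\zeta,\theta})_{t\ge s}$ from time $s$ of the second equation with $\mu_{s,r}^\zeta$ in place of $\mu_r$, with $\nu_{s,s}^{\zeta,\theta}=\theta$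 and $(\nu_{s,s+t}^{\zeta,\theta})_{t\ge0}\in\tilde{\mathscr A}$, and $(\theta,\zeta)\mapsto\nu_{s,t}^{\zeta,\theta}$ is Borel measurable for all $t\ge s$. Under well-posedness of (FP), for each $(s,\theta,\zeta)\in[0,\infty)\times\tilde{\mathscr P}_0\times\mathscr P_0$ there is a weak solution, unique in law among those with $(\mathscr L_{X_{s,s+t}^{\zeta,\theta}})_{t\ge0}\in\tilde{\mathscr A}$, of $dX_{s,t}^{\zeta,\theta}=\bar b(t,X_{s,t}^{\zeta,\theta},\mu_{s,t}^\zeta)dt+\bar\sigma(t,X_{s,t}^{\zeta,\theta},\mu_{s,t}^\zeta)dW_t$, $t\ge s$, $\mathscr L_{X_{s,s}^{\zeta,\theta}}=\theta$ (weak solution: continuous adapted process on some filtered probability space with an $\mathbb R^m$-Brownian motion $W$, satisfying the integrated equation a.s. and $\int_s^t\mathbb E(|\bar b|+\|\bar\sigma\|^2)(r,X_{s,r}^{\zeta,\theta},\mu_{s,r}^\zeta)dr<\infty$ for all $t\ge s$). Its marginals are $\mathscr L_{X_{s,t}^{\zeta,\theta}}=\nu_{s,t}^{\zeta,\theta}$. For fixed $s$ and $\zeta\in\mathscr P_0$, and $r\ge s$, $\theta'\in\tilde{\mathscr P}_0$, $\mathbb P_{\zeta,(r,\theta')}$ denotes the law on $C([r,\infty)\to\mathbb R^d)$ of $X_{r,\cdot}^{\mu_{s,r}^\zeta,\theta'}$ (so $\mathbb P_{\zeta,(s,\theta)}$ is the law of $X_{s,\cdot}^{\zeta,\theta}$);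 $\mathbb E_{\zeta,(r,\theta')}$ is its expectation. $\pi_t$ is the evaluation map at time $t$, path spaces carry the $\sigma$-algebra generated by the evaluation maps, and $\mathscr G_{s,r}:=\sigma(\pi_u:u\in[s,r])$. *)

(* Defs.v *)
From HB Require Import structures.
From mathcomp Require Import all_boot all_order all_algebra.
From mathcomp Require Import all_classical all_reals all_analysis.
Set Implicit Arguments.
Unset Strict Implicit.
Unset Printing Implicit Defensive.
Import Order.TTheory GRing.Theory Num.Theory.
Import numFieldNormedType.Exports.
Local Open Scope classical_set_scope.
Local Open Scope ring_scope.

(* Borel sigma-algebra on matrices, in particular on R^d = 'rV[R]_d. *)
HB.instance Definition _ (R : realType) (m n : nat) :=
  Measurable.copy 'M[R]_(m, n) (g_sigma_algebraType (@open 'M[R]_(m, n))).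

(* Euclidean norm on R^d, Hilbert-Schmidt norm on R^d (x) R^m (the norm
   `|_| of the library is the maximum norm). *)
Definition enorm (R : realType) (m n : nat) (A : 'M[R]_(m, n)) : R :=
  Num.sqrt (\sum_i \sum_j A i j ^+ 2).

Section ProbabilityMeasures.
Variables (R : realType) (d : nat).

Definition Pspace : Type := probability 'rV[R]_d R.

Definition prob_of (mu : Pspace) : probability 'rV[R]_d R := mu.

Definition Cb : Type := {f : 'rV[R]_d -> R |
  continuous f /\ exists M : R, forall x, `|f x| <= M}.

Definition pair_Cb (mu : probability 'rV[R]_d R) : {ptws Cb -> R} :=
  fun f => \int[mu]_x (sval f x).

(* weak topology: the coarsest one making every mu |-> \int f dmu, with f
   bounded and continuous, continuous *)
HB.instance Definition _ :=
  Topological.copy Pspace (initial_topology pair_Cb).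
HB.instance Definition _ := Pointed.copy Pspace (probability 'rV[R]_d R).

HB.instance Definition _ :=
  Measurable.copy Pspace (g_sigma_algebraType (@open Pspace)).

(* Elements of [probability T R] are set functions defined on all sets, so
   equality of probability measures is agreement on measurable sets, not
   Leibniz equality. Weakly open sets are unions of classes of this relation,
   hence so are all Borel subsets of [Pspace]. *)
Definition same_law (mu nu : Pspace) : Prop :=
  forall B : set 'rV[R]_d, measurable B -> prob_of mu B = prob_of nu B.

Definition dominated (C : R) (mu nu : Pspace) : Prop :=
  forall B : set 'rV[R]_d, measurable B ->
    (prob_of mu B <= C%:E * prob_of nu B)%E.

(* C([s, oo) -> P0); the values of a path before time s are irrelevant *)
Definition cont_paths (s : R) (P0 : set Pspace) : set (R -> Pspace) :=
  [set l | {within `[s, +oo[, continuous l} /\ forall t, s <= t -> P0 (l t)].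

(* The last clause, with C = 1, makes membership in [A] insensitive to the
   values of a path at negative times and to [same_law] at each time. *)
Definition property_P (P0 : set Pspace) (A : set (R -> Pspace)) : Prop :=
  [/\ measurable P0,
      A `<=` cont_paths 0 P0,
      forall (mu nu : Pspace) (C : R),
        P0 mu -> 0 < C -> dominated C nu mu -> P0 nu,
      forall (l : R -> Pspace) (s : R),
        A l -> 0 <= s -> A (fun t => l (s + t)) &
      forall (l l' : R -> Pspace) (C : R),
        A l -> cont_paths 0 P0 l' -> 0 < C ->
        (forall t, 0 <= t -> dominated C (l' t) (l t)) -> A l'].

End ProbabilityMeasures.

Coercion prob_of : Pspace >-> Probability.type.

Section TestFunctions.
Variables (R : realType) (d : nat).
Implicit Types h : 'rV[R]_d -> R.

Definition partial (i : 'I_d) h : 'rV[R]_d -> R :=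
  fun x => 'D_('e_i) h x.

Definition smooth h : Prop := forall s : seq 'I_d,
  let k := foldr partial h s in
  continuous k /\ forall (i : 'I_d) x, derivable k x 'e_i.

Definition test_function h : Prop :=
  smooth h /\ compact (closure [set x | h x != 0]).

End TestFunctions.

Section FokkerPlanck.
Variables (R : realType) (d m : nat).

Definition drift := R -> 'rV[R]_d -> Pspace R d -> 'rV[R]_d.
Definition diffusion := R -> 'rV[R]_d -> Pspace R d -> 'M[R]_(d, m).

Definition borel_coefficient (k n : nat)
    (f : R -> 'rV[R]_d -> Pspace R d -> 'M[R]_(k, n)) : Prop :=
  measurable_fun [set z : R * 'rV[R]_d * Pspace R d | 0 <= z.1.1]
    (fun z => f z.1.1 z.1.2 z.2).

Implicit Types (b : drift) (sigma : diffusion).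

Definition generator b sigma (t : R) (mu : Pspace R d) (h : 'rV[R]_d -> R)
    (x : 'rV[R]_d) : R :=
  2^-1 * (\sum_i \sum_j (sigma t x mu *m (sigma t x mu)^T) i j
                        * partial i (partial j h) x)
  + \sum_i b t x mu 0 i * partial i h x.

(* (nu_t)_{t >= s} solves d_t nu_t = L_{t, mu_t}^* nu_t. With nu = mu this is
   the nonlinear equation d_t mu_t = L_{t, mu_t}^* mu_t. *)
Definition solves_FP b sigma (s : R) (mu nu : R -> Pspace R d) : Prop :=
  {within `[s, +oo[, continuous nu} /\
  forall t, s <= t ->
    (\int[lebesgue_measure]_(r in `[s, t]) \int[nu r]_x
       (enorm (b r x (mu r)) + enorm (sigma r x (mu r)) ^+ 2)%:E < +oo)%E /\
    forall h, test_function h ->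
      \int[nu t]_x h x = \int[nu s]_x h x +
        \int[lebesgue_measure]_(r in `[s, t]) \int[nu r]_x
          generator b sigma r (mu r) h x.

Definition solves_FP_from b sigma (A : set (R -> Pspace R d)) (s : R)
    (theta : Pspace R d) (mu nu : R -> Pspace R d) : Prop :=
  [/\ solves_FP b sigma s mu nu, same_law (nu s) theta
    & A (fun t => nu (s + t))].

(* Well-posedness of (FP), with [mu s zeta t] and [nu s zeta theta t] the
   solutions mu_{s,t}^zeta and nu_{s,t}^{zeta,theta}. *)
Definition well_posed b sigma (bb : drift) (bs : diffusion)
    (P0 : set (Pspace R d)) (A : set (R -> Pspace R d))
    (tP0 : set (Pspace R d)) (tA : set (R -> Pspace R d))
    (mu : R -> Pspace R d -> R -> Pspace R d)
    (nu : R -> Pspace R d -> Pspace R d -> R -> Pspace R d) : Prop :=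
  [/\ forall s zeta, 0 <= s -> P0 zeta ->
        solves_FP_from b sigma A s zeta (mu s zeta) (mu s zeta) /\
        forall l, solves_FP_from b sigma A s zeta l l ->
          forall t, s <= t -> same_law (l t) (mu s zeta t),
      forall s t, 0 <= s -> s <= t ->
        measurable_fun P0 (fun zeta => mu s zeta t),
      forall s theta zeta, 0 <= s -> tP0 theta -> P0 zeta ->
        solves_FP_from bb bs tA s theta (mu s zeta) (nu s zeta theta) /\
        forall l, solves_FP_from bb bs tA s theta (mu s zeta) l ->
          forall t, s <= t -> same_law (l t) (nu s zeta theta t)
    & forall s t, 0 <= s -> s <= t ->
        measurable_fun (tP0 `*` P0)
          (fun z : Pspace R d * Pspace R d => nu s z.2 z.1 t)].

End FokkerPlanck.

(* C([s, oo) -> R^d). A path is stored as a function on R that is constant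
   before time s, so that distinct records are distinct paths on [s, oo). *)
Record cpath (R : realType) (d : nat) (s : R) := CPath {
  path_fun :> R -> 'rV[R]_d;
  path_cont : {within `[s, +oo[, continuous path_fun};
  path_before : forall t, t < s -> path_fun t = path_fun s }.
Arguments cpath R d s : clear implicits.

Section PathSpace.
Variables (R : realType) (d : nat) (s : R).

Let cst_cont : {within `[s, +oo[, continuous (fun _ : R => 0 : 'rV[R]_d)}.
Proof. by apply: continuous_subspaceT => x; exact: cvg_cst. Qed.

HB.instance Definition _ := gen_eqMixin (cpath R d s).
HB.instance Definition _ := gen_choiceMixin (cpath R d s).
HB.instance Definition _ :=
  isPointed.Build (cpath R d s) (CPath cst_cont (fun _ _ => erefl)).

Definition cylinders (I : set R) : set (set (cpath R d s)) :=
  [set A | exists u (B : set 'rV[R]_d),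
    [/\ I u, measurable B & A = [set w : cpath R d s | B (w u)]]].

HB.instance Definition _ :=
  Measurable.copy (cpath R d s) (g_sigma_algebraType (cylinders `[s, +oo[)).

Definition history (r : R) : set (set (cpath R d s)) :=
  <<s cylinders `[s, r] >>.

End PathSpace.
Arguments history {R d} s r.

Section Probability.
Variables (R : realType) (dO : measure_display) (Omega : measurableType dO).
Variable Q : probability Omega R.

Definition measurable_wrt (dT : measure_display) (T : measurableType dT)
    (G : set (set Omega)) (f : Omega -> T) : Prop :=
  forall B, measurable B -> G (f @^-1` B).

Definition is_law (dT : measure_display) (T : measurableType dT)
    (Y : Omega -> T) (mu : set T -> \bar R) : Prop :=
  forall B, measurable B -> mu B = Q (Y @^-1` B).

(* Y is one version of E_Q[f | G]; all versions agree Q-a.e. *)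
Definition cond_expectation (G : set (set Omega)) (f Y : Omega -> R) : Prop :=
  [/\ measurable_wrt G Y, Q.-integrable setT (EFin \o Y) &
      forall B, G B ->
        (\int[Q]_(w in B) (Y w)%:E = \int[Q]_(w in B) (f w)%:E)%E].

Definition filtration (F : R -> set (set Omega)) : Prop :=
  [/\ forall t, 0 <= t -> sigma_algebra setT (F t),
      forall t, 0 <= t -> F t `<=` measurable &
      forall s t, 0 <= s -> s <= t -> F s `<=` F t].

Variables (d m : nat) (F : R -> set (set Omega)) (W : Omega -> cpath R m 0).

(* The last clause says that W_t - W_s is independent of F_s and has
   independent coordinates with law N(0, t - s); [normal_prob] takes the
   standard deviation. *)
Definition brownian_motion : Prop :=
  [/\ forall t, 0 <= t -> measurable_wrt (F t) (W ^~ t),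
      {ae Q, forall w, W w 0 = 0} &
      forall s t, 0 <= s -> s < t ->
      forall (B : set Omega) (C : 'I_m -> set R),
        F s B -> (forall i, measurable (C i)) ->
        (Q (B `&` [set w | forall i, C i ((W w t - W w s)%R 0%R i)]) =
         Q B * \big[*%E/1%E]_(i < m) normal_prob 0 (Num.sqrt (t - s)%R) (C i))%E].

(* Simple integrands on [s, t]:
   \sum_(k < n) xi k w * 1_(tau k < r <= tau k.+1). *)
Definition simple_integrand (s t : R) (n : nat) (tau : nat -> R)
    (xi : nat -> Omega -> 'M[R]_(d, m)) : Prop :=
  [/\ tau 0%N = s, tau n = t, forall k, (k < n)%N -> tau k <= tau k.+1,
      forall k, (k < n)%N -> measurable_wrt (F (tau k)) (xi k) &
      exists M : R, forall k w, (k < n)%N -> enorm (xi k w) <= M].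

Definition simple_value (n : nat) (tau : nat -> R)
    (xi : nat -> Omega -> 'M[R]_(d, m)) (r : R) (w : Omega) : 'M[R]_(d, m) :=
  \sum_(k < n) (if tau k < r <= tau k.+1 then xi k w else 0).

(* Vectors are rows: H dW is written dW *m H^T. *)
Definition simple_integral (n : nat) (tau : nat -> R)
    (xi : nat -> Omega -> 'M[R]_(d, m)) (w : Omega) : 'rV[R]_d :=
  \sum_(k < n) (W w (tau k.+1) - W w (tau k)) *m (xi k w)^T.

(* J is the Ito integral of H with respect to W over [s, t]: the L^2 limit of
   the integrals of simple integrands converging to H in L^2(dr x Q). *)
Definition ito_integral (s t : R) (H : R -> Omega -> 'M[R]_(d, m))
    (J : Omega -> 'rV[R]_d) : Prop :=
  measurable_fun setT J /\
  exists (n : nat -> nat) (tau : nat -> nat -> R)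
         (xi : nat -> nat -> Omega -> 'M[R]_(d, m)),
  [/\ forall k, simple_integrand s t (n k) (tau k) (xi k),
      (fun k => \int[lebesgue_measure]_(r in `[s, t]) \int[Q]_w
          (enorm (H r w - simple_value (n k) (tau k) (xi k) r w) ^+ 2)%R%:E)%E
        @ \oo --> 0%E &
      (fun k => \int[Q]_w
          (enorm (J w - simple_integral (n k) (tau k) (xi k) w) ^+ 2)%:E)%E
        @ \oo --> 0%E].

(* (X_t)_{t >= s} is a weak solution of
   dX_t = b(t, X_t, mu_t) dt + sigma(t, X_t, mu_t) dW_t,  X_s ~ theta,
   on (Omega, F, Q, W). *)
Definition weak_solution (b : drift R d) (sigma : diffusion R d m) (s : R)
    (mu : R -> Pspace R d) (theta : Pspace R d) (X : Omega -> cpath R d s)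
    : Prop :=
  filtration F /\ brownian_motion /\
  [/\ forall t, s <= t -> measurable_wrt (F t) (X ^~ t),
      is_law (X ^~ s) theta,
      forall t, s <= t ->
        (\int[lebesgue_measure]_(r in `[s, t]) \int[Q]_w
           (enorm (b r (X w r) (mu r))
            + enorm (sigma r (X w r) (mu r)) ^+ 2)%:E < +oo)%E &
      forall t, s <= t -> exists2 J : Omega -> 'rV[R]_d,
        ito_integral s t (fun r w => sigma r (X w r) (mu r)) J &
        {ae Q, forall w, X w t = X w s
           + \row_i (\int[lebesgue_measure]_(r in `[s, t])
                       b r (X w r) (mu r) 0 i)
           + J w}].

End Probability.

(* PP is the law on C([s, oo) -> R^d) of a weak solution whose time marginals
   belong to A. *)
Definition weak_solution_law (R : realType) (d m : nat) (b : drift R d)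
    (sigma : diffusion R d m) (A : set (R -> Pspace R d)) (s : R)
    (mu : R -> Pspace R d) (theta : Pspace R d)
    (PP : probability (cpath R d s) R) : Prop :=
  exists (dO : measure_display) (Omega : measurableType dO)
    (Q : probability Omega R) (F : R -> set (set Omega))
    (W : Omega -> cpath R m 0) (X : Omega -> cpath R d s),
  [/\ weak_solution Q F W b sigma mu theta X,
      exists2 l, A l & forall t, 0 <= t -> is_law Q (X ^~ (s + t)) (l t) &
      is_law Q X PP].

(* Main.v *)
Require Import Defs.
From HB Require Import structures.
From mathcomp Require Import all_boot all_order all_algebra.
From mathcomp Require Import all_classical all_reals all_analysis.
From mathcomp Require Import measurable_realfun ring lra.
Import Order.TTheory GRing.Theory Num.Theory.
Import numFieldNormedType.Exports.
Local Open Scope classical_set_scope.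
Local Open Scope ring_scope.
Set Implicit Arguments.
Unset Strict Implicit.
Unset Printing Implicit Defensive.
Import HBNNSimple.

(** The statement is a Markov property, and it comes from uniqueness for the
linear equation alone: conditioning a weak solution on an event of its past
changes its one-dimensional marginals into other solutions of the same linear
Fokker-Planck equation.

Let X be a weak solution from time s, let B be an event of the history up to r
with probability q > 0, and let eta1_u be the law of X_u under the probability
with density 1_B / q. The density is bounded and measurable at time r, so the
Ito formula in expectation can be weighted by it from time r on, and (eta1_u)
solves the linear equation on [r, oo). It is dominated by 1/q times the
marginals of X, hence stays in the prescribed class of paths by property (P).
At time r it is dominated by 1/q times nu_r, the law of X_r, so it has a
density rho with values in [0, 1/q] with respect to nu_r. Weighting the
solution X' that is restarted at time r from nu_r by rho(X'_r) gives a second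
family (eta2_u), which solves the same equation and agrees with eta1 at time r.
By uniqueness eta1_t = eta2_t. Integrating g against both sides, and
disintegrating the law of X' along its value at time r, yields
E[1_B g(X_t)] = E[1_B G(X_r)] with G x the integral of g(w t) under p x, and
this is the claim, since B is arbitrary.

Two facts make this rigorous. The first, [tilted_solves_FP], is that the
marginals of a weak solution, reweighted by a bounded density known at time r,
solve the linear equation from time r. As the stochastic integral is given
only as a limit of simple integrals, the Ito formula is proved in expectation
and from scratch. On one step of a simple integrand, a third order expansion of
the test function leaves an error of order (c - a)^(3/2) ([one_step]); a
function whose increments are that small is constant ([holder_const]), so the
formula is exact for processes with simple integrand and bounded drift
([simple_ito]). Truncating the drift and using the isometry
([blk_isometry]), such processes approximate X in L^1 uniformly in time
([gap_bound]), and [ito_limit] carries the formula over. The drift may be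
unbounded and only integrable in time and space; the limit uses the Lipschitz
bound of a test function capped at 1 against uniform integrability.

The second, [flow_property], is that restarting the nonlinear equation at
time r from mu_r continues the same path, so that X and X' have the same
measure argument. This needs the time integral to be additive, that is,
the measurability of v |-> \int f_v dmu_v along weakly continuous paths
([path_Rint_meas]), and the invariance of Borel coefficients under equality of
laws ([coef_same_law]). *)

(** * Integrals of real functions, image laws, densities *)

Section Integ.
Context d (T : measurableType d) (R : realType) (m : {measure set T -> \bar R}).
Implicit Types f g : T -> R.

(** Real-valued integrability, so that the linear algebra of integrals can be
done in R with [Rintegral] instead of in the extended reals. *)
Definition integ f := m.-integrable setT (EFin \o f).

Lemma integ_meas f : integ f -> measurable_fun setT f.
Proof. by move/measurable_int/measurable_EFinP. Qed.

Lemma integD f g : integ f -> integ g -> integ (fun x => f x + g x).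
Proof. by move=> hf hg; have := integrableD measurableT hf hg. Qed.

Lemma integB f g : integ f -> integ g -> integ (fun x => f x - g x).
Proof. by move=> hf hg; have := integrableB measurableT hf hg. Qed.

Lemma integZ k f : integ f -> integ (fun x => k * f x).
Proof. by move=> hf; have := integrableZl measurableT k hf. Qed.

Lemma integ0 : integ (fun=> 0).
Proof. exact: integrable0. Qed.

Lemma eq_integ f g : (forall x, g x = f x) -> integ f -> integ g.
Proof. by move=> /funext ->. Qed.

Lemma integ_sum (I : Type) (s : seq I) (P : pred I) (h : I -> T -> R) :
  (forall i, P i -> integ (h i)) -> integ (fun x => \sum_(i <- s | P i) h i x).
Proof.
move=> H; elim: s => [|i s IH].
  by apply: (eq_integ _ integ0) => x; rewrite big_nil.
case: (boolP (P i)) => Pi.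
  by apply: (eq_integ _ (integD (H i Pi) IH)) => x; rewrite big_cons Pi.
by apply: (eq_integ _ IH) => x; rewrite big_cons (negbTE Pi).
Qed.

Lemma integ_le f g : measurable_fun setT f -> integ g ->
  (forall x, `|f x| <= g x) -> integ f.
Proof.
move=> mf ig H; apply: (le_integrable measurableT _ _ ig).
  exact/measurable_EFinP.
by move=> x _ /=; rewrite lee_fin (le_trans (H x))// ler_norm.
Qed.

Lemma integ_norm f : integ f -> integ (fun x => `|f x|).
Proof. by move=> hf; have := integrable_norm hf. Qed.

Lemma integMb f g k : measurable_fun setT g -> (forall x, `|g x| <= k) ->
  integ f -> integ (fun x => g x * f x).
Proof.
move=> mg gk hf; apply: (@integ_le _ (fun x => k * `|f x|)).
- by apply: measurable_funM => //; exact: integ_meas.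
- by apply: integZ; exact: integ_norm.
- by move=> x; rewrite normrM ler_wpM2r.
Qed.

Lemma integ_b f k : (m setT < +oo)%E -> measurable_fun setT f ->
  (forall x, `|f x| <= k) -> integ f.
Proof.
move=> mT mf fk; apply: measurable_bounded_integrable => //.
by exists k; split; [exact: num_real|move=> y ky x _ /=; rewrite (le_trans (fk x))// ltW].
Qed.

Lemma RintD f g : integ f -> integ g ->
  \int[m]_x (f x + g x) = \int[m]_x f x + \int[m]_x g x.
Proof. exact: RintegralD. Qed.

Lemma RintB f g : integ f -> integ g ->
  \int[m]_x (f x - g x) = \int[m]_x f x - \int[m]_x g x.
Proof. exact: RintegralB. Qed.

Lemma RintZ k f : integ f -> \int[m]_x (k * f x) = k * \int[m]_x f x.
Proof. by move=> hf; rewrite RintegralZl. Qed.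

Lemma Rint_sum (I : Type) (s : seq I) (P : pred I) (h : I -> T -> R) :
  (forall i, P i -> integ (h i)) ->
  \int[m]_x (\sum_(i <- s | P i) h i x) = \sum_(i <- s | P i) \int[m]_x h i x.
Proof.
move=> H; elim: s => [|i s IH].
  under eq_Rintegral do rewrite big_nil.
  by rewrite big_nil /Rintegral integral0.
under eq_Rintegral do rewrite big_cons.
rewrite big_cons; case: ifPn => // Pi.
by rewrite RintD ?IH//; [exact: H|exact: integ_sum].
Qed.

Lemma Rint_le f g : integ f -> integ g -> (forall x, f x <= g x) ->
  \int[m]_x f x <= \int[m]_x g x.
Proof. by move=> hf hg fg; apply: le_Rintegral => // x _; exact: fg. Qed.

Lemma Rint_norm f : integ f -> `|\int[m]_x f x| <= \int[m]_x `|f x|.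
Proof. by move=> hf; exact: le_normr_Rintegral. Qed.

Lemma Rint_norm_le f g : integ f -> integ g -> (forall x, `|f x| <= g x) ->
  `|\int[m]_x f x| <= \int[m]_x g x.
Proof.
move=> hf hg H; apply: (le_trans (Rint_norm hf)); apply: Rint_le => //.
exact: integ_norm.
Qed.

Lemma Rint_ge0 f : (forall x, 0 <= f x) -> 0 <= \int[m]_x f x.
Proof. by move=> H; apply: Rintegral_ge0. Qed.

Lemma EFin_Rint f : integ f -> (\int[m]_x f x)%:E = (\int[m]_x (f x)%:E)%E.
Proof. by move=> hf; rewrite /Rintegral fineK//; exact: integrable_fin_num. Qed.

Lemma integ_ge0P f : measurable_fun setT f -> (forall x, 0 <= f x) ->
  (\int[m]_x (f x)%:E < +oo)%E -> integ f.
Proof.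
move=> mf f0 H; apply/integrableP; split; first exact/measurable_EFinP.
by under eq_integral do rewrite /= ger0_norm//.
Qed.

Lemma Rint_eq f g : (forall x, f x = g x) -> \int[m]_x f x = \int[m]_x g x.
Proof. by move=> H; apply: eq_Rintegral => x _; exact: H. Qed.

Lemma Rint_ae f g : measurable_fun setT f -> measurable_fun setT g ->
  {ae m, forall x, f x = g x} -> \int[m]_x f x = \int[m]_x g x.
Proof.
move=> mf mg H; rewrite /Rintegral; congr fine; apply: ae_eq_integral => //.
- exact/measurable_EFinP.
- exact/measurable_EFinP.
- by apply: filterS H => x -> _.
Qed.

End Integ.

(** The change of density formula holds on simple functions by linearity and
passes to monotone limits on both sides. *)
Lemma ge0_integral_density d (T : measurableType d) (R : realType)
    (m m' : {measure set T -> \bar R}) (D : T -> R) (f : T -> \bar R) :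
  measurable_fun setT D -> (forall x, 0 <= D x) ->
  (forall B, measurable B -> m' B = \int[m]_(x in B) (D x)%:E)%E ->
  measurable_fun setT f -> (forall x, 0 <= f x)%E ->
  (\int[m']_x f x = \int[m]_x (f x * (D x)%:E))%E.
Proof.
move=> mD D0 H mf f0.
pose h := nnsfun_approx measurableT mf.
have fE x : f x = (limn (EFin \o h ^~ x))%E.
  by apply/esym/cvg_lim => //; apply: cvg_nnsfun_approx.
under eq_integral do rewrite fE.
rewrite monotone_convergence//; last 3 first.
- by move=> n; apply/measurable_EFinP.
- by move=> n x _; rewrite lee_fin.
- by move=> x _ a b ab; rewrite lee_fin; exact/lefP/nd_nnsfun_approx.
have fD x : (f x * (D x)%:E)%E = (limn (fun n => (h n x * D x)%:E))%E.
  apply/esym/cvg_lim => //; rewrite (_ : (fun n => _) = (fun n => (h n x)%:E * (D x)%:E)%E).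
    by apply: cvgeZr => //; exact: cvg_nnsfun_approx.
  by apply/funext => n; rewrite EFinM.
under [RHS]eq_integral do rewrite fD.
rewrite monotone_convergence//; last 3 first.
- by move=> n; apply/measurable_EFinP; apply: measurable_funM.
- by move=> n x _; rewrite lee_fin mulr_ge0.
- move=> x _ a b ab; rewrite lee_fin ler_wpM2r//.
  exact/lefP/nd_nnsfun_approx.
congr (limn _); apply/funext => n.
transitivity (\int[m']_x (\sum_(y \in range (h n)) (y * \1_(h n @^-1` [set y]) x)%:E))%E.
  by apply: eq_integral => t tE; rewrite /= fimfunE -fsumEFin.
have mi y : measurable_fun setT (fun x : T => (y * \1_(h n @^-1` [set y]) x)%:E).
  by apply/measurable_EFinP; apply: measurable_funM.
have hge y x : (0 <= (y * \1_(h n @^-1` [set y]) x)%:E)%E.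
  exact: nnfun_muleindic_ge0.
rewrite ge0_integral_fsum//.
transitivity (\int[m]_x (\sum_(y \in range (h n))
    ((y * \1_(h n @^-1` [set y]) x)%:E * (D x)%:E)))%E; last first.
  apply: eq_integral => x _.
  rewrite -ge0_mule_fsuml => [|y]; last exact: hge.
  by rewrite fsumEFin // -(fimfunE _ x) EFinM.
rewrite ge0_integral_fsum//; last 2 first.
  - by move=> y; apply: emeasurable_funM => //; apply/measurable_EFinP.
  - by move=> y x _; rewrite mule_ge0 ?lee_fin//; exact: hge.
apply: eq_fsbigr => r rhn.
rewrite integralZl_indic_nnsfun//.
under [RHS]eq_integral do rewrite EFinM -muleA.
have r0 : (0 <= r)%R by move: rhn; rewrite inE => -[t _ <-].
rewrite ge0_integralZl_EFin//; last 2 first.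
- by move=> x _; rewrite mule_ge0 ?lee_fin.
- by apply: emeasurable_funM; apply/measurable_EFinP.
congr (_ * _)%E; rewrite integral_indic// setIT H//.
rewrite [in LHS]integral_mkcond; apply: eq_integral => x _.
by rewrite epatch_indic muleC.
Qed.

Section Law.
Context d1 d2 (X : measurableType d1) (Y : measurableType d2) (R : realType).
Variables (m : {measure set X -> \bar R}) (m' : {measure set Y -> \bar R}).
Variable phi : X -> Y.
Hypothesis mphi : measurable_fun setT phi.
Hypothesis law : forall B, measurable B -> (m' B = m (phi @^-1` B))%E.

Lemma law_ge0_integral (f : Y -> \bar R) : measurable_fun setT f ->
  (forall y, 0 <= f y)%E -> (\int[m']_y f y = \int[m]_x f (phi x))%E.
Proof.
move=> mf f0.
have E := @ge0_integral_pushforward _ _ _ _ R phi mphi m setT f measurableT mf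
  (fun y _ => f0 y).
rewrite -[RHS]E; apply: eq_measure_integral => A mA _; exact: law.
Qed.

Lemma law_integral (f : Y -> \bar R) : measurable_fun setT f ->
  (\int[m']_y f y = \int[m]_x f (phi x))%E.
Proof.
move=> mf; rewrite -[RHS]/(\int[m]_x (f \o phi) x)%E integralE [RHS]integralE.
rewrite (funepos_comp f phi) (funeneg_comp f phi); congr (_ - _)%E.
  exact: (law_ge0_integral (measurable_funepos mf) (funepos_ge0 f)).
exact: (law_ge0_integral (measurable_funeneg mf) (funeneg_ge0 f)).
Qed.

Lemma law_Rint (f : Y -> R) : measurable_fun setT f ->
  \int[m']_y f y = \int[m]_x f (phi x).
Proof.
by move=> mf; rewrite /Rintegral law_integral//; exact/measurable_EFinP.
Qed.

Lemma law_integ (f : Y -> R) : measurable_fun setT f ->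
  integ m' f <-> integ m (fun x => f (phi x)).
Proof.
move=> mf; split=> /integrableP[_ H]; apply/integrableP; split.
- by apply/measurable_EFinP; apply: measurableT_comp.
- rewrite -(@law_ge0_integral (fun y => `|(f y)%:E|)%E)//.
  by apply: measurableT_comp => //; exact/measurable_EFinP.
- exact/measurable_EFinP.
- rewrite law_ge0_integral//.
  by apply: measurableT_comp => //; exact/measurable_EFinP.
Qed.

End Law.

Section Independence.
Context dO (Omega : measurableType dO) (R : realType) (Q : probability Omega R).
Variable G : set (set Omega).
Hypotheses (sG : sigma_algebra setT G) (Gm : G `<=` measurable).

(** Adaptedness as plain measurability, with the sub-sigma-algebra
carried by the domain type; the closure lemmas for measurable functions then
apply to adapted processes unchanged. *)
Lemma measurable_wrtP dT (T : measurableType dT) (f : Omega -> T) :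
  measurable_wrt G f <-> measurable_fun setT (f : g_sigma_algebraType G -> T).
Proof.
have E : @measurable _ (g_sigma_algebraType G) = G by exact: sigma_algebra_id.
split=> [H _ B mB|H B mB]; first by rewrite setTI E; exact: H.
by have := H measurableT B mB; rewrite setTI E.
Qed.

Lemma measurable_coarse dT (T : measurableType dT) (f : Omega -> T) :
  measurable_fun setT (f : g_sigma_algebraType G -> T) -> measurable_fun setT f.
Proof.
by move=> /measurable_wrtP H _ B mB; rewrite setTI; apply: Gm; exact: H.
Qed.

Context dT (T : measurableType dT) (Z : Omega -> T) (L : probability T R).
Hypothesis mZ : measurable_fun setT Z.
Hypothesis ind : forall B C, G B -> measurable C ->
  (Q (B `&` Z @^-1` C) = Q B * L C)%E.

(** The joint law of the identity into the sub-sigma-algebra G and of Z is the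
product of Q restricted to G and of L, by uniqueness of product measures on
rectangles; the factorization is then Fubini. *)
Lemma indep_integral (zeta : Omega -> R) (f : T -> R) :
  measurable_fun setT (zeta : g_sigma_algebraType G -> R) ->
  integ Q zeta -> integ L f ->
  integ Q (fun w => zeta w * f (Z w)) /\
  \int[Q]_w (zeta w * f (Z w)) = \int[Q]_w zeta w * \int[L]_x f x.
Proof.
move=> mz iz iff.
have E : @measurable _ (g_sigma_algebraType G) = G by exact: sigma_algebra_id.
have mid : measurable_fun setT (id : Omega -> g_sigma_algebraType G).
  by move=> _ B; rewrite setTI preimage_id E; exact: Gm.
pose idm : {mfun Omega >-> g_sigma_algebraType G} :=
  HB.pack (id : Omega -> g_sigma_algebraType G) (isMeasurableFun.Build _ _ _ _ _ mid).
pose QG : probability _ R := distribution Q idm.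
have mphi : measurable_fun setT
    ((fun w => (w, Z w)) : Omega -> g_sigma_algebraType G * T).
  exact: measurable_fun_pair.
pose phi : {mfun Omega >-> (g_sigma_algebraType G * T)%type} :=
  HB.pack (fun w => (w, Z w)) (isMeasurableFun.Build _ _ _ _ _ mphi).
pose QP : probability _ R := distribution Q phi.
have QPE X : measurable X -> ((QG \x L) X = QP X)%E.
  apply: product_measure_unique => A B mA mB.
  have GA : G A by rewrite -E.
  exact: (ind GA mB).
pose F := fun z : g_sigma_algebraType G * T => zeta z.1 * f z.2.
have mff := integ_meas iff.
have mF : measurable_fun setT F.
  by apply: measurable_funM; apply: measurableT_comp.
have lawE X : measurable X -> ((QG \x L)%E X = Q ((fun w => (w, Z w)) @^-1` X))%E.
  by move=> mX; rewrite QPE.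
have mze : measurable_fun setT (EFin \o (zeta : g_sigma_algebraType G -> R)).
  exact/measurable_EFinP.
have izG : integ QG (zeta : g_sigma_algebraType G -> R).
  by apply/(law_integ mid) => //.
have iF : integ (QG \x L)%E F.
  apply/integrable12ltyP; first exact/measurable_EFinP.
  rewrite (eq_integral (fun x : g_sigma_algebraType G => `|zeta x|%:E * (\int[L]_y `|f y|)%:E)%E); last first.
    move=> x _; rewrite EFin_Rint; last exact: integ_norm.
    rewrite -ge0_integralZl_EFin//; last first.
      by apply/measurable_EFinP; apply: measurableT_comp.
    by apply: eq_integral => y _; rewrite /F /= normrM EFinM.
  have mza : measurable_fun setT (fun x : g_sigma_algebraType G => `|zeta x|%:E).
    by apply/measurable_EFinP; apply: measurableT_comp.
  rewrite (ge0_integralZr QG measurableT mza)//; last first.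
    by rewrite lee_fin; apply: Rint_ge0.
  rewrite muleC; apply: lte_mul_pinfty => //.
    by rewrite lee_fin; apply: Rint_ge0.
  by case/integrableP : izG.
split; first exact: ((law_integ mphi lawE mF).1 iF).
rewrite -(law_Rint mphi lawE mF) /Rintegral -integral12_prod_meas1//.
rewrite -fineM ?integrable_fin_num//; congr fine.
rewrite (eq_integral (fun x : g_sigma_algebraType G => (zeta x)%:E * (\int[L]_y f y)%:E)%E); last first.
  move=> x _; rewrite EFin_Rint// -integralZl//.
rewrite EFin_Rint// -EFin_Rint// integralZr//.
congr (_ * _)%E.
by rewrite (@law_integral _ _ _ _ R Q QG _ mid (fun _ _ => erefl)).
Qed.
End Independence.

Section Density.
Context d (T : measurableType d) (R : realType).
Variables (m m' : {measure set T -> \bar R}) (D : T -> R).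
Hypotheses (mD : measurable_fun setT D) (D0 : forall x, 0 <= D x).
Hypothesis mm' : forall B, measurable B ->
  (m' B = \int[m]_(x in B) (D x)%:E)%E.

Lemma density_integral (f : T -> \bar R) : measurable_fun setT f ->
  (\int[m']_x f x = \int[m]_x (f x * (D x)%:E))%E.
Proof.
move=> mf; rewrite integralE [RHS]integralE.
have Ep : (fun x => f x * (D x)%:E)^\+%E = (fun x => f^\+%E x * (D x)%:E)%E.
  by apply/funext => x; rewrite !unlock /= maxe_pMl ?lee_fin// mul0e.
have En : (fun x => f x * (D x)%:E)^\-%E = (fun x => f^\-%E x * (D x)%:E)%E.
  by apply/funext => x; rewrite !unlock /= maxe_pMl ?lee_fin// mul0e mulNe.
rewrite Ep En; congr (_ - _)%E.
  exact: (ge0_integral_density mD D0 mm' (measurable_funepos mf) (funepos_ge0 f)).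
exact: (ge0_integral_density mD D0 mm' (measurable_funeneg mf) (funeneg_ge0 f)).
Qed.

Lemma density_Rint (f : T -> R) : measurable_fun setT f ->
  \int[m']_x f x = \int[m]_x (f x * D x).
Proof.
move=> mf; rewrite /Rintegral density_integral//; last exact/measurable_EFinP.
Qed.

Lemma density_integ (f : T -> R) : measurable_fun setT f ->
  integ m' f <-> integ m (fun x => f x * D x).
Proof.
move=> mf.
have E : (\int[m']_x `|(EFin \o f) x| = \int[m]_x `|(f x * D x)%:E|)%E.
  rewrite (density_integral (f := fun x => `|(f x)%:E|%E)).
    apply: eq_integral => x _; rewrite EFinM abseM; congr (_ * _)%E.
    by rewrite gee0_abs ?lee_fin.
  by apply: measurableT_comp => //; exact/measurable_EFinP.
split=> /integrableP[_ H]; apply/integrableP; split.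
- by apply/measurable_EFinP; apply: measurable_funM.
- by rewrite -E.
- exact/measurable_EFinP.
- by rewrite E.
Qed.
End Density.

(** * Borel structure on matrices and joint measurability *)

Section BorelMatrix.
Variables (R : realType) (k n : nat).

Lemma open_measurable_mx (U : set 'M[R]_(k, n)) : open U -> measurable U.
Proof. by move=> oU; apply: sub_sigma_algebra. Qed.

Lemma continuous_measurable_mx (f : 'M[R]_(k, n) -> R) :
  continuous f -> measurable_fun setT f.
Proof.
move=> /continuousP cf; apply: (measurability _ (RGenOpens.measurableE R)).
move=> _ [_ [a [b ->] <-]]; rewrite setTI.
by apply: open_measurable_mx; apply: cf; exact: interval_open.
Qed.

Lemma measurable_coord i j : measurable_fun setT (fun M : 'M[R]_(k, n) => M i j).
Proof. by apply: continuous_measurable_mx; exact: coord_continuous. Qed.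

Definition ratbox (p q : 'M[rat]_(k, n)) : set 'M[R]_(k, n) :=
  [set M | forall i j, ratr (p i j) < M i j < ratr (q i j)].

(** Open sets of matrices are countable unions of boxes with rational
corners, whence measurability into matrices can be tested on entries. *)
Lemma open_ratbox (U : set 'M[R]_(k, n)) x : open U -> U x ->
  exists p q, ratbox p q x /\ ratbox p q `<=` U.
Proof.
move=> oU Ux; have /nbhs_ballP[e /= e0 eU] : nbhs x U by exact: open_nbhs_nbhs.
have H i j : exists pq : rat * rat, ratr pq.1 < x i j < ratr pq.2 /\
    forall y : R, ratr pq.1 < y < ratr pq.2 -> ball (x i j) e y.
  have /rat_in_itvoo[p] : x i j - e < x i j by rewrite ltrBlDr ltrDl.
  have /rat_in_itvoo[q] : x i j < x i j + e by rewrite ltrDl.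
  rewrite !in_itv/= => /andP[q1 q2] /andP[p1 p2].
  exists (p, q); split => /=; first by rewrite p2 q1.
  move=> y /andP[y1 y2]; rewrite /ball/= ltr_norml.
  by apply/andP; split; lra.
have [F FP] := choice (fun ij : 'I_k * 'I_n => H ij.1 ij.2).
pose f i j := F (i, j).
have fP i j : ratr (f i j).1 < x i j < ratr (f i j).2 /\
    forall y : R, ratr (f i j).1 < y < ratr (f i j).2 -> ball (x i j) e y.
  exact: (FP (i, j)).
exists (\matrix_(i, j) (f i j).1), (\matrix_(i, j) (f i j).2); split.
  by move=> i j; rewrite !mxE; exact: (fP i j).1.
move=> M HM; apply: eU; split=> // i j; apply: (fP i j).2.
by have := HM i j; rewrite !mxE.
Qed.

Lemma measurable_mx d (T : measurableType d) (D : set T) (f : T -> 'M[R]_(k, n)) :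
  (forall i j, measurable_fun D (fun x => f x i j)) -> measurable_fun D f.
Proof.
move=> mf mD; move: (mD).
apply: (@measurability _ _ T 'M[R]_(k, n) D f (@open 'M[R]_(k, n)) erefl).
move=> _ [U oU <-].
rewrite (_ : D `&` f @^-1` U = \bigcup_(pq : 'M[rat]_(k, n) * 'M[rat]_(k, n))
   (if pselect (ratbox pq.1 pq.2 `<=` U) then D `&` f @^-1` ratbox pq.1 pq.2 else set0)); last first.
  apply/seteqP; split=> [x [Dx Ux]|x [[p q] _]/=].
    have [p [q [Hx HU]]] := open_ratbox oU Ux.
    by exists (p, q) => //=; case: pselect.
  by case: (pselect _) => // HU [Dx Hx]; split=> //; exact: HU.
apply: countable_bigcupT_measurable => [//|[p q]/=].
case: (pselect (ratbox p q `<=` U)) => HU /=; last exact: measurable0.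
rewrite (_ : _ `&` _ = D `&` \bigcap_(ij in [set: 'I_k * 'I_n])
   (D `&` (fun x => f x ij.1 ij.2) @^-1` `]ratr (p ij.1 ij.2), ratr (q ij.1 ij.2)[)); last first.
  apply/seteqP; split=> [x [Dx H]|x [Dx H]]; split=> //.
    by move=> [i j] _; split=> //=; rewrite in_itv/=; exact: H.
  by move=> i j; have [_] := H (i, j) I; rewrite /= in_itv.
apply: measurableI => //; apply: fin_bigcap_measurable => // -[i j] _.
exact: mf.
Qed.
End BorelMatrix.

Lemma measurable_fun_sumr d (T : measurableType d) (R : realType) (D : set T) (I : Type)
    (s : seq I) (P : pred I) (h : I -> T -> R) :
  (forall i, P i -> measurable_fun D (h i)) ->
  measurable_fun D (fun x => \sum_(i <- s | P i) h i x).
Proof.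
move=> H; elim: s => [|i s IH].
  by rewrite (_ : (fun _ => _) = cst 0)//; apply/funext => x; rewrite big_nil.
case: (boolP (P i)) => Pi.
  rewrite (_ : (fun _ => _) = (fun x => h i x + \sum_(j <- s | P j) h j x)).
    by apply: measurable_funD => //; exact: H.
  by apply/funext => x; rewrite big_cons Pi.
rewrite (_ : (fun _ => _) = (fun x => \sum_(j <- s | P j) h j x))//.
by apply/funext => x; rewrite big_cons (negbTE Pi).
Qed.

Lemma measurable_entry d (T : measurableType d) (R : realType) (k n : nat) (D : set T)
    (f : T -> 'M[R]_(k, n)) i j :
  measurable_fun D f -> measurable_fun D (fun x => f x i j).
Proof. by move=> mf; apply: (measurableT_comp (measurable_coord i j)). Qed.

(** f is the pointwise limit of (v, w) |-> f (floor (N v) / N) w, which is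
piecewise constant in v on countably many intervals. *)
Lemma measurable_joint_real d (T : measurableType d) (R : realType) (f : R -> T -> R) :
  (forall v, measurable_fun setT (f v)) -> (forall w, continuous (f ^~ w)) ->
  measurable_fun setT (fun z : R * T => f z.1 z.2).
Proof.
move=> mf cf.
pose s (N : nat) (v : R) : R := (Num.floor (v * N.+1%:R))%:~R / N.+1%:R.
have sv v : s ^~ v @ \oo --> v.
  apply/cvgrPdist_le => e e0; near=> N.
  have N0 : 0 < N.+1%:R :> R by [].
  have -> : v - s N v = (v * N.+1%:R - (Num.floor (v * N.+1%:R))%:~R) / N.+1%:R.
    by rewrite mulrBl mulfK ?gt_eqF.
  have /andP[h1 h2] := floor_itv (v * N.+1%:R).
  rewrite ger0_norm; last by rewrite divr_ge0 ?subr_ge0.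
  rewrite ler_pdivrMr//; apply: (@le_trans _ _ 1).
    by rewrite lerBlDl ltW// -intrD1.
  rewrite -ler_pdivrMr// div1r ltW//.
  near: N; exact: near_infty_natSinv_lt (PosNum e0).
apply: (@measurable_fun_cvg _ _ _ setT (fun N (z : R * T) => f (s N z.1) z.2)) => //.
  move=> N _ B mB; rewrite setTI.
  rewrite (_ : _ @^-1` _ = \bigcup_(k : int)
     ([set v : R | Num.floor (v * N.+1%:R) == k] `*` (f (k%:~R / N.+1%:R) @^-1` B))); last first.
    apply/seteqP; split=> [[v w]/= Hz|[v w][k _]/= [/eqP E]].
      by exists (Num.floor (v * N.+1%:R)) => //; split=> /=.
    by rewrite /s E.
  apply: countable_bigcupT_measurable => // k; apply: measurableX.
    rewrite (_ : [set _ | _] = `[k%:~R / N.+1%:R, (k + 1)%:~R / N.+1%:R[%classic)//.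
    by apply/seteqP; split=> v /=; rewrite floor_eq in_itv/= ler_pdivrMr// ltr_pdivlMr.
  by have := mf (k%:~R / N.+1%:R) measurableT B mB; rewrite setTI.
move=> [v w] _ /=.
exact: (cvg_comp _ _ (sv v) (cf w v)).
Unshelve. all: by end_near. Qed.

Lemma measurable_joint d (T : measurableType d) (R : realType) (k n : nat)
    (Z : R -> T -> 'M[R]_(k, n)) :
  (forall v, measurable_fun setT (Z v)) -> (forall w, continuous (Z ^~ w)) ->
  measurable_fun setT (fun z : R * T => Z z.1 z.2).
Proof.
move=> mZ cZ; apply: measurable_mx => i j.
apply: (@measurable_joint_real _ _ _ (fun v w => Z v w i j)).
  by move=> v; exact: measurable_entry.
move=> w v; apply: (@continuous_comp _ _ _ (Z ^~ w) (fun M => M i j)); first exact: cZ.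
exact: coord_continuous.
Qed.

(** * Moments of the centred normal law *)

Section Gauss.
Variable R : realType.
Notation leb := (@lebesgue_measure R).
Implicit Types (x s : R).

(** The integral over the line is the limit of the integrals over [-n, n],
each computed from the primitive. *)
Lemma integral_line_FTC (g G : R -> R) :
  continuous g -> (forall x, is_derive x 1 G (g x)) -> integ leb g ->
  (fun n : nat => G n%:R - G (- n%:R)) @ \oo --> (0:R) ->
  \int[leb]_x g x = 0.
Proof.
move=> cg dG ig lG.
have E n : (0 < n)%N -> (\int[leb]_x ((g x * \1_`[- n%:R, n%:R] x)%:E) = (G n%:R - G (- n%:R))%:E)%E.
  move=> n0; have nn : - n%:R < n%:R :> R by rewrite gtrN// ltr0n.
  rewrite EFinB -(@continuous_FTC2 _ g G _ _ nn) //; first last.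
  - by move=> x _; rewrite derive1E; apply: (@derive_val _ _ _ _ _ _ _ (dG x)).
  - split.
    + by move=> x _; apply: ex_derive.
    + by apply: cvg_at_right_filter; apply: differentiable_continuous; apply/derivable1_diffP.
    + by apply: cvg_at_left_filter; apply: differentiable_continuous; apply/derivable1_diffP.
  - by apply: continuous_subspaceT.
  rewrite [RHS]integral_mkcond; apply: eq_integral => x _.
  by rewrite epatch_indic EFinM.
have D : (fun n : nat => \int[leb]_x ((g x * \1_`[- n%:R, n%:R] x)%:E))%E @ \oo -->
    (\int[leb]_x (g x)%:E)%E.
  have mg := integ_meas ig.
  have [] // := @dominated_convergence _ _ _ leb setT measurableT
    (fun (n : nat) x => (g x * \1_`[- n%:R, n%:R] x)%:E) (EFin \o g) (fun x => `|g x|%:E).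
  - by move=> n; apply/measurable_EFinP; apply: measurable_funM.
  - exact/measurable_EFinP.
  - apply: aeW => x _.
    apply: cvg_near_cst; near=> n.
    rewrite /= indicE mem_set ?mulr1//= in_itv/= -ler_norml.
    near: n; exact: nbhs_infty_ger.
  - exact: (integ_norm ig).
  - apply: aeW => x n _; rewrite lee_fin normrM ler_piMr//.
    by rewrite indicE; case: (_ \in _); rewrite ?normr1 ?normr0.
have H : (fun n : nat => (G n%:R - G (- n%:R))%:E) @ \oo --> 0%:E.
  by apply: cvg_EFin => //; exact: nearW.
rewrite /Rintegral; suff -> : (\int[leb]_x (g x)%:E = 0)%E by [].
apply: (cvg_unique _ D); first exact: ereal_hausdorff.
apply: cvg_trans H; apply: near_eq_cvg; near=> n.
by rewrite E//; near: n; exists 1%N.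
Unshelve. all: by end_near. Qed.

Section Moments.
Variable s : R.
Hypothesis s0 : 0 < s.
Let p := normal_pdf 0 s.

Lemma normal_pdf_expR x : p x = normal_peak s * expR (- x ^+ 2 / (s ^+ 2 *+ 2)).
Proof. by rewrite /p normal_pdfE ?gt_eqF// /normal_fun subr0. Qed.

Lemma is_derive_normal_pdf x : is_derive x 1 p (- (x / s ^+ 2 * p x)).
Proof.
have -> : p = (fun y => normal_peak s * expR (- y ^+ 2 / (s ^+ 2 *+ 2))).
  by apply/funext => y; exact: normal_pdf_expR.
apply: is_derive_eq.
rewrite /GRing.scale /=.
set e := expR _.
have sn : s != 0 by rewrite gt_eqF.
by field.
Qed.

(** A third absolute moment costs nothing if the standard deviation is doubled,
because z^3 exp(- 3/8 z^2) <= 16. Integrability and a bound of the right order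
in s follow from the total mass of the wider density. *)
Lemma normal_pdf_cube x : `|x| ^+ 3 * p x <= 32 * s ^+ 3 * normal_pdf 0 (2 * s) x.
Proof.
have sn : s != 0 by rewrite gt_eqF.
rewrite normal_pdf_expR normal_pdfE ?mulf_neq0 ?pnatr_eq0// /normal_fun subr0.
have -> : normal_peak (2 * s) = normal_peak s / 2.
  rewrite /normal_peak (_ : (2 * s) ^+ 2 * pi *+ 2 = 2 ^+ 2 * (s ^+ 2 * pi *+ 2)).
    by rewrite sqrtrM ?sqr_ge0// sqrtr_sqr ger0_norm// invfM mulrC.
  by rewrite exprMn -mulrA -mulrnAr.
set z := `|x| / s; set y := 3 / 8 * z ^+ 2.
have zx : x ^+ 2 = z ^+ 2 * s ^+ 2 by rewrite /z exprMn exprVn mulfVK ?expf_neq0// real_normK ?num_real.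
have z0 : 0 <= z by rewrite divr_ge0// ltW.
have -> : - x ^+ 2 / (s ^+ 2 *+ 2) = - x ^+ 2 / ((2 * s) ^+ 2 *+ 2) - y.
  by rewrite zx /y; field.
have -> : `|x| = z * s by rewrite /z mulfVK.
rewrite expRD expRN.
set E := expR _; set pk := normal_peak s.
have pk0 : 0 < pk by apply: normal_peak_gt0.
have E0 : 0 < E by exact: expR_gt0.
have ey : 16 * expR y >= z ^+ 3.
  have h1 : 1 + y / 2 <= expR (y / 2) by exact: expR_ge1Dx.
  have -> : expR y = expR (y / 2) ^+ 2 by rewrite expr2 -expRD; congr expR; field.
  apply: (@le_trans _ _ (16 * (1 + y / 2) ^+ 2)).
    have : 0 <= z ^+ 2 * (1 - z) ^+ 2 by rewrite mulr_ge0 ?sqr_ge0.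
    rewrite /y; nra.
  rewrite ler_pM2l// lerXn2r// nnegrE; last exact: expR_ge0.
  by rewrite /y addr_ge0// divr_ge0// mulr_ge0// ?sqr_ge0// divr_ge0.
have ey0 : 0 < expR y by exact: expR_gt0.
have -> : (z * s) ^+ 3 * (pk * (E / expR y)) = (z ^+ 3 / expR y) * (s ^+ 3 * pk * E).
  by field; rewrite gt_eqF.
have -> : 32 * s ^+ 3 * (pk / 2 * E) = 16 * (s ^+ 3 * pk * E) by field.
apply: ler_wpM2r; last by rewrite ler_pdivrMr.
by rewrite !mulr_ge0// ?exprn_ge0 ?ltW.
Qed.

Lemma normal_pdf_continuous : continuous p.
Proof. by apply: continuous_normal_pdf; rewrite gt_eqF. Qed.

Let p_ge0 x : 0 <= p x. Proof. exact: normal_pdf_ge0. Qed.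

Let mp : measurable_fun setT p. Proof. exact: measurable_normal_pdf. Qed.

Lemma integ_cube : integ leb (fun x => `|x| ^+ 3 * p x).
Proof.
apply: (@integ_le _ _ _ leb _ (fun x => 32 * s ^+ 3 * normal_pdf 0 (2 * s) x)).
- apply: measurable_funM => //; apply: measurable_funX; exact: normr_measurable.
- by apply: integZ; exact: integrable_normal_pdf.
- by move=> x; rewrite ger0_norm ?normal_pdf_cube// mulr_ge0// exprn_ge0.
Qed.

Lemma integ_pow n : (n <= 3)%N -> integ leb (fun x => `|x| ^+ n * p x).
Proof.
move=> n3; apply: (@integ_le _ _ _ leb _ (fun x => p x + `|x| ^+ 3 * p x)).
- apply: measurable_funM => //; apply: measurable_funX; exact: normr_measurable.
- by apply: integD; [exact: integrable_normal_pdf|exact: integ_cube].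
- move=> x; rewrite ger0_norm; last by rewrite mulr_ge0// exprn_ge0.
  rewrite -[X in _ <= X + _]mul1r -mulrDl ler_wpM2r//.
  have [x1|x1] := leP `|x| 1.
    by apply: (@le_trans _ _ 1); rewrite ?exprn_ile1// lerDl exprn_ge0.
  apply: (@le_trans _ _ (`|x| ^+ 3)); first by rewrite ler_eXn2l// ltW.
  by rewrite lerDr.
Qed.

Lemma normal_tail : (fun n : nat => n%:R * p n%:R) @ \oo --> (0 : R).
Proof.
pose C := 32 * s ^+ 3 * normal_peak (2 * s).
have C0 : 0 <= C by rewrite !mulr_ge0// ?exprn_ge0 ?normal_peak_ge0// ltW.
have H n : (0 < n)%N -> n%:R * p n%:R <= 2 * C * harmonic n.
  move=> n0; have n0' : 0 < n%:R :> R by rewrite ltr0n.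
  apply: (@le_trans _ _ (C / n%:R)); last first.
    rewrite /harmonic/= ler_pdivlMr ?ltr0n// mulrAC ler_pdivrMr//.
    have n1 : 1 <= n%:R :> R by rewrite ler1n.
    rewrite -natr1 [2 * C]mulrC -(mulrA C 2) ler_wpM2l//; lra.
  rewrite ler_pdivlMr//.
  have := normal_pdf_cube n%:R; rewrite ger0_norm// => h.
  apply: (@le_trans _ _ (n%:R ^+ 3 * p n%:R)).
    rewrite mulrAC -expr2 ler_wpM2r// ler_weXn2l// ler1n//.
  apply: (le_trans h); rewrite /C ler_wpM2l//.
    by rewrite !mulr_ge0// ?exprn_ge0// ltW.
  by apply: normal_pdf_ub; rewrite mulf_neq0// gt_eqF.
apply: (@squeeze_cvgr _ _ _ _ (fun=> 0) (fun n : nat => 2 * C * harmonic n)).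
- near=> n; rewrite mulr_ge0//= H//.
  by near: n; exists 1%N.
- exact: cvg_cst.
- by rewrite -[X in _ --> X](mulr0 (2 * C)); apply: cvgMr; exact: cvg_harmonic.
Unshelve. all: by end_near. Qed.

Lemma normal_pdf_even x : p (- x) = p x.
Proof. by rewrite !normal_pdf_expR sqrrN. Qed.

(** - s^2 p is a primitive of x p(x). *)
Lemma int_normal1 : \int[leb]_x (x * p x) = 0.
Proof.
apply: (@integral_line_FTC (fun x => x * p x) (fun x => - s ^+ 2 * p x)).
- by move=> x; apply: cvgM; [exact: cvg_id|exact: normal_pdf_continuous].
- move=> x; have d := is_derive_normal_pdf x; apply: is_derive_eq.
  by rewrite /GRing.scale/=; field; rewrite gt_eqF.
- apply: (@integ_le _ _ _ leb _ (fun x => `|x| ^+ 1 * p x)); first exact: measurable_funM.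
    exact: integ_pow.
  by move=> x; rewrite normrM (ger0_norm (p_ge0 x)).
- apply: cvg_near_cst; apply: nearW => n.
  by rewrite normal_pdf_even subrr.
Qed.

(** - s^2 x p(x) is a primitive of x^2 p(x) - s^2 p(x). *)
Lemma int_normal2 : \int[leb]_x (x ^+ 2 * p x) = s ^+ 2.
Proof.
have ip : integ leb p by exact: integrable_normal_pdf.
have i2 : integ leb (fun x => x ^+ 2 * p x).
  apply: (eq_integ _ (integ_pow (n := 2) _)) => // x.
  by rewrite real_normK// num_real.
suff : \int[leb]_x (x ^+ 2 * p x - s ^+ 2 * p x) = 0.
  rewrite RintB ?RintZ//; last exact: integZ.
  have -> : \int[leb]_x p x = 1 by rewrite /Rintegral integral_normal_pdf.
  by move=> /eqP; rewrite mulr1 subr_eq0 => /eqP.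
apply: (@integral_line_FTC (fun x => x ^+ 2 * p x - s ^+ 2 * p x)
  (fun x => - s ^+ 2 * (x * p x))).
- move=> x; apply: cvgB; apply: cvgM; try exact: normal_pdf_continuous.
    by apply: exprn_continuous.
  exact: cvg_cst.
- move=> x; have d := is_derive_normal_pdf x; apply: is_derive_eq.
  by rewrite /GRing.scale/=; field; rewrite gt_eqF.
- by apply: integB => //; exact: integZ.
- rewrite (_ : (fun _ => _) = (fun n : nat => - (s ^+ 2 * 2) * (n%:R * p n%:R))).
    by rewrite -[X in _ --> X](mulr0 (- (s ^+ 2 * 2))); apply: cvgMr; exact: normal_tail.
  by apply/funext => n; rewrite normal_pdf_even; ring.
Qed.

Lemma normal_probE (f : R -> R) : measurable_fun setT f ->
  (integ (normal_prob 0 s) f <-> integ leb (fun x => f x * p x)) /\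
  \int[normal_prob 0 s]_x f x = \int[leb]_x (f x * p x).
Proof.
move=> mf; split.
  by apply: density_integ => //.
by apply: density_Rint => //.
Qed.

Lemma normal_moment1 : integ (normal_prob 0 s) (fun x => x) /\
  \int[normal_prob 0 s]_x x = 0.
Proof.
have [h1 h2] := @normal_probE (fun x => x) (@measurable_id _ _ _).
rewrite h2 int_normal1; split=> //; apply/h1.
apply: (@integ_le _ _ _ leb _ (fun x => `|x| ^+ 1 * p x)); first exact: measurable_funM.
  exact: integ_pow.
by move=> x; rewrite normrM (ger0_norm (p_ge0 x)).
Qed.

Lemma normal_moment2 : integ (normal_prob 0 s) (fun x => x ^+ 2) /\
  \int[normal_prob 0 s]_x (x ^+ 2) = s ^+ 2.
Proof.
have [h1 h2] := @normal_probE (fun x => x ^+ 2) (@measurable_funX _ _ _ _ _ 2 (@measurable_id _ _ _)).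
rewrite h2 int_normal2; split=> //; apply/h1.
apply: (eq_integ _ (integ_pow (n := 2) _)) => // x.
by rewrite real_normK// num_real.
Qed.

Lemma normal_moment3 : integ (normal_prob 0 s) (fun x => `|x| ^+ 3) /\
  \int[normal_prob 0 s]_x (`|x| ^+ 3) <= 32 * s ^+ 3.
Proof.
have m3 : measurable_fun setT (fun x : R => `|x| ^+ 3).
  by apply: measurable_funX; exact: normr_measurable.
have [h1 h2] := normal_probE m3.
split; first by apply/h1; exact: integ_cube.
rewrite h2; apply: (@le_trans _ _ (\int[leb]_x (32 * s ^+ 3 * normal_pdf 0 (2 * s) x))).
  apply: Rint_le; [exact: integ_cube| |exact: normal_pdf_cube].
  by apply: integZ; exact: integrable_normal_pdf.
rewrite RintZ; last exact: integrable_normal_pdf.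
by rewrite /Rintegral integral_normal_pdf/= mulr1.
Qed.

End Moments.
End Gauss.

(** * Taylor expansion of test functions *)

Section Taylor1D.
Variable R : realType.

(** First order expansion with the derivative compared to an arbitrary
constant c instead of its value at 0: this is what the coordinatewise
expansions below need. *)
Lemma mvt_bound (f f' : R -> R) (c B t : R) :
  (forall u : R, is_derive u (1 : R) f (f' u)) ->
  (forall u, `|u| <= `|t| -> `|f' u - c| <= B) ->
  `|f t - f 0 - t * c| <= `|t| * B.
Proof.
move=> df Hb.
have cf : continuous f.
  move=> u; apply: differentiable_continuous; apply/derivable1_diffP.
  exact: ex_derive.
have cfs (a b : R) : {within `[a, b], continuous f} by apply: continuous_subspaceT.
have [t0|t0] := leP 0 t.
  have [u] := MVT_segment t0 (fun x _ => df x) (@cfs _ _).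
  rewrite in_itv/= subr0 => /andP[u0 ut] ->.
  rewrite mulrC -mulrBr normrM ler_wpM2l//; apply: Hb.
  by rewrite !ger0_norm.
have [u] := MVT_segment (ltW t0) (fun x _ => df x) (@cfs _ _).
rewrite in_itv/= sub0r => /andP[u0 ut] E.
have -> : f t - f 0 - t * c = t * (f' u - c).
  have -> : f t - f 0 = - (f 0 - f t) by rewrite opprB.
  by rewrite E; ring.
rewrite normrM ler_wpM2l//; apply: Hb.
by rewrite !ler0_norm ?lerN2// ltW.
Qed.

Lemma is_derive_quad (f : R -> R) (t a C : R) :
  (forall s, `|f (t + s) - f t - s * a| <= C * s ^+ 2) -> is_derive t (1 : R) f a.
Proof.
move=> H.
have cv : (fun s => s^-1 *: (f (s *: (1 : R) + t) - f t)) @ 0^' --> a.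
  apply/cvgrPdist_le => e e0.
  near=> s.
  have s0 : s != 0 by near: s; exact: nbhs_dnbhs_neq.
  rewrite /GRing.scale/= mulr1 [s + t]addrC.
  have -> : a - s^-1 * (f (t + s) - f t) = - (s^-1 * (f (t + s) - f t - s * a)).
    by field.
  rewrite normrN normrM normfV ler_pdivrMl ?normr_gt0//.
  apply: (le_trans (H s)).
  have -> : s ^+ 2 = `|s| * `|s| by rewrite -expr2 real_normK// num_real.
  rewrite mulrCA ler_wpM2l//.
  apply: (@le_trans _ _ (`|C| * `|s|)); first by rewrite ler_wpM2r// ler_norm.
  apply: (@le_trans _ _ ((`|C| + 1) * `|s|)); first by rewrite ler_wpM2r// lerDl.
  rewrite -ler_pdivlMl ?ltr_wpDl//.
  near: s; apply: dnbhs0_le; by rewrite mulr_gt0// invr_gt0 ltr_wpDl.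
apply: DeriveDef; first by apply/cvg_ex; exists a.
by rewrite /derive; apply: cvg_lim.
Unshelve. all: by end_near. Qed.

End Taylor1D.

Section TestFun.
Variables (R : realType) (d : nat).
Implicit Types (h : 'rV[R]_d -> R) (x y : 'rV[R]_d).

Lemma test_partial h i : test_function h -> test_function (partial i h).
Proof.
move=> [sh ch]; split.
  by move=> s; have := sh (rcons s i); rewrite -cats1 foldr_cat.
have sub : [set x | partial i h x != 0] `<=` closure [set x | h x != 0].
  move=> x; apply: contraPP => nx; apply/negP; rewrite negbK; apply/eqP.
  have nU : \forall y \near x, h y = 0.
    have : nbhs x (~` closure [set x | h x != 0]).
      by apply: open_nbhs_nbhs; split=> //; apply: closed_openC; exact: closed_closure.
    apply: filterS => y ny; apply/eqP; apply: contrapT => /negP hy; apply: ny.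
    exact: subset_closure.
  rewrite /partial (near_eq_derive (g := cst 0)) ?derive_cst//.
apply: (subclosed_compact _ ch); first exact: closed_closure.
rewrite [X in _ `<=` X](closure_id (closure [set x | h x != 0])).1; last exact: closed_closure.
exact: closureS.
Qed.

Lemma test_cont h : test_function h -> continuous h.
Proof. by move=> [sh _]; exact: (sh [::]).1. Qed.

Lemma test_derivable h x i : test_function h -> derivable h x 'e_i.
Proof. by move=> [sh _]; exact: (sh [::]).2. Qed.

Lemma test_measurable h : test_function h -> measurable_fun setT h.
Proof. by move=> /test_cont; exact: continuous_measurable_mx. Qed.

(** A test function is continuous and vanishes off a compact set. *)
Lemma test_bounded h : test_function h -> exists2 K, 0 <= K & forall x, `|h x| <= K.
Proof.
move=> th; have [_ cK] := th.
have : compact (h @` closure [set x | h x != 0]).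
  by apply: continuous_compact => //; apply: continuous_subspaceT; exact: test_cont.
move=> /compact_bounded[M [_ HM]].
exists (`|M| + 1); first by rewrite addr_ge0.
move=> x; have [->|hx] := eqVneq (h x) 0; first by rewrite normr0 addr_ge0.
apply: HM; first by rewrite (le_lt_trans (ler_norm M))// ltrDl.
by exists x => //; exact: subset_closure.
Qed.

Lemma is_derive_line h x i (t : R) : test_function h ->
  is_derive t (1 : R) (fun u => h (x + u *: 'e_i)) (partial i h (x + t *: 'e_i)).
Proof.
move=> th; have D := @test_derivable h (x + t *: 'e_i) i th.
have E : (fun s : R => s^-1 *: (((fun u => h (x + u *: 'e_i)) \o shift t) (s *: (1 : R)) - h (x + t *: 'e_i)))
  = (fun s : R => s^-1 *: ((h \o shift (x + t *: 'e_i)) (s *: 'e_i) - h (x + t *: 'e_i))).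
  apply/funext => s /=; congr (_ *: (h _ - _)).
  by rewrite -[s *: (1 : R)]/(s * 1) mulr1 scalerDl addrCA.
apply: DeriveDef; first by rewrite /derivable E.
by rewrite /partial /derive E.
Qed.

(** Corners of the coordinatewise path from 0 to y. *)
Definition trunc_row y (k : nat) : 'rV[R]_d := \row_i (if (i < k)%N then y 0 i else 0).

Lemma trunc_row0 y : trunc_row y 0 = 0.
Proof. by apply/rowP => i; rewrite !mxE. Qed.

Lemma trunc_rowd y : trunc_row y d = y.
Proof. by apply/rowP => i; rewrite !mxE ltn_ord. Qed.

Lemma trunc_rowS y (k : 'I_d) : trunc_row y k.+1 = trunc_row y k + y 0 k *: 'e_k.
Proof.
apply/rowP => i; rewrite !mxE /= ltnS leq_eqVlt.
have [->|ik] := eqVneq i k; first by rewrite eqxx ltnn /= mulr1 add0r.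
have -> : (i == k :> nat) = false by apply/negbTE.
by rewrite /= mulr0 addr0.
Qed.

Lemma entry_norm k n (M : 'M[R]_(k, n)) i j : `|M i j| <= `|M|.
Proof.
rewrite [leRHS]/Num.norm /= mx_normrE; apply/bigmax_geP; right => /=.
by exists (i, j).
Qed.

Lemma norm_mx_le k n (M : 'M[R]_(k, n)) c : 0 <= c ->
  (forall i j, `|M i j| <= c) -> `|M| <= c.
Proof.
move=> c0 H; rewrite [leLHS]/Num.norm /= mx_normrE; apply/bigmax_leP; split=> //.
Qed.

(** Smoothness is known only through partial derivatives, so increments are
taken along a path that changes one coordinate at a time, and [mvt_bound] is
applied on each edge. *)
Lemma telescope_line h x y (c : 'I_d -> R) (B : 'I_d -> R) : test_function h ->
  (forall (k : 'I_d) u, `|u| <= `|y 0 k| ->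
     `|partial k h (x + trunc_row y k + u *: 'e_k) - c k| <= B k) ->
  `|h (x + y) - h x - \sum_k y 0 k * c k| <= \sum_k `|y 0 k| * B k.
Proof.
move=> th HB.
have -> : h (x + y) - h x = \sum_(k < d) (h (x + trunc_row y k.+1) - h (x + trunc_row y k)).
  rewrite -{1}(trunc_rowd y) -[X in _ - h X](addr0 x) -(trunc_row0 y).
  by rewrite -(big_mkord xpredT (fun k => h (x + trunc_row y k.+1) - h (x + trunc_row y k)))
    telescope_sumr.
rewrite -sumrB; apply: (le_trans (ler_norm_sum _ _ _)); apply: ler_sum => k _.
have := @mvt_bound R (fun u => h (x + trunc_row y k + u *: 'e_k))
  (fun u => partial k h (x + trunc_row y k + u *: 'e_k)) (c k) (B k) (y 0 k)
  (fun u => @is_derive_line _ _ _ _ th) (HB k).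
by rewrite scale0r addr0 trunc_rowS addrA.
Qed.

Lemma trunc_row_norm y (k : 'I_d) (u : R) : `|u| <= `|y 0 k| ->
  `|trunc_row y k + u *: 'e_k| <= `|y|.
Proof.
move=> uk; apply: norm_mx_le => // i j; rewrite !mxE ord1 eqxx /=.
have [->|jk] := eqVneq j k.
  by rewrite ltnn add0r mulr1 (le_trans uk)// entry_norm.
rewrite mulr0 addr0; case: ifP => _; first exact: entry_norm.
by rewrite normr0.
Qed.

Lemma taylor1 h : test_function h ->
  exists2 K, 0 <= K & forall x y, `|h (x + y) - h x| <= K * `|y|.
Proof.
move=> th.
have /choice[K HK] : forall k : 'I_d, exists Kk : R, 0 <= Kk /\ forall x, `|partial k h x| <= Kk.
  by move=> k; have [B B0 HB] := test_bounded (test_partial k th); exists B.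
exists (\sum_k K k); first by apply: sumr_ge0 => k _; exact: (HK k).1.
move=> x y; have := @telescope_line h x y (fun=> 0) K th.
rewrite big1 => [|k _]; last by rewrite mulr0.
rewrite subr0 mulr_suml => H; apply: (le_trans (H _)).
  by move=> k u _; rewrite subr0; exact: (HK k).2.
by apply: ler_sum => k _; rewrite mulrC ler_wpM2l ?(HK k).1// entry_norm.
Qed.

(** Along the coordinatewise path the partial derivative at a corner is
within O(|y|) of its value at x, by [taylor1] for the partial derivatives. *)
Lemma taylor2 h : test_function h ->
  exists2 K, 0 <= K & forall x y,
    `|h (x + y) - h x - \sum_k y 0 k * partial k h x| <= K * `|y| ^+ 2.
Proof.
move=> th.
have /choice[K HK] : forall k : 'I_d, exists Kk : R, 0 <= Kk /\
    forall x y, `|partial k h (x + y) - partial k h x| <= Kk * `|y|.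
  by move=> k; have [B B0 HB] := taylor1 (test_partial k th); exists B.
exists (\sum_k K k); first by apply: sumr_ge0 => k _; exact: (HK k).1.
move=> x y.
apply: (le_trans (@telescope_line h x y (fun k => partial k h x) (fun k => K k * `|y|) th _)).
  move=> k u uk; rewrite -addrA; apply: (le_trans ((HK k).2 _ _)).
  by rewrite ler_wpM2l ?(HK k).1// trunc_row_norm.
rewrite mulr_suml; apply: ler_sum => k _.
by rewrite mulrCA expr2 ler_wpM2l ?(HK k).1// ler_wpM2r// entry_norm.
Qed.

(** By [taylor2], h is differentiable along the line from x to x + y, with the
expected derivative. The mean value inequality for h (x + t y) minus its
quadratic expansion in t leaves the second order remainders of the partial
derivatives. *)
Lemma taylor3 h : test_function h ->
  exists2 K, 0 <= K & forall x y,
    `|h (x + y) - h x - \sum_i y 0 i * partial i h x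
      - 2^-1 * \sum_i \sum_j y 0 i * y 0 j * partial i (partial j h) x| <= K * `|y| ^+ 3.
Proof.
move=> th.
have [K0 K00 HK0] := taylor2 th.
have /choice[K HK] : forall k : 'I_d, exists Kk : R, 0 <= Kk /\
    forall x y, `|partial k h (x + y) - partial k h x
      - \sum_j y 0 j * partial j (partial k h) x| <= Kk * `|y| ^+ 2.
  by move=> k; have [B B0 HB] := taylor2 (test_partial k th); exists B.
exists (\sum_k K k); first by apply: sumr_ge0 => k _; exact: (HK k).1.
move=> x y.
pose c1 := \sum_i y 0 i * partial i h x.
pose c2 := \sum_i \sum_j y 0 i * y 0 j * partial i (partial j h) x.
pose phi (t : R) := h (x + t *: y).
pose phi' (t : R) := \sum_k y 0 k * partial k h (x + t *: y).
have dphi (t : R) : is_derive t (1 : R) phi (phi' t).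
  apply: (@is_derive_quad _ _ _ _ (K0 * `|y| ^+ 2)) => s.
  have := HK0 (x + t *: y) (s *: y).
  rewrite -(addrA x) -scalerDl normrZ exprMn real_normK ?num_real// mulrA mulrAC.
  congr (`|_ - _| <= _); rewrite /phi' mulr_sumr; apply: eq_bigr => k _.
  by rewrite mxE mulrA.
pose G (t : R) := phi t - t * c1 - 2^-1 * t ^+ 2 * c2.
have dG (t : R) : is_derive t (1 : R) G (phi' t - c1 - t * c2).
  have dp := dphi t; apply: is_derive_eq.
  by rewrite /GRing.scale/=; field.
have E : h (x + y) - h x - c1 - 2^-1 * c2 = G 1 - G 0 - 1 * 0.
  by rewrite /G /phi scale1r scale0r addr0; ring.
rewrite -/c1 -/c2 E.
apply: (le_trans (mvt_bound (B := (\sum_k K k) * `|y| ^+ 3) dG _)); last first.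
  by rewrite normr1 mul1r.
move=> u; rewrite normr1 => u1; rewrite subr0.
have -> : phi' u - c1 - u * c2 = \sum_k y 0 k * (partial k h (x + u *: y) - partial k h x
    - \sum_j (u *: y) 0 j * partial j (partial k h) x).
  rewrite /phi' /c1 /c2 exchange_big/= mulr_sumr -!sumrB; apply: eq_bigr => k _.
  rewrite !mulrBr; congr (_ - _); rewrite !mulr_sumr; apply: eq_bigr => j _.
  by rewrite mxE; ring.
apply: (le_trans (ler_norm_sum _ _ _)); rewrite mulr_suml; apply: ler_sum => k _.
rewrite normrM; apply: (@le_trans _ _ (`|y| * (K k * `|y| ^+ 2))).
  apply: ler_pM => //; first exact: entry_norm.
  apply: (le_trans ((HK k).2 _ _)); rewrite ler_wpM2l ?(HK k).1//.
  by rewrite normrZ exprMn ler_piMl ?exprn_ge0// exprn_ile1.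
by rewrite mulrCA -exprS.
Qed.

End TestFun.

(** * Brownian increments *)

(** Replacing t by max s t turns continuity on [s, oo) into continuity on the
line, and membership in [s, oo) is no longer a side condition. *)
Lemma continuous_clamp (R : realType) (T : topologicalType) (s : R) (f : R -> T) :
  {within `[s, +oo[, continuous f} -> continuous (fun t => f (Num.max s t)).
Proof.
move=> /subspace_continuousP cf t.
have ms : `[s, +oo[%classic (Num.max s t) by rewrite /= in_itv/= andbT le_max lexx.
apply: (cvg_comp (Num.max s) f _ (cf _ ms)) => A hA.
have cm : continuous (fun t : R => Num.max s t).
  by move=> u; apply: (@continuous_max _ _ (fun=> s) (fun u => u)); [exact: cvg_cst|exact: cvg_id].
have : nbhs t (Num.max s @^-1` [set y | `[s, +oo[%classic y -> A y]) := cm t _ hA.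
apply: filterS => u; apply.
by rewrite /= in_itv/= andbT le_max lexx.
Qed.

Lemma cpath_continuous (R : realType) (d : nat) (s : R) (c : cpath R d s) : continuous c.
Proof.
have -> : path_fun c = (fun t => c (Num.max s t)).
  apply/funext => t; have [ts|//] := ltP t s.
  by rewrite path_before.
by apply: (@continuous_clamp _ _ s (path_fun c)); exact: path_cont.
Qed.

Lemma prob_integ_b d (T : measurableType d) (R : realType) (P : probability T R)
    (f : T -> R) k :
  measurable_fun setT f -> (forall x, `|f x| <= k) -> integ P f.
Proof.
have PT : (P setT < +oo)%E by rewrite probability_setT ltry.
exact: integ_b.
Qed.

Lemma integ_cst d (T : measurableType d) (R : realType) (P : probability T R) (c : R) :
  integ P (fun=> c).
Proof. by apply: (@prob_integ_b _ _ _ _ _ `|c|). Qed.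

Lemma Rint_cst d (T : measurableType d) (R : realType) (P : probability T R) (c : R) :
  \int[P]_w c = c.
Proof.
rewrite /Rintegral integral_cst//.
transitivity (fine (c%:E * 1)%E); last by rewrite mule1.
by congr (fine (_ * _)%E); exact: probability_setT.
Qed.

Section BM.
Context (R : realType) (dO : measure_display) (Omega : measurableType dO).
Variables (Q : probability Omega R) (m : nat) (F : R -> set (set Omega)).
Variable (W : Omega -> cpath R m 0).
Hypotheses (hF : filtration F) (hW : brownian_motion Q F W).

Notation Om a := (g_sigma_algebraType (F a)).

Lemma filt_sigma a : 0 <= a -> sigma_algebra setT (F a).
Proof. by case: hF => H _ _; exact: H. Qed.

Lemma filt_meas a : 0 <= a -> F a `<=` measurable.
Proof. by case: hF => _ H _; exact: H. Qed.

Lemma filt_mono a c : 0 <= a -> a <= c -> F a `<=` F c.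
Proof. by case: hF => _ _ H; exact: H. Qed.

Lemma adapted_mono dT (T : measurableType dT) (f : Omega -> T) a c : 0 <= a -> a <= c ->
  measurable_fun setT (f : Om a -> T) -> measurable_fun setT (f : Om c -> T).
Proof.
move=> a0 ac /(measurable_wrtP (filt_sigma a0)) H.
apply/(measurable_wrtP (filt_sigma (le_trans a0 ac))) => B mB.
by apply: (filt_mono a0 ac); exact: H.
Qed.

Lemma adapted_meas dT (T : measurableType dT) (f : Omega -> T) a : 0 <= a ->
  measurable_fun setT (f : Om a -> T) -> measurable_fun setT f.
Proof. by move=> a0; apply: measurable_coarse; [exact: filt_sigma|exact: filt_meas]. Qed.

Lemma bm_adapted a : 0 <= a -> measurable_fun setT ((fun w => W w a) : Om a -> _).
Proof. by move=> a0; case: hW => H _ _; apply/(measurable_wrtP (filt_sigma a0)); exact: H. Qed.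

Definition increment (a c : R) (k : 'I_m) (w : Omega) : R := W w c 0 k - W w a 0 k.

Lemma inc_adapted a c k : 0 <= a -> a <= c -> measurable_fun setT (increment a c k : Om c -> R).
Proof.
move=> a0 ac; apply: measurable_funB; apply: measurable_entry.
  exact: bm_adapted (le_trans a0 ac).
by apply: (adapted_mono a0 ac); exact: bm_adapted.
Qed.

Lemma inc_meas a c k : 0 <= a -> a <= c -> measurable_fun setT (increment a c k).
Proof.
by move=> a0 ac; apply: (adapted_meas (le_trans a0 ac)); exact: inc_adapted.
Qed.

Let N (a c : R) : probability _ R := normal_prob (0 : R) (Num.sqrt (c - a)).

Lemma inc_indep2 a c k l (B : set Omega) (C C' : set R) : 0 <= a -> a < c -> k != l ->
  F a B -> measurable C -> measurable C' ->
  (Q (B `&` [set w | C (increment a c k w) /\ C' (increment a c l w)]) = Q B * N a c C * N a c C')%E.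
Proof.
move=> a0 ac kl FB mC mC'.
pose Ci := fun i : 'I_m => if i == k then C else if i == l then C' else setT.
have := hW => -[_ _ /(_ a c a0 ac B Ci FB)].
have mCi i : measurable (Ci i) by rewrite /Ci; case: ifP => // _; case: ifP.
move=> /(_ mCi).
rewrite (bigD1 k)//= (bigD1 l)/=; last by rewrite eq_sym.
rewrite big1 ?mule1; last first.
  move=> i /andP[ik il]; rewrite /Ci (negbTE ik) (negbTE il).
  exact: probability_setT.
rewrite {2 3}/Ci !eqxx eq_sym (negbTE kl) muleA => <-.
congr (Q (B `&` _)); apply/seteqP; split=> w /=.
  move=> [h1 h2] i; rewrite /Ci !mxE.
  by case: eqVneq => [->//|_]; case: eqVneq => [->//|_].
move=> H; have := H k; have := H l.
by rewrite /Ci !eqxx eq_sym (negbTE kl) !mxE.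
Qed.

(** The independence clause of a Brownian motion speaks of all coordinates
at once; the other coordinates are left free by taking setT for them. *)
Lemma inc_indep1 a c k (B : set Omega) (C : set R) : 0 <= a -> a < c ->
  F a B -> measurable C ->
  (Q (B `&` increment a c k @^-1` C) = Q B * N a c C)%E.
Proof.
move=> a0 ac FB mC.
pose Ci := fun i : 'I_m => if i == k then C else setT.
have := hW => -[_ _ /(_ a c a0 ac B Ci FB)].
have mCi i : measurable (Ci i) by rewrite /Ci; case: ifP.
move=> /(_ mCi).
rewrite (bigD1 k)//= big1 ?mule1; last first.
  by move=> i ik; rewrite /Ci (negbTE ik); exact: probability_setT.
rewrite {2}/Ci !eqxx => <-.
congr (Q (B `&` _)); apply/seteqP; split=> w /=.
  move=> h1 i; rewrite /Ci !mxE.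
  by case: eqVneq => [->//|_].
by move=> H; have := H k; rewrite /Ci !eqxx !mxE.
Qed.

Lemma inc_integral a c k (zeta : Omega -> R) (f : R -> R) : 0 <= a -> a < c ->
  measurable_fun setT (zeta : Om a -> R) -> integ Q zeta ->
  integ (N a c) f ->
  integ Q (fun w => zeta w * f (increment a c k w)) /\
  \int[Q]_w (zeta w * f (increment a c k w)) = \int[Q]_w zeta w * \int[N a c]_x f x.
Proof.
move=> a0 ac; apply: (@indep_integral _ _ _ _ (F a)).
- exact: filt_sigma.
- exact: filt_meas.
- by apply: inc_meas => //; exact: ltW.
- by move=> B C FB mC; exact: inc_indep1.
Qed.

(** Two coordinates of an increment are jointly independent of F_a with a
product normal law. The law of the pair conditioned on B is a product on
rectangles, hence a product measure. *)
Lemma inc_integral2 a c k l (zeta : Omega -> R) (f : R * R -> R) : 0 <= a -> a < c -> k != l ->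
  measurable_fun setT (zeta : Om a -> R) -> integ Q zeta ->
  integ (N a c \x N a c)%E f ->
  integ Q (fun w => zeta w * f (increment a c k w, increment a c l w)) /\
  \int[Q]_w (zeta w * f (increment a c k w, increment a c l w)) =
    \int[Q]_w zeta w * \int[(N a c \x N a c)%E]_x f x.
Proof.
move=> a0 ac kl.
have mZ : measurable_fun setT
    ((fun w => (increment a c k w, increment a c l w)) : _ -> measurableTypeR R * measurableTypeR R).
  by apply: measurable_fun_pair; apply: inc_meas => //; exact: ltW.
move=> mz iz iff.
pose L : probability _ R := (N a c \x N a c)%E.
suff ind B (E : set (measurableTypeR R * measurableTypeR R)) : F a B -> measurable E ->
    (Q (B `&` (fun w => (increment a c k w, increment a c l w)) @^-1` E) = Q B * L E)%E.
  exact: (@indep_integral _ Omega R Q (F a) (filt_sigma a0) (filt_meas a0) _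
    (measurableTypeR R * measurableTypeR R)%type
    (fun w => (increment a c k w, increment a c l w)) L mZ ind zeta f mz iz iff).
move=> FB mE.
have mB : measurable B by apply: (filt_meas a0).
have [QB0|QB0] := eqVneq (Q B) 0%E.
  rewrite QB0 mul0e; apply/eqP; rewrite eq_le measure_ge0 andbT -QB0.
  apply: le_measure; rewrite ?inE//; apply: measurableI => //.
  by rewrite -[X in measurable X]setTI; exact: mZ.
pose Z : {mfun Omega >-> (measurableTypeR R * measurableTypeR R)%type} := HB.pack (fun w => (increment a c k w, increment a c l w))
  (isMeasurableFun.Build _ _ _ _ _ mZ).
have QBf : Q B \is a fin_num by exact: fin_num_measure.
have QBp : (0 < fine (Q B)) by rewrite fine_gt0// lt0e QB0 measure_ge0/= -ge0_fin_numE.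
have r0 : 0 <= (fine (Q B))^-1 by rewrite invr_ge0 ltW.
pose m' : {measure set (measurableTypeR R * measurableTypeR R) -> \bar R} :=
  mscale (NngNum r0) (pushforward (mrestr Q mB) Z).
have H := @product_measure_unique _ _ _ _ R (N a c) (N a c) (m' mZ) _ E mE.
rewrite -[L E]/((N a c \x N a c)%E E) H.
  rewrite /m' /mscale/= /pushforward /mrestr /= muleA -{1}(fineK QBf) -EFinM divff ?gt_eqF// mul1e.
  by rewrite setIC.
move=> C C' mC mC'.
transitivity (((fine (Q B))^-1)%:E * Q (B `&` [set w | C (increment a c k w) /\ C' (increment a c l w)]))%E.
  by rewrite setIC.
rewrite (inc_indep2 a0 ac kl FB mC mC') muleA muleA -{2}(fineK QBf) -EFinM mulVf ?gt_eqF//.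
by rewrite mul1e.
Qed.

Lemma inc_mean a c k (zeta : Omega -> R) : 0 <= a -> a <= c ->
  measurable_fun setT (zeta : Om a -> R) -> integ Q zeta ->
  integ Q (fun w => zeta w * increment a c k w) /\ \int[Q]_w (zeta w * increment a c k w) = 0.
Proof.
move=> a0; rewrite le_eqVlt => /orP[/eqP<-|ac] mz iz.
  have E w : zeta w * increment a a k w = 0 by rewrite /increment subrr mulr0.
  by split; [apply: (eq_integ E); exact: integ0|rewrite (Rint_eq _ E) /Rintegral integral0].
have s0 : 0 < Num.sqrt (c - a) by rewrite sqrtr_gt0 subr_gt0.
have [H1 H2] := inc_integral k a0 ac mz iz (normal_moment1 s0).1.
by split=> //; rewrite H2 (normal_moment1 s0).2 mulr0.
Qed.

Lemma inc_cov a c k l (zeta : Omega -> R) : 0 <= a -> a <= c ->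
  measurable_fun setT (zeta : Om a -> R) -> integ Q zeta ->
  integ Q (fun w => zeta w * (increment a c k w * increment a c l w)) /\
  \int[Q]_w (zeta w * (increment a c k w * increment a c l w)) =
    (k == l)%:R * (c - a) * \int[Q]_w zeta w.
Proof.
move=> a0; rewrite le_eqVlt => /orP[/eqP<-|ac] mz iz.
  have E w : zeta w * (increment a a k w * increment a a l w) = 0 by rewrite /increment !subrr !mulr0.
  split; first by apply: (eq_integ E); exact: integ0.
  by rewrite (Rint_eq _ E) /Rintegral integral0 subrr mulr0 mul0r.
have s0 : 0 < Num.sqrt (c - a) by rewrite sqrtr_gt0 subr_gt0.
have [->|kl] := eqVneq k l.
  have [H1 H2] := inc_integral l a0 ac mz iz (normal_moment2 s0).1.
  have E w : zeta w * (increment a c l w * increment a c l w) = zeta w * (increment a c l w) ^+ 2 by [].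
  split; first exact: (eq_integ E).
  rewrite (Rint_eq _ E) H2 (normal_moment2 s0).2 mul1r mulrC sqr_sqrtr// subr_ge0 ltW//.
have [i1 e1] := normal_moment1 s0.
have mf : measurable_fun setT (fun z : measurableTypeR R * measurableTypeR R => z.1 * z.2).
  by apply: measurable_funM; exact: measurable_fst || exact: measurable_snd.
have iff : integ (N a c \x N a c)%E (fun z => z.1 * z.2).
  apply/integrable12ltyP; first exact/measurable_EFinP.
  rewrite (eq_integral (fun x : measurableTypeR R => `|x : R|%:E * (\int[N a c]_y `|y|)%:E)%E); last first.
    move=> x _; rewrite EFin_Rint; last exact: integ_norm.
    rewrite -ge0_integralZl_EFin//; last first.
      by apply/measurable_EFinP; exact: normr_measurable.
    by apply: eq_integral => y _; rewrite /= normrM EFinM.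
  have mza : measurable_fun setT (fun x : measurableTypeR R => `|x : R|%:E).
    by apply/measurable_EFinP; exact: normr_measurable.
  rewrite (ge0_integralZr (N a c) measurableT mza)//; last first.
    by rewrite lee_fin; apply: Rint_ge0.
  rewrite muleC; apply: lte_mul_pinfty => //.
    by rewrite lee_fin; apply: Rint_ge0.
  by case/integrableP : i1.
have [H1 H2] := inc_integral2 a0 ac kl mz iz iff.
split=> //; rewrite H2 !mul0r.
suff -> : \int[(N a c \x N a c)%E]_x (x.1 * x.2) = 0 by rewrite mulr0.
rewrite /Rintegral -integral12_prod_meas1//.
rewrite (eq_integral (fun=> 0%E)) ?integral0// => x _.
rewrite /fubini_F; under eq_integral do rewrite /= EFinM.
by rewrite integralZl// -EFin_Rint// e1 mule0.
Qed.

Lemma inc_abs3 a c k : 0 <= a -> a <= c ->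
  integ Q (fun w => `|increment a c k w| ^+ 3) /\
  \int[Q]_w (`|increment a c k w| ^+ 3) <= 32 * Num.sqrt (c - a) ^+ 3.
Proof.
move=> a0; rewrite le_eqVlt => /orP[/eqP<-|ac].
  have E w : `|increment a a k w| ^+ 3 = 0 by rewrite /increment subrr normr0 expr0n.
  split; first by apply: (eq_integ E); exact: integ0.
  by rewrite (Rint_eq _ E) /Rintegral integral0 subrr sqrtr0 expr0n mulr0.
have s0 : 0 < Num.sqrt (c - a) by rewrite sqrtr_gt0 subr_gt0.
have i1 : integ Q (fun=> 1 : R).
  exact: integ_cst.
have [H1 H2] := inc_integral k a0 ac (zeta := fun=> 1) (measurable_cst _) i1 (normal_moment3 s0).1.
have E w : `|increment a c k w| ^+ 3 = 1 * `|increment a c k w| ^+ 3 by rewrite mul1r.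
split; first exact: (eq_integ E).
rewrite (Rint_eq _ E) H2; have := (normal_moment3 s0).2.
suff -> : \int[Q]_w (1 : R) = 1 by rewrite mul1r.
exact: Rint_cst.
Qed.

End BM.

(** * Isometry for simple stochastic integrals *)

Section LebItv.
Variable R : realType.
Notation leb := (@lebesgue_measure R).

(** Lebesgue measure restricted to [a, c], a finite measure on the whole line:
time integrals become integrals over the full type, for which products and
Fubini are available. *)
Definition lebitv (a c : R) : set (measurableTypeR R) -> \bar R :=
  mrestr leb (measurable_itv `[a, c]).
HB.instance Definition _ a c := Measure.on (lebitv a c).

Let lebitv_fin a c : fin_num_fun (lebitv a c).
Proof.
move=> U mU; rewrite /lebitv /mrestr ge0_fin_numE//.
apply: (@le_lt_trans _ _ (leb `[a, c]%classic)).
  by apply: le_measure; rewrite ?inE//; apply: measurableI.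
by rewrite lebesgue_measure_itv; case: ifP => _; rewrite ?ltry// -EFinB ltry.
Qed.

HB.instance Definition _ a c := Measure_isFinite.Build _ _ _ (lebitv a c) (lebitv_fin a c).

Lemma lebitvE a c B : measurable B ->
  (lebitv a c B = \int[leb]_(x in B) (\1_(`[a, c]%classic) x : R)%:E)%E.
Proof. by move=> mB; rewrite integral_indic// setIC. Qed.

Lemma lebitv_setT a c : a <= c -> lebitv a c setT = (c - a)%:E.
Proof.
rewrite le_eqVlt /lebitv /mrestr setTI lebesgue_measure_itv/= lte_fin => /orP[/eqP->|->].
  by rewrite ltxx subrr.
by rewrite EFinB.
Qed.

Lemma lebitv_integral a c (f : R -> \bar R) : measurable_fun setT f ->
  (\int[lebitv a c]_x f x = \int[leb]_(x in `[a, c]) f x)%E.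
Proof.
move=> mf; rewrite (@density_integral _ _ R leb (lebitv a c) (\1_(`[a, c]%classic)))//.
- by rewrite [RHS]integral_mkcond; apply: eq_integral => x _; rewrite epatch_indic.
- by move=> B mB; exact: lebitvE.
Qed.

Lemma lebitv_Rint a c (f : R -> R) : measurable_fun setT f ->
  \int[lebitv a c]_x f x = \int[leb]_(x in `[a, c]) f x.
Proof. by move=> mf; rewrite /Rintegral lebitv_integral//; exact/measurable_EFinP. Qed.

Lemma lebitv_cst a c (k : R) : a <= c -> \int[lebitv a c]_x k = k * (c - a).
Proof.
move=> ac; rewrite /Rintegral integral_cst//.
by transitivity (fine (k%:E * (c - a)%:E)%E) => //; rewrite -(lebitv_setT ac).
Qed.

Lemma lebitv_lt a c : (lebitv a c setT < +oo)%E.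
Proof. by rewrite -ge0_fin_numE//; exact: lebitv_fin. Qed.

End LebItv.

(** Length of the intersection of (a, b] and (c, e]. *)
Definition overlap (R : realType) (a b c e : R) : R := Num.max 0 (Num.min b e - Num.max a c).

Lemma overlapC (R : realType) (a b c e : R) : overlap a b c e = overlap c e a b.
Proof. by rewrite /overlap (minC b) (maxC a). Qed.

Lemma integral_overlap (R : realType) (lo hi a b c e : R) :
  lo <= a -> a <= b -> b <= hi -> lo <= c -> c <= e -> e <= hi ->
  \int[lebitv lo hi]_v ((if a < v <= b then 1 else 0) * (if c < v <= e then 1 else 0)) =
    overlap a b c e.
Proof.
move=> la ab bh lc ce eh.
have E v : ((if a < v <= b then 1 else 0) * (if c < v <= e then 1 else 0) : R) =
    \1_(`]Num.max a c, Num.min b e]%classic) v.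
  rewrite indicE mem_setE in_itv/= gt_max le_min.
  by case: (a < v); case: (v <= b); case: (c < v); case: (v <= e); rewrite ?mulr0 ?mul0r ?mulr1.
transitivity (\int[lebitv lo hi]_v (\1_(`]Num.max a c, Num.min b e]%classic) (v : R) : R)).
  by apply: Rint_eq => v; exact: E.
rewrite /Rintegral integral_indic// setIT.
transitivity (fine (@lebesgue_measure R (`]Num.max a c, Num.min b e]%classic `&` `[lo, hi]%classic))) => //.
rewrite setIidl.
  rewrite lebesgue_measure_itv /= /overlap lte_fin.
  set x := Num.max a c; set y := Num.min b e.
  case: ltP => h; first by rewrite -EFinB /= (@max_r _ _ 0)// subr_ge0 ltW.
  by rewrite (@max_l _ _ 0)// subr_le0.
move=> v /=; rewrite !in_itv/= gt_max le_min => /andP[/andP[h1 h2] /andP[h3 h4]].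
by apply/andP; split; lra.
Qed.

Section Isometry.
Context (R : realType) (dO : measure_display) (Omega : measurableType dO).
Variables (Q : probability Omega R) (m : nat) (F : R -> set (set Omega)).
Variable (W : Omega -> cpath R m 0).
Hypotheses (hF : filtration F) (hW : brownian_motion Q F W).
Notation Om a := (g_sigma_algebraType (F a)).
Notation inc := (increment W).

Lemma inc_sq a c k : 0 <= a -> a <= c -> integ Q (fun w => inc a c k w ^+ 2).
Proof.
move=> a0 ac; have [H _] := inc_cov hF hW k k a0 ac (zeta := fun=> 1) (measurable_cst _) (integ_cst _ _).
by apply: (eq_integ _ H) => w; rewrite mul1r.
Qed.

Lemma inc_prod a c k b e l C (z : Omega -> R) : 0 <= a -> a <= c -> 0 <= b -> b <= e ->
  measurable_fun setT z -> (forall w, `|z w| <= C) ->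
  integ Q (fun w => z w * (inc a c k w * inc b e l w)).
Proof.
move=> a0 ac b0 be mz zC; apply: (integMb mz zC).
apply: (@integ_le _ _ _ _ _ (fun w => inc a c k w ^+ 2 + inc b e l w ^+ 2)).
- by apply: measurable_funM; apply: inc_meas hF hW _ _ _ _ _.
- by apply: integD; exact: inc_sq.
- move=> w; rewrite normrM.
  have -> : inc a c k w ^+ 2 = `|inc a c k w| ^+ 2 by rewrite real_normK// num_real.
  have -> : inc b e l w ^+ 2 = `|inc b e l w| ^+ 2 by rewrite real_normK// num_real.
  have := sqr_ge0 (`|inc a c k w| - `|inc b e l w|).
  have := normr_ge0 (inc a c k w); have := normr_ge0 (inc b e l w); nra.
Qed.

Lemma inc_disjoint a b c e k l C (z : Omega -> R) : 0 <= a -> a <= b -> b <= c -> c <= e ->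
  measurable_fun setT (z : Om c -> R) -> (forall w, `|z w| <= C) ->
  \int[Q]_w (z w * (inc a b k w * inc c e l w)) = 0.
Proof.
move=> a0 ab bc ce mz zC.
have c0 : 0 <= c by rewrite (le_trans a0)// (le_trans ab).
have b0 := le_trans a0 ab.
have E w : z w * (inc a b k w * inc c e l w) = (z w * inc a b k w) * inc c e l w by rewrite mulrA.
rewrite (Rint_eq _ E); apply: (inc_mean hF hW l c0 ce _ _).2.
  apply: measurable_funM => //; apply: (adapted_mono hF b0 bc).
  exact: (inc_adapted hF hW).
apply: (integMb (adapted_meas hF c0 mz) zC).
apply: (@integ_le _ _ _ _ _ (fun w => 1 + inc a b k w ^+ 2)).
- exact: (inc_meas hF hW).
- by apply: integD; [exact: integ_cst|exact: inc_sq].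
- move=> w; have -> : inc a b k w ^+ 2 = `|inc a b k w| ^+ 2 by rewrite real_normK// num_real.
  have := normr_ge0 (inc a b k w); nra.
Qed.

(** Both increments are cut at c and at min b e. Pieces over disjoint intervals
are uncorrelated given the past of the later one, and only the common interval
contributes. *)
Lemma block_cov_le a b c e k l C (z : Omega -> R) : 0 <= a -> a <= b -> a <= c -> c <= e ->
  measurable_fun setT (z : Om c -> R) -> (forall w, `|z w| <= C) ->
  \int[Q]_w (z w * (inc a b k w * inc c e l w)) =
    (k == l)%:R * overlap a b c e * \int[Q]_w z w.
Proof.
move=> a0 ab ac ce mz zC.
have c0 := le_trans a0 ac.
have mz' := adapted_meas hF c0 mz.
have [bc|cb] := leP b c.
  rewrite (@inc_disjoint _ _ _ _ _ _ C)// /overlap max_l ?mulr0 ?mul0r//.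
  by rewrite subr_le0 ge_min le_max bc orbT.
(* the common interval is (c, e'] *)
set e' := Num.min b e.
have ce' : c <= e' by rewrite le_min (ltW cb).
have e'b : e' <= b by rewrite ge_min lexx.
have e'e : e' <= e by rewrite ge_min lexx orbT.
have e'0 := le_trans c0 ce'.
have E w : z w * (inc a b k w * inc c e l w) =
    (z w * (inc a c k w * inc c e l w) + z w * (inc c e' k w * inc e' e l w))
    + (z w * (inc c e' k w * inc c e' l w) + z w * (inc c e' l w * inc e' b k w)).
  have H0 : inc e' b k w * inc e' e l w = 0.
    by rewrite /e' minEle; case: ifP => _; rewrite /increment subrr ?mul0r ?mulr0.
  apply/eqP; rewrite -subr_eq0; apply/eqP.
  rewrite -[RHS](mulr0 (z w)) -H0 /increment; ring.
have mze' : measurable_fun setT (z : Om e' -> R) by exact: (adapted_mono hF c0 ce').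
rewrite (Rint_eq _ E) RintD; last 2 first.
- by apply: integD; apply: inc_prod mz' zC => //; exact: ltW.
- by apply: integD; apply: inc_prod mz' zC => //; exact: ltW.
rewrite RintD; last 2 first.
- by apply: inc_prod mz' zC.
- by apply: inc_prod mz' zC.
rewrite RintD; last 2 first.
- by apply: inc_prod mz' zC.
- by apply: inc_prod mz' zC.
rewrite (@inc_disjoint a c c e _ _ C)// (@inc_disjoint c e' e' e _ _ C)//.
rewrite (@inc_disjoint c e' e' b _ _ C)// !add0r addr0.
rewrite (inc_cov hF hW k l c0 ce' mz _).2; last exact: prob_integ_b mz' zC.
by rewrite /overlap -/e' (max_r ac) max_r// subr_ge0.
Qed.

Lemma bound_mul C (z z' : Omega -> R) : (forall w, `|z w| <= C) -> (forall w, `|z' w| <= C) ->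
  forall w, `|z w * z' w| <= C * C.
Proof. by move=> h h' w; rewrite normrM ler_pM. Qed.

Lemma block_cov a b c e k l C (z z' : Omega -> R) :
  0 <= a -> a <= b -> 0 <= c -> c <= e ->
  measurable_fun setT (z : Om a -> R) -> (forall w, `|z w| <= C) ->
  measurable_fun setT (z' : Om c -> R) -> (forall w, `|z' w| <= C) ->
  \int[Q]_w ((z w * inc a b k w) * (z' w * inc c e l w)) =
    (k == l)%:R * overlap a b c e * \int[Q]_w (z w * z' w).
Proof.
move=> a0 ab c0 ce mz zC mz' zC'.
have [ac|ca] := leP a c.
  have E w : (z w * inc a b k w) * (z' w * inc c e l w) =
    (z w * z' w) * (inc a b k w * inc c e l w) by ring.
  rewrite (Rint_eq _ E); apply: (@block_cov_le a b c e k l (C * C)) => //.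
    by apply: measurable_funM => //; exact: (adapted_mono hF a0 ac).
  exact: bound_mul.
have E w : (z w * inc a b k w) * (z' w * inc c e l w) =
  (z w * z' w) * (inc c e l w * inc a b k w) by ring.
rewrite (Rint_eq _ E) overlapC eq_sym.
apply: (@block_cov_le c e a b l k (C * C)) => //; first exact: ltW.
  by apply: measurable_funM => //; exact: (adapted_mono hF c0 (ltW ca)).
exact: bound_mul.
Qed.

Lemma block_integ a b c e k l C (z z' : Omega -> R) :
  0 <= a -> a <= b -> 0 <= c -> c <= e ->
  measurable_fun setT z -> (forall w, `|z w| <= C) ->
  measurable_fun setT z' -> (forall w, `|z' w| <= C) ->
  integ Q (fun w => (z w * inc a b k w) * (z' w * inc c e l w)).
Proof.
move=> a0 ab c0 ce mz zC mz' zC'.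
have E w : (z w * inc a b k w) * (z' w * inc c e l w) =
  (z w * z' w) * (inc a b k w * inc c e l w) by ring.
apply: (eq_integ E); apply: (inc_prod k l a0 ab c0 ce (C := C * C)).
  exact: measurable_funM.
exact: bound_mul.
Qed.

Lemma sqr_sum (J : finType) (f : J -> R) :
  (\sum_p f p) ^+ 2 = \sum_p \sum_q f p * f q.
Proof. by rewrite expr2 mulr_suml; apply: eq_bigr => p _; rewrite mulr_sumr. Qed.

Section Blocks.
Variables (J : finType) (a b : J -> R) (lo hi C : R).
Hypotheses (lo0 : 0 <= lo) (hJ : forall p, lo <= a p /\ a p <= b p /\ b p <= hi).

Let a0 p : 0 <= a p. Proof. by rewrite (le_trans lo0)//; exact: (hJ p).1. Qed.
Let ab p : a p <= b p. Proof. by case: (hJ p) => _ []. Qed.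

(** Blocks are allowed to overlap, so no common refinement of two partitions is
ever formed: second moments of sums are sums of pairwise covariances. *)
Lemma scalar_isometry (k : J -> 'I_m) (z : J -> Omega -> R) :
  (forall p, measurable_fun setT (z p : Om (a p) -> R)) ->
  (forall p w, `|z p w| <= C) ->
  integ Q (fun w => (\sum_p z p w * inc (a p) (b p) (k p) w) ^+ 2) /\
  \int[Q]_w ((\sum_p z p w * inc (a p) (b p) (k p) w) ^+ 2) =
  \sum_p \sum_q (k p == k q)%:R * overlap (a p) (b p) (a q) (b q) * \int[Q]_w (z p w * z q w).
Proof.
move=> mz zC.
have mz' p := adapted_meas hF (a0 p) (@mz p).
have ii p q : integ Q (fun w => (z p w * inc (a p) (b p) (k p) w) * (z q w * inc (a q) (b q) (k q) w)).
  by apply: (@block_integ _ _ _ _ _ _ C).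
have E w := sqr_sum (fun p => z p w * inc (a p) (b p) (k p) w).
split; first by apply: (eq_integ E); apply: integ_sum => p _; apply: integ_sum.
rewrite (Rint_eq _ E) Rint_sum; last by move=> p _; apply: integ_sum.
apply: eq_bigr => p _; rewrite Rint_sum//; apply: eq_bigr => q _.
by rewrite (@block_cov _ _ _ _ _ _ C).
Qed.

End Blocks.

Definition blk (a b v : R) : R := if a < v <= b then 1 else 0.

Lemma blk_meas a b : measurable_fun setT (blk a b).
Proof.
rewrite (_ : blk a b = \1_(`]a, b]%classic)).
  exact: measurable_indic.
by apply/funext => v; rewrite indicE mem_setE in_itv/= /blk; case: ifP.
Qed.

Section MxBlocks.
Variables (d : nat) (J : finType) (a b : J -> R) (lo hi C : R).
Hypotheses (lo0 : 0 <= lo) (hJ : forall p, lo <= a p /\ a p <= b p /\ b p <= hi).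
Variable (xi : J -> Omega -> 'M[R]_(d, m)).
Hypotheses (mxi : forall p, measurable_fun setT (xi p : Om (a p) -> 'M[R]_(d, m)))
  (xiC : forall p w i k, `|xi p w i k| <= C).

Let a0 p : 0 <= a p. Proof. by rewrite (le_trans lo0)//; exact: (hJ p).1. Qed.

(** Stochastic integral of [blk_fun], for a finite family of possibly
overlapping blocks (a p, b p] with integrand xi p. *)
Definition blk_int (w : Omega) : 'rV[R]_d := \sum_p (W w (b p) - W w (a p)) *m (xi p w)^T.
Definition blk_fun (v : R) (w : Omega) : 'M[R]_(d, m) := \sum_p blk (a p) (b p) v *: xi p w.

Lemma blk_intE w i : blk_int w 0 i =
  \sum_(pk : J * 'I_m) xi pk.1 w i pk.2 * inc (a pk.1) (b pk.1) pk.2 w.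
Proof.
rewrite /blk_int summxE -(pair_bigA _ (fun p k => xi p w i k * inc (a p) (b p) k w))/=.
apply: eq_bigr => p _; rewrite mxE; apply: eq_bigr => k _.
by rewrite !mxE mulrC.
Qed.

Lemma blk_funE v w i k : blk_fun v w i k = \sum_p blk (a p) (b p) v * xi p w i k.
Proof. by rewrite /blk_fun summxE; apply: eq_bigr => p _; rewrite mxE. Qed.

Let mxi' p i k : measurable_fun setT (fun w => xi p w i k).
Proof. by apply: measurable_entry; exact: (adapted_meas hF (a0 p)). Qed.

Let blkfun_sq v i k : integ Q (fun w => blk_fun v w i k ^+ 2) /\
  \int[Q]_w (blk_fun v w i k ^+ 2) =
  \sum_p \sum_q (blk (a p) (b p) v * blk (a q) (b q) v) * \int[Q]_w (xi p w i k * xi q w i k).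
Proof.
have E w : blk_fun v w i k ^+ 2 = \sum_p \sum_q (blk (a p) (b p) v * blk (a q) (b q) v) *
    (xi p w i k * xi q w i k).
  rewrite blk_funE sqr_sum; apply: eq_bigr => p _; apply: eq_bigr => q _; ring.
have ii p q : integ Q (fun w => xi p w i k * xi q w i k).
  apply: (@prob_integ_b _ _ _ _ _ (C * C)); first exact: measurable_funM.
  by apply: bound_mul.
have iiZ p q c : integ Q (fun w => c * (xi p w i k * xi q w i k)) by apply: integZ.
split; first by apply: (eq_integ E); apply: integ_sum => p _; apply: integ_sum.
rewrite (Rint_eq _ E) Rint_sum; last by move=> p _; apply: integ_sum.
apply: eq_bigr => p _; rewrite Rint_sum//; apply: eq_bigr => q _.
by rewrite RintZ.
Qed.

Lemma enorm_sq (n1 n2 : nat) (A : 'M[R]_(n1, n2)) : enorm A ^+ 2 = \sum_i \sum_j A i j ^+ 2.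
Proof.
rewrite /enorm sqr_sqrtr//; apply: sumr_ge0 => i _; apply: sumr_ge0 => j _; exact: sqr_ge0.
Qed.

(** Ito isometry. Both sides expand into the same double sum over pairs of
blocks, with the overlap lengths as weights. *)
Lemma blk_isometry : integ Q (fun w => enorm (blk_int w) ^+ 2) /\
  \int[Q]_w (enorm (blk_int w) ^+ 2) =
    \int[lebitv lo hi]_v \int[Q]_w (enorm (blk_fun v w) ^+ 2).
Proof.
have H i := scalar_isometry (J := (J * 'I_m)%type) (a := fun pk => a pk.1) (b := fun pk => b pk.1)
   lo0 (fun pk => hJ pk.1) (fun pk => pk.2) (z := fun pk w => xi pk.1 w i pk.2)
   (fun pk => measurable_entry i pk.2 (@mxi pk.1)) (fun pk w => xiC pk.1 w i pk.2).
have E w : enorm (blk_int w) ^+ 2 = \sum_i (\sum_(pk : J * 'I_m) xi pk.1 w i pk.2 * inc (a pk.1) (b pk.1) pk.2 w) ^+ 2.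
  rewrite enorm_sq big_ord1; apply: eq_bigr => i _; by rewrite blk_intE.
split; first by apply: (eq_integ E); apply: integ_sum => i _; exact: (H i).1.
rewrite (Rint_eq _ E) Rint_sum; last by move=> i _; exact: (H i).1.
have E2 v : \int[Q]_w (enorm (blk_fun v w) ^+ 2) =
    \sum_i \sum_k \sum_p \sum_q (\int[Q]_w (xi p w i k * xi q w i k)) * (blk (a p) (b p) v * blk (a q) (b q) v).
  rewrite (Rint_eq _ (fun w => enorm_sq (blk_fun v w))) Rint_sum; last first.
    by move=> i _; apply: integ_sum => k _; exact: (blkfun_sq _ _ _).1.
  apply: eq_bigr => i _; rewrite Rint_sum; last by move=> k _; exact: (blkfun_sq _ _ _).1.
  apply: eq_bigr => k _; rewrite (blkfun_sq _ _ _).2.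
  by apply: eq_bigr => p _; apply: eq_bigr => q _; rewrite mulrC.
have ib p q c : integ (lebitv lo hi) (fun v => c * (blk (a p) (b p) v * blk (a q) (b q) v)).
  apply: integZ; apply: (@integ_b _ _ _ _ _ 1).
  - exact: lebitv_lt.
  - by apply: measurable_funM; exact: blk_meas.
  - by move=> v; rewrite /blk; do 2 case: ifP => _; rewrite ?mulr0 ?mul0r ?mulr1 ?normr0 ?normr1.
transitivity (\int[lebitv lo hi]_v (\sum_i \sum_k \sum_p \sum_q
   (\int[Q]_w (xi p w i k * xi q w i k)) * (blk (a p) (b p) v * blk (a q) (b q) v))); last first.
  by apply: Rint_eq => v; rewrite E2.
rewrite Rint_sum; last first.
  by move=> i _; apply: integ_sum => k _; apply: integ_sum => p _; apply: integ_sum.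
apply: eq_bigr => i _; rewrite (H i).2 Rint_sum; last first.
  by move=> k _; apply: integ_sum => p _; apply: integ_sum.
transitivity (\sum_k \sum_p \sum_q overlap (a p) (b p) (a q) (b q) * \int[Q]_w (xi p w i k * xi q w i k)).
  rewrite -(pair_bigA _ (fun p k => \sum_(ql : J * 'I_m) (k == ql.2)%:R *
    overlap (a p) (b p) (a ql.1) (b ql.1) * \int[Q]_w (xi p w i k * xi ql.1 w i ql.2)))/=.
  rewrite exchange_big; apply: eq_bigr => k _; apply: eq_bigr => p _.
  rewrite -(pair_bigA _ (fun q l => (k == l)%:R *
    overlap (a p) (b p) (a q) (b q) * \int[Q]_w (xi p w i k * xi q w i l)))/=.
  apply: eq_bigr => q _; rewrite (bigD1 k)//= eqxx mul1r big1 ?addr0// => l lk.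
  by rewrite eq_sym (negbTE lk) !mul0r.
apply: eq_bigr => k _; rewrite Rint_sum; last by move=> p _; apply: integ_sum.
apply: eq_bigr => p _; rewrite Rint_sum//; apply: eq_bigr => q _.
rewrite RintZ; last by apply: (eq_integ _ (ib p q 1)) => v; rewrite mul1r.
have [h1 [h2 h3]] := hJ p; have [h1' [h2' h3']] := hJ q.
by rewrite mulrC -(integral_overlap h1 h2 h3 h1' h2' h3').
Qed.

End MxBlocks.
End Isometry.

(** * The generator with fixed coefficients *)

Section Deterministic.
Variables (R : realType) (d m : nat).
Implicit Types (h : 'rV[R]_d -> R) (x y : 'rV[R]_d) (S : 'M[R]_(d, m)) (B : 'rV[R]_d).

(** The generator with the values S and B of its coefficients put in, so that
coefficients along a process and their approximations can be compared. *)
Definition genop S B h x : R :=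
  2^-1 * (\sum_i \sum_j (S *m S^T) i j * partial i (partial j h) x)
  + \sum_i B 0 i * partial i h x.

(** Lipschitz for small increments, bounded for large ones; the cap at 1 lets an
increment that is small in mean be paired with an unbounded weight. *)
Lemma test_minlip h : test_function h ->
  exists2 K, 0 <= K & forall x y, `|h y - h x| <= K * Num.min 1 `|y - x|.
Proof.
move=> th; have [K1 K10 H1] := taylor1 th; have [K0 K00 H0] := test_bounded th.
exists (K1 + (K0 + K0)); first by rewrite !addr_ge0.
move=> x y; have := H1 x (y - x); rewrite (addrC x) subrK => h1.
have h2 : `|h y - h x| <= K0 + K0 by rewrite (le_trans (ler_normB _ _))// lerD.
case: (leP 1 `|y - x|) => h3.
  by rewrite mulr1 (le_trans h2)// lerDr.
by rewrite (le_trans h1)// ler_wpM2r// lerDl addr_ge0.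
Qed.

Lemma partial2_choice (P : 'I_d -> 'I_d -> R -> Prop) :
  (forall i j, exists2 K, 0 <= K & P i j K) ->
  exists K : 'I_d -> 'I_d -> R, forall i j, 0 <= K i j /\ P i j (K i j).
Proof.
move=> H; have /choice[K HK] : forall ij : 'I_d * 'I_d, exists K : R, 0 <= K /\ P ij.1 ij.2 K.
  by move=> [i j]; have [K K0 HK] := H i j; exists K.
by exists (fun i j => K (i, j)) => i j; exact: (HK (i, j)).
Qed.

Lemma partial1_choice (P : 'I_d -> R -> Prop) :
  (forall i, exists2 K, 0 <= K & P i K) ->
  exists K : 'I_d -> R, forall i, 0 <= K i /\ P i (K i).
Proof.
move=> H; have /choice[K HK] : forall i : 'I_d, exists K : R, 0 <= K /\ P i K.
  by move=> i; have [K K0 HK] := H i; exists K.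
by exists K.
Qed.

Lemma test_unif h : test_function h -> exists2 K, 0 <= K &
  [/\ forall i x, `|partial i h x| <= K,
      forall i j x, `|partial i (partial j h) x| <= K,
      forall i x y, `|partial i h y - partial i h x| <= K * Num.min 1 `|y - x| &
      forall i j x y, `|partial i (partial j h) y - partial i (partial j h) x|
        <= K * Num.min 1 `|y - x|].
Proof.
move=> th.
have [K1 H1] := partial1_choice (fun i => test_bounded (test_partial i th)).
have [K2 H2] := partial2_choice (fun i j => test_bounded (test_partial i (test_partial j th))).
have [K3 H3] := partial1_choice (fun i => test_minlip (test_partial i th)).
have [K4 H4] := partial2_choice (fun i j => test_minlip (test_partial i (test_partial j th))).
have s1 : 0 <= \sum_i K1 i by apply: sumr_ge0 => i _; exact: (H1 i).1.
have s2 : 0 <= \sum_i \sum_j K2 i j by apply: sumr_ge0 => i _; apply: sumr_ge0 => j _; exact: (H2 i j).1.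
have s3 : 0 <= \sum_i K3 i by apply: sumr_ge0 => i _; exact: (H3 i).1.
have s4 : 0 <= \sum_i \sum_j K4 i j by apply: sumr_ge0 => i _; apply: sumr_ge0 => j _; exact: (H4 i j).1.
have l1 i : K1 i <= \sum_i K1 i.
  by rewrite (bigD1 i)//= lerDl; apply: sumr_ge0 => j _; exact: (H1 j).1.
have l3 i : K3 i <= \sum_i K3 i.
  by rewrite (bigD1 i)//= lerDl; apply: sumr_ge0 => j _; exact: (H3 j).1.
have l2 i j : K2 i j <= \sum_i \sum_j K2 i j.
  rewrite (bigD1 i)//= (bigD1 j)//= -addrA lerDl addr_ge0//.
    by apply: sumr_ge0 => j' _; exact: (H2 i j').1.
  by apply: sumr_ge0 => i' _; apply: sumr_ge0 => j' _; exact: (H2 i' j').1.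
have l4 i j : K4 i j <= \sum_i \sum_j K4 i j.
  rewrite (bigD1 i)//= (bigD1 j)//= -addrA lerDl addr_ge0//.
    by apply: sumr_ge0 => j' _; exact: (H4 i j').1.
  by apply: sumr_ge0 => i' _; apply: sumr_ge0 => j' _; exact: (H4 i' j').1.
set k1 := \sum_i K1 i in s1 l1 *; set k2 := \sum_i \sum_j K2 i j in s2 l2 *.
set k3 := \sum_i K3 i in s3 l3 *; set k4 := \sum_i \sum_j K4 i j in s4 l4 *.
exists (k1 + k2 + k3 + k4); first by lra.
have mn x y : 0 <= Num.min 1 `|y - x| :> R by rewrite le_min ler01 normr_ge0.
split.
- move=> i x; apply: (le_trans ((H1 i).2 x)); have := l1 i; lra.
- move=> i j x; apply: (le_trans ((H2 i j).2 x)); have := l2 i j; lra.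
- move=> i x y; apply: (le_trans ((H3 i).2 x y)); apply: ler_wpM2r => //.
  have := l3 i; lra.
- move=> i j x y; apply: (le_trans ((H4 i j).2 x y)); apply: ler_wpM2r => //.
  have := l4 i j; lra.
Qed.

Lemma mulmxT_diff S S' i j :
  `|(S *m S^T) i j - (S' *m S'^T) i j| <= m%:R * (`|S - S'| ^+ 2 + 2 * (`|S - S'| * `|S'|)).
Proof.
rewrite !mxE -sumrB; apply: (le_trans (ler_norm_sum _ _ _)).
have -> : m%:R * (`|S - S'| ^+ 2 + 2 * (`|S - S'| * `|S'|)) =
  \sum_(k < m) (`|S - S'| ^+ 2 + 2 * (`|S - S'| * `|S'|)).
  by rewrite sumr_const card_ord mulr_natl.
apply: ler_sum => k _; rewrite !mxE.
have -> : S i k * S j k - S' i k * S' j k =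
  ((S - S') i k * (S - S') j k + (S - S') i k * S' j k) + S' i k * (S - S') j k.
  by rewrite !mxE; ring.
apply: (le_trans (ler_normD _ _)); rewrite mulr_natl mulr2n addrA; apply: lerD.
  apply: (le_trans (ler_normD _ _)); rewrite !normrM; apply: lerD.
    by rewrite expr2; apply: ler_pM => //; exact: entry_norm.
  by apply: ler_pM => //; exact: entry_norm.
by rewrite normrM mulrC; apply: ler_pM => //; exact: entry_norm.
Qed.

Lemma mulmxT_bound S i j : `|(S *m S^T) i j| <= m%:R * `|S| ^+ 2.
Proof.
have := mulmxT_diff S 0 i j.
by rewrite mul0mx [X in _ - X]mxE !subr0 normr0 !mulr0 addr0.
Qed.

Lemma sum_norm_le (f : 'I_d -> R) c : (forall i, `|f i| <= c) -> `|\sum_i f i| <= d%:R * c.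
Proof.
move=> H; apply: (le_trans (ler_norm_sum _ _ _)).
have -> : d%:R * c = \sum_(k < d) c by rewrite sumr_const card_ord mulr_natl.
exact: ler_sum.
Qed.

(** Stability of the generator in its coefficients and in the point. The
factor of the unbounded coefficients is capped at 1, see [test_minlip]. *)
Lemma genop_pert h : test_function h -> exists2 C0, 0 <= C0 & forall S S' B B' x y,
  `|genop S B h y - genop S' B' h x| <= C0 * (`|S - S'| ^+ 2 + `|S - S'| * `|S'| + `|B - B'|
     + (`|B'| + `|S'| ^+ 2) * Num.min 1 `|y - x|).
Proof.
move=> th; have [K K0 [H1 H2 H3 H4]] := test_unif th.
exists (d%:R * (d%:R * (m%:R * K)) * 2 + d%:R * K * 2).
  by rewrite !(addr_ge0, mulr_ge0).
move=> S S' B B' x y.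
have mn : 0 <= Num.min 1 `|y - x| :> R by rewrite le_min ler01 normr_ge0.
set mi := Num.min _ _ in mn *.
set D2 := `|S - S'| ^+ 2 + 2 * (`|S - S'| * `|S'|).
have D20 : 0 <= D2 by rewrite addr_ge0// ?exprn_ge0// !mulr_ge0.
have A1 : `|\sum_i \sum_j (S *m S^T) i j * partial i (partial j h) y -
    \sum_i \sum_j (S' *m S'^T) i j * partial i (partial j h) x| <=
    d%:R * (d%:R * (m%:R * K * (D2 + `|S'| ^+ 2 * mi))).
  rewrite -sumrB; apply: sum_norm_le => i; rewrite -sumrB; apply: sum_norm_le => j.
  set s := (S *m S^T) i j; set s' := (S' *m S'^T) i j; set p := partial i _ y; set p' := partial i _ x.
  have -> : s * p - s' * p' = (s - s') * p + s' * (p - p') by ring.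
  apply: (le_trans (ler_normD _ _)); rewrite [leRHS]mulrDr !normrM; apply: lerD.
    by rewrite mulrAC; apply: ler_pM => //; [exact: mulmxT_diff|exact: H2].
  have -> : m%:R * K * (`|S'| ^+ 2 * mi) = (m%:R * `|S'| ^+ 2) * (K * mi) by ring.
  by apply: ler_pM => //; [exact: mulmxT_bound|exact: H4].
have A2 : `|\sum_i B 0 i * partial i h y - \sum_i B' 0 i * partial i h x| <=
    d%:R * (K * (`|B - B'| + `|B'| * mi)).
  rewrite -sumrB; apply: sum_norm_le => i.
  set p := partial i _ y; set p' := partial i _ x.
  have -> : B 0 i * p - B' 0 i * p' = (B - B') 0 i * p + B' 0 i * (p - p') by rewrite !mxE; ring.
  apply: (le_trans (ler_normD _ _)); rewrite [leRHS]mulrDr !normrM; apply: lerD.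
    by rewrite mulrC; apply: ler_pM => //; [exact: H1|exact: entry_norm].
  by rewrite mulrCA; apply: ler_pM => //; [exact: entry_norm|exact: H3].
rewrite /genop opprD addrACA -mulrBr.
apply: (le_trans (ler_normD _ _)); rewrite normrM ger0_norm//.
have e1 : D2 + `|S'| ^+ 2 * mi <= 2 * (`|S - S'| ^+ 2 + `|S - S'| * `|S'| + `|B - B'| + (`|B'| + `|S'| ^+ 2) * mi).
  rewrite /D2.
  have := normr_ge0 (B - B'); have : 0 <= `|B'| * mi by rewrite mulr_ge0.
  have : 0 <= `|S'| ^+ 2 * mi by rewrite mulr_ge0// exprn_ge0.
  have : 0 <= `|S - S'| ^+ 2 by rewrite exprn_ge0.
  lra.
have e2 : `|B - B'| + `|B'| * mi <= 2 * (`|S - S'| ^+ 2 + `|S - S'| * `|S'| + `|B - B'| + (`|B'| + `|S'| ^+ 2) * mi).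
  have := normr_ge0 (B - B'); have : 0 <= `|B'| * mi by rewrite mulr_ge0.
  have : 0 <= `|S'| ^+ 2 * mi by rewrite mulr_ge0// exprn_ge0.
  have : 0 <= `|S - S'| ^+ 2 by rewrite exprn_ge0.
  have : 0 <= `|S - S'| * `|S'| by rewrite mulr_ge0.
  lra.
set G0 := `|S - S'| ^+ 2 + _ + _ + _ in e1 e2 *.
rewrite mulrDl; apply: lerD.
  have hh : (2^-1 : R) <= 1 by lra.
  apply: (le_trans (ler_piMl (normr_ge0 _) hh)); apply: (le_trans A1).
  have -> : d%:R * (d%:R * (m%:R * K)) * 2 * G0 = d%:R * (d%:R * (m%:R * K * (2 * G0))) by ring.
  by rewrite !ler_wpM2l// mulr_ge0.
apply: (le_trans A2).
have -> : d%:R * K * 2 * G0 = d%:R * (K * (2 * G0)) by ring.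
by rewrite !ler_wpM2l.
Qed.

Lemma genop_le h : test_function h -> exists2 C0, 0 <= C0 & forall S B x,
  `|genop S B h x| <= C0 * (`|S| ^+ 2 + `|B|).
Proof.
move=> th; have [C0 C00 HC] := genop_pert th; exists C0 => // S B x.
have := HC S 0 B 0 x x; rewrite !subr0 !normr0 expr0n/= !mulr0 !addr0 mul0r addr0.
suff -> : genop 0 0 h x = 0 by rewrite subr0.
rewrite /genop [X in _ + X]big1 ?addr0; last by move=> i _; rewrite mxE mul0r.
by rewrite big1 ?mulr0// => i _; rewrite big1// => j _; rewrite mul0mx mxE mul0r.
Qed.

Lemma genop_bound h C M : test_function h -> 0 <= C -> 0 <= M -> exists2 K, 0 <= K &
  forall S B x, (forall i k, `|S i k| <= C) -> (forall i, `|B 0 i| <= M) -> `|genop S B h x| <= K.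
Proof.
move=> th C0 M0; have [C1 C10 HC] := genop_le th; exists (C1 * (C ^+ 2 + M)).
  by rewrite mulr_ge0// addr_ge0 ?exprn_ge0.
move=> S B x SC BM; apply: (le_trans (HC _ _ _)); rewrite ler_wpM2l// lerD//.
  by rewrite lerXn2r ?nnegrE//; exact: norm_mx_le.
by apply: norm_mx_le => // i j; rewrite ord1.
Qed.

Lemma genop_meas h dU (U : measurableType dU) (S : U -> 'M[R]_(d, m)) (B x : U -> 'rV[R]_d) :
  test_function h -> measurable_fun setT S -> measurable_fun setT B -> measurable_fun setT x ->
  measurable_fun setT (fun u => genop (S u) (B u) h (x u)).
Proof.
move=> th mS mB mx; have mSe i k := measurable_entry i k mS.
have mh f : test_function f -> measurable_fun setT (fun u => f (x u)).
  by move=> tf; apply: measurableT_comp mx; exact: test_measurable.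
apply: measurable_funD.
  apply: measurable_funM => //; apply: measurable_fun_sumr => i _.
  apply: measurable_fun_sumr => j _; apply: measurable_funM; last first.
    exact: (mh _ (test_partial i (test_partial j th))).
  rewrite (_ : (fun _ => _) = (fun u => \sum_k S u i k * S u j k)).
    by apply: measurable_fun_sumr => k _; exact: measurable_funM.
  by apply/funext => u; rewrite mxE; apply: eq_bigr => k _; rewrite mxE.
apply: measurable_fun_sumr => i _; apply: measurable_funM; first exact: measurable_entry.
exact: (mh _ (test_partial i th)).
Qed.

(** [taylor3] at the sum of a drift displacement y and a martingale displacement
z. Quadratic terms with a factor y go to the error, since y will be of the
order of the length of the time step and z of its square root. *)
Lemma taylor_split h : test_function h -> exists2 K, 0 <= K & forall x y z,
  `|h (x + (y + z)) - h x - \sum_i y 0 i * partial i h x - \sum_i z 0 i * partial i h x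
    - 2^-1 * \sum_i \sum_j z 0 i * z 0 j * partial i (partial j h) x|
  <= K * (`|y| ^+ 3 + `|z| ^+ 3 + `|y| ^+ 2 + `|y| * `|z|).
Proof.
move=> th; have [K K0 [_ H2 _ _]] := test_unif th; have [K3 K30 H3] := taylor3 th.
exists (4 * K3 + d%:R * (d%:R * K) * 2); first by rewrite !(addr_ge0, mulr_ge0).
move=> x y z; have := H3 x (y + z).
set X := `|y|; set Z := `|z|.
have X0 : 0 <= X by exact: normr_ge0.
have Z0 : 0 <= Z by exact: normr_ge0.
set s2 := \sum_i \sum_j (y + z) 0 i * _ * _.
set t2 := \sum_i \sum_j z 0 i * _ * _.
have A : `|s2 - t2| <= d%:R * (d%:R * (K * (X ^+ 2 + 2 * (X * Z)))).
  rewrite -sumrB; apply: sum_norm_le => i; rewrite -sumrB; apply: sum_norm_le => j.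
  rewrite -mulrBl normrM mulrC; apply: ler_pM; [by []|by []|exact: H2|].
  have -> : (y + z) 0 i * (y + z) 0 j - z 0 i * z 0 j = (y 0 i * y 0 j + y 0 i * z 0 j) + y 0 j * z 0 i.
    by rewrite !mxE; ring.
  apply: (le_trans (ler_normD _ _)); rewrite mulr_natl mulr2n addrA; apply: lerD.
    apply: (le_trans (ler_normD _ _)); rewrite !normrM; apply: lerD.
      by rewrite expr2; apply: ler_pM => //; exact: entry_norm.
    by apply: ler_pM => //; exact: entry_norm.
  by rewrite normrM; apply: ler_pM => //; exact: entry_norm.
have n3 : `|y + z| ^+ 3 <= 4 * (X ^+ 3 + Z ^+ 3).
  apply: (@le_trans _ _ ((X + Z) ^+ 3)).
    by rewrite lerXn2r ?nnegrE ?addr_ge0// ler_normD.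
  have : 0 <= (X + Z) * (X - Z) ^+ 2 by rewrite mulr_ge0 ?addr_ge0 ?sqr_ge0.
  nra.
have -> : \sum_i (y + z) 0 i * partial i h x = \sum_i y 0 i * partial i h x + \sum_i z 0 i * partial i h x.
  by rewrite -big_split; apply: eq_bigr => i _; rewrite mxE mulrDl.
set sy := \sum_i y 0 i * _; set sz := \sum_i z 0 i * _.
set H := h _; set H0 := h x => Hyp.
have -> : H - H0 - sy - sz - 2^-1 * t2 = (H - H0 - (sy + sz) - 2^-1 * s2) + 2^-1 * (s2 - t2) by ring.
have p1 : 0 <= X ^+ 3 by rewrite exprn_ge0.
have p2 : 0 <= Z ^+ 3 by rewrite exprn_ge0.
have p3 : 0 <= X ^+ 2 by rewrite exprn_ge0.
have p4 : 0 <= X * Z by rewrite mulr_ge0.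
apply: (le_trans (ler_normD _ _)); rewrite mulrDl; apply: lerD.
  apply: (le_trans Hyp); apply: (@le_trans _ _ (K3 * (4 * (X ^+ 3 + Z ^+ 3)))).
    by rewrite ler_wpM2l.
  by rewrite mulrCA mulrA ler_wpM2l ?mulr_ge0//; lra.
rewrite normrM ger0_norm//; apply: (@le_trans _ _ `|s2 - t2|).
  by have := normr_ge0 (s2 - t2); lra.
apply: (le_trans A); rewrite -!mulrA !ler_wpM2l//; lra.
Qed.

End Deterministic.

(** * Drift integrals and Fubini on time times space *)

Section Sections.
Context d1 d2 d3 (T1 : measurableType d1) (T2 : measurableType d2) (T3 : measurableType d3).
Variable f : T1 -> T2 -> T3.
Hypothesis mf : measurable_fun setT (fun z : T1 * T2 => f z.1 z.2).

Lemma meas_sec1 (w : T2) : measurable_fun setT (fun u => f u w).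
Proof.
exact: (measurableT_comp mf (pair2_measurable w)).
Qed.

Lemma meas_sec2 (u : T1) : measurable_fun setT (fun w => f u w).
Proof.
exact: (measurableT_comp mf (pair1_measurable u)).
Qed.
End Sections.

Section Drift.
Variable R : realType.

Lemma lebitv_integrable (a c : R) (f : R -> R) : integ (lebitv a c) f ->
  (@lebesgue_measure R).-integrable `[a, c] (EFin \o f).
Proof.
move=> iff; have mf := integ_meas iff.
have mfe : measurable_fun setT (EFin \o f) by exact/measurable_EFinP.
have mn : measurable_fun setT (fun x : R => `|(EFin \o f) x|%E) by apply: measurableT_comp.
move/integrableP: iff => [_ H]; apply/integrableP; split; first exact: measurable_funTS.
by rewrite -lebitv_integral.
Qed.

Lemma lebitv_split (a v c : R) (f : R -> R) : a <= v -> v <= c -> integ (lebitv a c) f ->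
  \int[lebitv a c]_u f u = \int[lebitv a v]_u f u + \int[lebitv v c]_u f u.
Proof.
move=> av vc iff; have mf := integ_meas iff.
have iL := lebitv_integrable iff.
rewrite !lebitv_Rint// -(@Rintegral_itv_obnd_cbnd _ v (BRight c)); last first.
  by apply: integrableS iL => //; apply: subset_itv; rewrite bnd_simp.
have E : `[a, c]%classic = `[a, v]%classic `|` `]v, c]%classic.
  by rewrite -itv_bndbnd_setU// bnd_simp.
rewrite E Rintegral_setU//; first by rewrite -E.
apply/disj_setPS => y [/=]; rewrite 2!in_itv/= => /andP[_ yx] /andP[].
by rewrite ltNge yx.
Qed.

Lemma drift_bound (a v : R) (f : R -> R) M : a <= v -> measurable_fun setT f ->
  (forall u, `|f u| <= M) -> `|\int[lebitv a v]_u f u| <= M * (v - a).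
Proof.
move=> av mf fM; rewrite -lebitv_cst//; apply: Rint_norm_le => //.
- exact: (integ_b (lebitv_lt a v) mf fM).
- exact: (integ_b (lebitv_lt a v) (measurable_cst M) (k := `|M|)).
Qed.

Lemma lebitv_empty (a v : R) (f : R -> R) : v <= a -> measurable_fun setT f ->
  \int[lebitv a v]_u f u = 0.
Proof.
rewrite le_eqVlt => /orP[/eqP->|va] mf; rewrite lebitv_Rint//.
  by rewrite set_itv1 Rintegral_set1.
by rewrite set_itv_ge ?Rintegral_set0// bnd_simp -ltNge.
Qed.

Lemma drift_lip (a v v' : R) (f : R -> R) M : 0 <= M -> measurable_fun setT f ->
  (forall u, `|f u| <= M) ->
  `|\int[lebitv a v']_u f u - \int[lebitv a v]_u f u| <= M * `|v' - v|.
Proof.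
move=> M0 mf fM.
wlog vv : v v' / v <= v'.
  move=> H; have [|/ltW] := leP v v'; first exact: H.
  by move=> /H; rewrite distrC (distrC v).
rewrite (@ger0_norm _ (v' - v)) ?subr_ge0//.
have [av|/ltW va] := leP a v.
  rewrite (lebitv_split av vv); last exact: (integ_b (lebitv_lt a v') mf fM).
  by rewrite addrC addKr; exact: drift_bound.
rewrite (@lebitv_empty a v)// subr0.
have [av'|/ltW va'] := leP a v'.
  by apply: (le_trans (drift_bound av' mf fM)); rewrite ler_wpM2l// lerD2l lerN2.
by rewrite lebitv_empty// normr0 mulr_ge0// subr_ge0.
Qed.

Lemma drift_continuous (a : R) (f : R -> R) M : 0 <= M -> measurable_fun setT f ->
  (forall u, `|f u| <= M) -> continuous (fun v => \int[lebitv a v]_u f u).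
Proof.
move=> M0 mf fM v; apply/cvgrPdist_le => e e0; near=> v'.
rewrite distrC; apply: (le_trans (drift_lip _ _ _ M0 mf fM)).
apply: (@le_trans _ _ ((M + 1) * `|v' - v|)); first by rewrite ler_wpM2r// lerDl.
rewrite -ler_pdivlMl ?ltr_wpDl// distrC.
by near: v'; apply: cvgr_dist_le => //; rewrite mulr_gt0// invr_gt0 ltr_wpDl.
Unshelve. all: by end_near. Qed.

(** Shifting by the bound M makes the integrand nonnegative, and Tonelli's
theorem applies. *)
Lemma drift_meas d (T : measurableType d) (a v : R) (f : R -> T -> R) M :
  measurable_fun setT (fun z : measurableTypeR R * T => f z.1 z.2) ->
  (forall u w, `|f u w| <= M) ->
  measurable_fun setT (fun w => \int[lebitv a v]_u f u w).
Proof.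
move=> mf fM.
have E w : \int[lebitv a v]_u f u w = \int[lebitv a v]_u (f u w + M) - \int[lebitv a v]_u M.
  rewrite -RintB; first by apply: Rint_eq => u; rewrite addrK.
  - apply: (@integ_b _ _ _ _ _ (M + M)); first exact: lebitv_lt.
      apply: measurable_funD => //; exact: (meas_sec1 mf).
    move=> u; rewrite (le_trans (ler_normD _ _))// lerD// ger0_norm//.
    by apply: le_trans (fM 0 w).
  - exact: (integ_b (lebitv_lt a v) (measurable_cst M) (k := `|M|)).
rewrite (_ : (fun _ => _) = (fun w => \int[lebitv a v]_u (f u w + M) - \int[lebitv a v]_u M)); last first.
  by apply/funext => w; exact: E.
apply: measurable_funB => //.
apply: (@measurableT_comp _ _ _ _ _ _ fine); first exact: fine_measurable.
apply: (@measurable_fun_fubini_tonelli_G _ _ _ _ R (lebitv a v)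
  (fun z : measurableTypeR R * T => (f z.1 z.2 + M)%:E)).
  by apply/measurable_EFinP; apply: measurable_funD.
by move=> z; rewrite lee_fin -lerBlDr sub0r; have := fM z.1 z.2; rewrite ler_norml => /andP[].
Qed.

End Drift.

Section Fubini.
Context d1 d2 (T1 : measurableType d1) (T2 : measurableType d2) (R : realType).
Variables (m1 : {sigma_finite_measure set T1 -> \bar R}) (m2 : {sigma_finite_measure set T2 -> \bar R}).
Variable G : T1 -> T2 -> R.
Hypothesis iG : integ (m1 \x m2)%E (fun z => G z.1 z.2).

Let F x := (\int[m2]_y (G x y)%:E)%E.
Let H y := (\int[m1]_x (G x y)%:E)%E.

(** The inner integrals are finite for almost every first coordinate, which is
enough for the real-valued iterated integral. *)
Lemma fubini12 : integ m1 (fun x => \int[m2]_y G x y) /\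
  \int[m1]_x \int[m2]_y G x y = \int[(m1 \x m2)%E]_z G z.1 z.2.
Proof.
have iF : m1.-integrable setT F by exact: (integrable_fubini_F iG).
have aeF : ae_eq m1 setT F (fun x => (\int[m2]_y G x y)%:E).
  have := integrable_ae measurableT iF; apply: filterS => x /(_ I) Fx _.
  by rewrite /Rintegral fineK.
have mF : measurable_fun setT (fun x => (\int[m2]_y G x y)%:E).
  apply/measurable_EFinP; apply: (@measurableT_comp _ _ _ _ _ _ fine _ F).
    exact: fine_measurable.
  exact: (measurable_int _ iF).
split.
  apply/integrableP; split => //; case/integrableP : iF => mF' H'.
  rewrite (_ : (\int[m1]_x _)%E = (\int[m1]_x `|F x|)%E)//.
  apply: ae_eq_integral => //; [exact: measurableT_comp|exact: measurableT_comp|].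
  by apply: filterS aeF => x /(_ I) Ex _; rewrite Ex.
rewrite /Rintegral -(integral12_prod_meas1 iG); congr fine.
apply: ae_eq_integral => //; first exact: (measurable_int _ iF).
by apply: filterS aeF => x /(_ I) Ex _; rewrite -Ex.
Qed.

Lemma fubini21 : integ m2 (fun y => \int[m1]_x G x y) /\
  \int[m2]_y \int[m1]_x G x y = \int[(m1 \x m2)%E]_z G z.1 z.2.
Proof.
have iF : m2.-integrable setT H.
  apply/integrableP; split; first exact: (measurable_fubini_G iG).
  have lt := (integrable21ltyP m1 m2 (measurable_int _ iG)).1 iG.
  apply: le_lt_trans lt.
  apply: ge0_le_integral => //.
  - by apply: measurableT_comp => //; exact: (measurable_fubini_G iG).
  - apply: (@measurable_fun_fubini_tonelli_G _ _ _ _ R m1 (fun z : T1 * T2 => `|(G z.1 z.2)%:E|%E)) => //.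
    by apply: measurableT_comp => //; exact: (measurable_int _ iG).
  - move=> y _; apply: le_abse_integral => //; apply/measurable_EFinP.
    exact: (meas_sec1 (integ_meas iG)).
have aeF : ae_eq m2 setT H (fun y => (\int[m1]_x G x y)%:E).
  have := integrable_ae measurableT iF; apply: filterS => x /(_ I) Fx _.
  by rewrite /Rintegral fineK.
have mF : measurable_fun setT (fun y => (\int[m1]_x G x y)%:E).
  apply/measurable_EFinP; apply: (@measurableT_comp _ _ _ _ _ _ fine _ H).
    exact: fine_measurable.
  exact: (measurable_int _ iF).
split.
  apply/integrableP; split => //; case/integrableP : iF => mF' H'.
  rewrite (_ : (\int[m2]_x _)%E = (\int[m2]_x `|H x|)%E)//.
  apply: ae_eq_integral => //; [exact: measurableT_comp|exact: measurableT_comp|].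
  by apply: filterS aeF => x /(_ I) Ex _; rewrite Ex.
rewrite /Rintegral -(integral21_prod_meas1 iG); congr fine.
apply: ae_eq_integral => //; first exact: (measurable_int _ iF).
by apply: filterS aeF => x /(_ I) Ex _; rewrite -Ex.
Qed.

End Fubini.

Section TimeSpace.
Context (R : realType) (dO : measure_display) (Omega : measurableType dO).
Variables (Q : probability Omega R).

Lemma lebitv_prod_lt a c : ((lebitv a c \x Q) setT < +oo)%E.
Proof.
rewrite -setXTT product_measure1E//.
have Q1 : (Q setT < +oo)%E by rewrite probability_setT ltry.
apply: lte_mul_pinfty => //.
by rewrite ge0_fin_numE//; exact: lebitv_lt.
Qed.

Lemma ts_integ_b a c (G : R -> Omega -> R) k :
  measurable_fun setT (fun z : measurableTypeR R * Omega => G z.1 z.2) ->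
  (forall v w, `|G v w| <= k) -> integ (lebitv a c \x Q)%E (fun z => G z.1 z.2).
Proof.
by move=> mG Gk; apply: (integ_b (lebitv_prod_lt a c) mG (k := k)) => z.
Qed.

Lemma ts_swap_b a c (G : R -> Omega -> R) k :
  measurable_fun setT (fun z : measurableTypeR R * Omega => G z.1 z.2) ->
  (forall v w, `|G v w| <= k) ->
  integ (lebitv a c) (fun v => \int[Q]_w G v w) /\
  \int[Q]_w \int[lebitv a c]_v G v w = \int[lebitv a c]_v \int[Q]_w G v w.
Proof.
move=> mG Gk; have iG := @ts_integ_b a c _ _ mG Gk.
by have [h1 ->] := fubini12 iG; have [_ ->] := fubini21 iG.
Qed.

End TimeSpace.

(** * One step of the Ito formula in expectation *)

Lemma mx_norm_meas (R : realType) k n : measurable_fun setT (fun M : 'M[R]_(k, n) => `|M|).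
Proof. by apply: continuous_measurable_mx => M; exact: norm_continuous. Qed.

Lemma row_norm_pow (R : realType) n (y : 'rV[R]_n) p : (0 < p)%N ->
  `|y| ^+ p <= \sum_k `|y 0 k| ^+ p.
Proof.
move=> p0; have [y0|y0] := eqVneq (mx_norm y) 0.
  have -> : `|y| = 0 by [].
  by rewrite expr0n gtn_eqF//= sumr_ge0// => k _; rewrite exprn_ge0.
have [[i k] /= E] := mx_norm_neq0 y0.
have -> : `|y| = `|y 0 k| by rewrite -(ord1 i).
by rewrite (bigD1 k)//= lerDl sumr_ge0// => j _; rewrite exprn_ge0.
Qed.

Lemma lebitv_eq (R : realType) (a c : R) (f g : R -> R) :
  measurable_fun setT f -> measurable_fun setT g ->
  (forall v, a <= v -> v <= c -> f v = g v) ->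
  \int[lebitv a c]_v f v = \int[lebitv a c]_v g v.
Proof.
move=> mf mg H; rewrite !lebitv_Rint//; apply: eq_Rintegral => v.
by rewrite inE/= in_itv/= => /andP[]; exact: H.
Qed.

Lemma lebitv_norm_le (R : realType) (a c : R) (f : R -> R) B : a <= c ->
  measurable_fun setT f -> (forall v, a <= v -> v <= c -> `|f v| <= B) ->
  `|\int[lebitv a c]_v f v| <= B * (c - a).
Proof.
move=> ac mf H; have B0 : 0 <= B by apply: le_trans (H a (lexx a) ac).
rewrite (@lebitv_eq _ _ _ _ (fun v => f v * \1_(`[a, c]%classic) v))//.
- apply: drift_bound => //; first exact: measurable_funM.
  move=> u; rewrite indicE; case: (boolP (u \in _)) => [|_].
    by rewrite inE/= in_itv/= mulr1 => /andP[]; exact: H.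
  by rewrite mulr0 normr0.
- exact: measurable_funM.
- by move=> v av vc; rewrite indicE mem_set ?mulr1//= in_itv/= av.
Qed.

Section OneStep.
Context (R : realType) (dO : measure_display) (Omega : measurableType dO).
Variables (Q : probability Omega R) (m d : nat) (F : R -> set (set Omega)).
Variable (W : Omega -> cpath R m 0).
Hypotheses (hF : filtration F) (hW : brownian_motion Q F W).
Notation Om a := (g_sigma_algebraType (F a)).
Notation inc := (increment W).

Definition dW (a c : R) (w : Omega) : 'rV[R]_m := W w c - W w a.

Lemma dWE a c w k : dW a c w 0 k = inc a c k w.
Proof. by rewrite /dW !mxE. Qed.

Lemma dW_meas a c : 0 <= a -> a <= c -> measurable_fun setT (dW a c).
Proof.
move=> a0 ac; apply: measurable_mx => i j.
rewrite (_ : (fun _ => _) = inc a c j); first exact: (inc_meas hF hW).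
by apply/funext => w; rewrite ord1 dWE.
Qed.

Lemma dW_norm3 a c : 0 <= a -> a <= c ->
  integ Q (fun w => `|dW a c w| ^+ 3) /\
  \int[Q]_w (`|dW a c w| ^+ 3) <= 32 * m%:R * Num.sqrt (c - a) ^+ 3.
Proof.
move=> a0 ac.
have is_ : integ Q (fun w => \sum_k `|inc a c k w| ^+ 3).
  by apply: integ_sum => k _; exact: (inc_abs3 hF hW k a0 ac).1.
have le w : `|dW a c w| ^+ 3 <= \sum_k `|inc a c k w| ^+ 3.
  by apply: (le_trans (row_norm_pow _ _)) => //; apply: ler_sum => k _; rewrite dWE.
have i3 : integ Q (fun w => `|dW a c w| ^+ 3).
  apply: (@integ_le _ _ _ _ _ (fun w => \sum_k `|inc a c k w| ^+ 3)) => //.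
    apply: measurable_funX; apply: (measurableT_comp (@mx_norm_meas R 1 m)).
    exact: dW_meas.
  by move=> w; rewrite ger0_norm ?exprn_ge0.
split=> //; apply: (le_trans (Rint_le i3 is_ le)).
rewrite Rint_sum; last by move=> k _; exact: (inc_abs3 hF hW k a0 ac).1.
have -> : 32 * m%:R * Num.sqrt (c - a) ^+ 3 = \sum_(k < m) (32 * Num.sqrt (c - a) ^+ 3).
  by rewrite sumr_const card_ord -mulr_natl; ring.
by apply: ler_sum => k _; exact: (inc_abs3 hF hW k a0 ac).2.
Qed.

(** The first moment is bounded through the third one, by comparing with q below
the level q and with the cube above it. *)
Lemma dW_norm1 a c q : 0 < q -> 0 <= a -> a <= c -> Num.sqrt (c - a) <= q ->
  integ Q (fun w => `|dW a c w|) /\ \int[Q]_w `|dW a c w| <= (1 + 32 * m%:R) * q.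
Proof.
move=> q0 a0 ac cq; have [i3 H3] := dW_norm3 a0 ac.
have le w : `|dW a c w| <= q + q ^- 2 * `|dW a c w| ^+ 3.
  set x := `|_|; have x0 : 0 <= x by exact: normr_ge0.
  have [xq|/ltW qx] := leP x q.
    by rewrite (le_trans xq)// lerDl mulr_ge0 ?exprn_ge0// invr_ge0 exprn_ge0// ltW.
  apply: (@le_trans _ _ (q ^- 2 * x ^+ 3)); last by rewrite lerDr ltW.
  rewrite mulrC ler_pdivlMr ?exprn_gt0// [x ^+ 3]exprS ler_wpM2l//.
  by rewrite lerXn2r// nnegrE ltW.
have ir : integ Q (fun w => q + q ^- 2 * `|dW a c w| ^+ 3).
  by apply: integD; [exact: integ_cst|exact: integZ].
have i1 : integ Q (fun w => `|dW a c w|).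
  apply: (integ_le _ ir) => [|w]; last by rewrite ger0_norm.
  by apply: (measurableT_comp (@mx_norm_meas R 1 m)); exact: dW_meas.
split=> //; apply: (le_trans (Rint_le i1 ir le)).
rewrite RintD; [|exact: integ_cst|exact: integZ].
rewrite Rint_cst RintZ// mulrDl mul1r lerD2l mulrC ler_pdivrMr ?exprn_gt0//.
apply: (le_trans H3); rewrite -!mulrA !ler_wpM2l//.
rewrite -exprS; apply: lerXn2r => //; rewrite nnegrE ?sqrtr_ge0 ?ltW//.
Qed.

Lemma mulmx_norm (u : 'rV[R]_m) (S : 'M[R]_(d, m)) C : 0 <= C ->
  (forall i k, `|S i k| <= C) -> `|u *m S^T| <= m%:R * C * `|u|.
Proof.
move=> C0 SC; apply: norm_mx_le => [|i j]; first by rewrite !mulr_ge0.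
rewrite mxE; apply: (le_trans (ler_norm_sum _ _ _)).
have -> : m%:R * C * `|u| = \sum_(k < m) (`|u| * C).
  by rewrite sumr_const card_ord -mulr_natl; ring.
apply: ler_sum => k _; rewrite normrM !mxE; apply: ler_pM => //.
exact: entry_norm.
Qed.

Section Step.
Variables (a c C M K : R).
Hypotheses (a0 : 0 <= a) (ac : a < c) (ca1 : c - a <= 1) (C0 : 0 <= C) (M0 : 0 <= M) (K0 : 0 <= K).
Variables (S : Omega -> 'M[R]_(d, m)) (D : Omega -> R) (beta : R -> Omega -> 'rV[R]_d)
  (Y : R -> Omega -> 'rV[R]_d).
Hypotheses (mYa : measurable_fun setT (Y a : Om a -> 'rV[R]_d))
  (mS : measurable_fun setT (S : Om a -> 'M[R]_(d, m))) (SC : forall w i k, `|S w i k| <= C)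
  (mD : measurable_fun setT (D : Om a -> R)) (DK : forall w, `|D w| <= K)
  (mb : measurable_fun setT (fun z : measurableTypeR R * Omega => beta z.1 z.2))
  (bM : forall v w i, `|beta v w 0 i| <= M)
  (mY : measurable_fun setT (fun z : measurableTypeR R * Omega => Y z.1 z.2)).

Definition drift_part (v : R) (w : Omega) : 'rV[R]_d := \row_i \int[lebitv a v]_u beta u w 0 i.
Definition noise_part (v : R) (w : Omega) : 'rV[R]_d := dW a v w *m (S w)^T.

Hypothesis hY : forall v w, a <= v -> v <= c -> Y v w = Y a w + (drift_part v w + noise_part v w).

Let tau := c - a.
Let q := Num.sqrt tau.
Let tau0 : 0 < tau. Proof. by rewrite subr_gt0. Qed.
Let q0 : 0 < q. Proof. by rewrite sqrtr_gt0. Qed.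
Let qq : q ^+ 2 = tau. Proof. by rewrite sqr_sqrtr// ltW. Qed.
Let q1 : q <= 1. Proof. by rewrite -sqrtr1 ler_sqrt. Qed.

Lemma beta_entry i : measurable_fun setT (fun z : measurableTypeR R * Omega => beta z.1 z.2 0 i).
Proof. exact: measurable_entry. Qed.

Lemma drift_part_norm v w : a <= v -> v <= c -> `|drift_part v w| <= M * tau.
Proof.
move=> av vc; apply: norm_mx_le => [|i j]; first by rewrite mulr_ge0// ltW.
rewrite mxE; apply: (@le_trans _ _ (M * (v - a))).
  apply: drift_bound => //.
  exact: (meas_sec1 (f := fun u w => beta u w 0 j) (beta_entry j) w).
by rewrite ler_wpM2l// lerD2r.
Qed.

Lemma noise_part_norm v w : `|noise_part v w| <= m%:R * C * `|dW a v w|.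
Proof. exact: mulmx_norm. Qed.

Lemma noise_part_entry v w i : noise_part v w 0 i = \sum_k S w i k * inc a v k w.
Proof. by rewrite /noise_part mxE; apply: eq_bigr => k _; rewrite dWE mxE mulrC. Qed.

Let mSe i k : measurable_fun setT ((fun w => S w i k) : Om a -> R).
Proof. exact: measurable_entry. Qed.

Lemma noise_part_mean (f : Omega -> R) B i : measurable_fun setT (f : Om a -> R) -> (forall w, `|f w| <= B) ->
  integ Q (fun w => f w * noise_part c w 0 i) /\ \int[Q]_w (f w * noise_part c w 0 i) = 0.
Proof.
move=> mf fB.
have H k : integ Q (fun w => (f w * S w i k) * inc a c k w) /\
    \int[Q]_w ((f w * S w i k) * inc a c k w) = 0.
  apply: (inc_mean hF hW k a0 (ltW ac)); first exact: measurable_funM.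
  apply: (@prob_integ_b _ _ _ _ _ (B * C)) => [|w].
    by apply: (adapted_meas hF a0); exact: measurable_funM.
  by rewrite normrM ler_pM.
have E w : f w * noise_part c w 0 i = \sum_k (f w * S w i k) * inc a c k w.
  by rewrite noise_part_entry mulr_sumr; apply: eq_bigr => k _; rewrite mulrA.
split; first by apply: (eq_integ E); apply: integ_sum => k _; exact: (H k).1.
rewrite (Rint_eq _ E) Rint_sum; last by move=> k _; exact: (H k).1.
by rewrite big1// => k _; exact: (H k).2.
Qed.

Lemma noise_part_cov (f : Omega -> R) B i j : measurable_fun setT (f : Om a -> R) -> (forall w, `|f w| <= B) ->
  integ Q (fun w => f w * (noise_part c w 0 i * noise_part c w 0 j)) /\
  \int[Q]_w (f w * (noise_part c w 0 i * noise_part c w 0 j)) = tau * \int[Q]_w (f w * (S w *m (S w)^T) i j).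
Proof.
move=> mf fB.
have mz k l : measurable_fun setT ((fun w => f w * (S w i k * S w j l)) : Om a -> R).
  by apply: measurable_funM => //; apply: measurable_funM.
have iz k l : integ Q (fun w => f w * (S w i k * S w j l)).
  apply: (@prob_integ_b _ _ _ _ _ (B * (C * C))) => [|w].
    by apply: (adapted_meas hF a0); exact: mz.
  by rewrite normrM ler_pM// normrM ler_pM.
have H k l := inc_cov hF hW k l a0 (ltW ac) (mz k l) (iz k l).
have E w : f w * (noise_part c w 0 i * noise_part c w 0 j) =
    \sum_k \sum_l (f w * (S w i k * S w j l)) * (inc a c k w * inc a c l w).
  rewrite !noise_part_entry mulr_suml mulr_sumr; apply: eq_bigr => k _.
  by rewrite mulr_sumr mulr_sumr; apply: eq_bigr => l _; ring.
split; first by apply: (eq_integ E); apply: integ_sum => k _; apply: integ_sum => l _; exact: (H k l).1.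
rewrite (Rint_eq _ E) Rint_sum; last by move=> k _; apply: integ_sum => l _; exact: (H k l).1.
have E2 w : f w * (S w *m (S w)^T) i j = \sum_k f w * (S w i k * S w j k).
  by rewrite mxE mulr_sumr; apply: eq_bigr => k _; rewrite mxE.
rewrite (Rint_eq _ E2) Rint_sum// mulr_sumr; apply: eq_bigr => k _.
rewrite Rint_sum; last by move=> l _; exact: (H k l).1.
rewrite (bigD1 k)//= (H k k).2 eqxx mul1r big1 ?addr0// => l lk.
by rewrite (H k l).2 eq_sym (negbTE lk) !mul0r.
Qed.

Variables (h : 'rV[R]_d -> R) (Kh K1 C1 : R).
Hypotheses (th : test_function h) (Kh0 : 0 <= Kh) (K10 : 0 <= K1) (C10 : 0 <= C1).
Hypothesis hKh : [/\ forall i x, `|partial i h x| <= Kh,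
      forall i j x, `|partial i (partial j h) x| <= Kh & forall x, `|h x| <= Kh].
Hypothesis hK1 : forall x y z : 'rV[R]_d,
  `|h (x + (y + z)) - h x - \sum_i y 0 i * partial i h x - \sum_i z 0 i * partial i h x
    - 2^-1 * \sum_i \sum_j z 0 i * z 0 j * partial i (partial j h) x|
  <= K1 * (`|y| ^+ 3 + `|z| ^+ 3 + `|y| ^+ 2 + `|y| * `|z|).
Hypothesis hC1 : forall (S S' : 'M[R]_(d, m)) B B' x y,
  `|genop S B h y - genop S' B' h x| <= C1 * (`|S - S'| ^+ 2 + `|S - S'| * `|S'| + `|B - B'|
     + (`|B'| + `|S'| ^+ 2) * Num.min 1 `|y - x|).

Let c0 : 0 <= c. Proof. by rewrite (le_trans a0)// ltW. Qed.
Let mD' : measurable_fun setT D. Proof. exact: (adapted_meas hF a0 mD). Qed.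
Let mYv v : measurable_fun setT (Y v). Proof. exact: (meas_sec2 mY). Qed.
Let m_h f v : test_function f -> measurable_fun setT (fun w => f (Y v w)).
Proof. by move=> tf; apply: measurableT_comp (mYv v); exact: test_measurable. Qed.
Let m_ha f : test_function f -> measurable_fun setT ((fun w => f (Y a w)) : Om a -> R).
Proof. by move=> tf; apply: measurableT_comp mYa; exact: test_measurable. Qed.

Let tp i := test_partial i th.
Let tpp i j := test_partial i (test_partial j th).

Let f1 i w := D w * partial i h (Y a w).
Let f2 i j w := D w * partial i (partial j h) (Y a w).
Let mf1 i : measurable_fun setT (f1 i : Om a -> R).
Proof. by apply: measurable_funM => //; exact: m_ha (tp i). Qed.
Let mf2 i j : measurable_fun setT (f2 i j : Om a -> R).
Proof. by apply: measurable_funM => //; exact: m_ha (tpp i j). Qed.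
Let f1b i w : `|f1 i w| <= K * Kh.
Proof. by rewrite normrM ler_pM//; case: hKh. Qed.
Let f2b i j w : `|f2 i j w| <= K * Kh.
Proof. by rewrite normrM ler_pM//; case: hKh. Qed.

Let rho w := h (Y c w) - h (Y a w) - \sum_i drift_part c w 0 i * partial i h (Y a w)
   - \sum_i noise_part c w 0 i * partial i h (Y a w)
   - 2^-1 * \sum_i \sum_j noise_part c w 0 i * noise_part c w 0 j * partial i (partial j h) (Y a w).

Let R2 := K1 * (M ^+ 3 + M ^+ 2 + M * (m%:R * C) + (m%:R * C) ^+ 3 + M * (m%:R * C)).

Lemma rho_bound w : `|rho w| <= R2 * (tau * q + `|dW a c w| ^+ 3).
Proof.
rewrite /rho (hY w (ltW ac) (lexx c)).
apply: (le_trans (hK1 _ _ _)).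
have A1 := drift_part_norm w (ltW ac) (lexx c); have A2 := noise_part_norm c w.
set N := `|dW a c w| in A2 *; have N0 : 0 <= N by exact: normr_ge0.
set x := `|drift_part c w| in A1 *; have x0 : 0 <= x by exact: normr_ge0.
set z := `|noise_part c w| in A2 *; have z0 : 0 <= z by exact: normr_ge0.
have p : 0 <= m%:R * C by rewrite mulr_ge0.
set L := m%:R * C in A2 p *.
rewrite /R2 -mulrA ler_wpM2l//.
have tq : tau <= q by rewrite -qq expr2 ler_piMl// ltW.
have tau1 : tau <= 1 := ca1.
have tN : tau * N <= tau * q + N ^+ 3.
  have [Nq|/ltW qN] := leP N q.
    apply: (@le_trans _ _ (tau * q)); first by rewrite ler_wpM2l// ltW.
    by rewrite lerDl exprn_ge0.
  apply: (@le_trans _ _ (N ^+ 3)); last by rewrite lerDr mulr_ge0// ltW.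
  by rewrite -qq [N ^+ 3]exprSr ler_wpM2r// lerXn2r// nnegrE ltW.
have tq0 : 0 <= tau * q by rewrite mulr_ge0// ltW.
have N30 : 0 <= N ^+ 3 by rewrite exprn_ge0.
have b2 : x ^+ 2 <= M ^+ 2 * (tau * q).
  apply: (@le_trans _ _ ((M * tau) ^+ 2)); first by rewrite lerXn2r// nnegrE mulr_ge0// ltW.
  by rewrite exprMn ler_wpM2l ?exprn_ge0// expr2 ler_wpM2l// ltW.
have b3 : x ^+ 3 <= M ^+ 3 * (tau * q).
  apply: (@le_trans _ _ ((M * tau) ^+ 3)); first by rewrite lerXn2r// nnegrE mulr_ge0// ltW.
  rewrite exprMn ler_wpM2l ?exprn_ge0// exprS ler_wpM2l// ?(ltW tau0)//.
  by rewrite expr2 (le_trans _ tq)// ler_piMl// ltW.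
have b4 : z ^+ 3 <= L ^+ 3 * N ^+ 3.
  by rewrite -exprMn lerXn2r// nnegrE mulr_ge0.
have b5 : x * z <= M * L * (tau * q + N ^+ 3).
  apply: (@le_trans _ _ ((M * tau) * (L * N))); first exact: ler_pM.
  by rewrite mulrACA ler_wpM2l// mulr_ge0.
have M2 : 0 <= M ^+ 2 by rewrite exprn_ge0.
have M3 : 0 <= M ^+ 3 by rewrite exprn_ge0.
have L3 : 0 <= L ^+ 3 by rewrite exprn_ge0.
have ML : 0 <= M * L by rewrite mulr_ge0.
set T := tau * q in tq0 tN b2 b3 b5 *; set N3 := N ^+ 3 in N30 tN b4 b5 *.
have : 0 <= M ^+ 2 * N3 by rewrite mulr_ge0.
have : 0 <= M ^+ 3 * N3 by rewrite mulr_ge0.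
have : 0 <= L ^+ 3 * T by rewrite mulr_ge0.
have : 0 <= (M * L) * (T + N3) by rewrite mulr_ge0// addr_ge0.
have -> : (M ^+ 3 + M ^+ 2 + M * L + L ^+ 3 + M * L) * (T + N3) =
  M ^+ 3 * T + M ^+ 3 * N3 + (M ^+ 2 * T + M ^+ 2 * N3) + (L ^+ 3 * T + L ^+ 3 * N3)
  + M * L * (T + N3) + M * L * (T + N3) by ring.
lra.
Qed.

Let R3 := K * (R2 * (1 + 32 * m%:R)).

Let iD_h v : integ Q (fun w => D w * h (Y v w)).
Proof.
apply: (@prob_integ_b _ _ _ _ _ (K * Kh)) => [|w].
  by apply: measurable_funM => //; exact: m_h.
by rewrite normrM ler_pM//; case: hKh.
Qed.

Let drift_part_meas i : measurable_fun setT (fun w => drift_part c w 0 i).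
Proof.
rewrite (_ : (fun _ => _) = (fun w => \int[lebitv a c]_u beta u w 0 i)).
  by apply: (@drift_meas _ _ _ _ _ (fun u w => beta u w 0 i) M) => //; exact: beta_entry.
by apply/funext => w; rewrite /drift_part mxE.
Qed.

Let drift_part_integ i : integ Q (fun w => f1 i w * drift_part c w 0 i).
Proof.
apply: (@prob_integ_b _ _ _ _ _ (K * Kh * (M * tau))) => [|w].
  by apply: measurable_funM => //; exact: (adapted_meas hF a0).
by rewrite normrM ler_pM// (le_trans (entry_norm _ _ _))// drift_part_norm// ltW.
Qed.

Let ig1 i : integ (lebitv a c) (fun v => \int[Q]_w (f1 i w * beta v w 0 i)) /\
  \int[Q]_w (f1 i w * drift_part c w 0 i) = \int[lebitv a c]_v \int[Q]_w (f1 i w * beta v w 0 i).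
Proof.
have mj : measurable_fun setT (fun z : measurableTypeR R * Omega => f1 i z.2 * beta z.1 z.2 0 i).
  apply: measurable_funM; last exact: beta_entry.
  by apply: (measurableT_comp (f := f1 i)) => //; exact: (adapted_meas hF a0).
have bj (v : R) w : `|f1 i w * beta v w 0 i| <= K * Kh * M by rewrite normrM ler_pM.
have [h1 h2] := @ts_swap_b R _ _ Q a c (fun v w => f1 i w * beta v w 0 i) _ mj bj.
split=> //; rewrite -h2; apply: Rint_eq => w.
rewrite /drift_part mxE RintZ//.
apply: (integ_b (lebitv_lt a c) (k := M)) => //.
exact: (meas_sec1 (f := fun u w => beta u w 0 i) (beta_entry i) w).
Qed.

Let g0 := 2^-1 * \sum_i \sum_j \int[Q]_w (f2 i j w * (S w *m (S w)^T) i j).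

Let iSS i j : integ Q (fun w => f2 i j w * (S w *m (S w)^T) i j).
Proof.
apply: (@prob_integ_b _ _ _ _ _ (K * Kh * (m%:R * C ^+ 2))) => [|w].
  apply: measurable_funM; first exact: (adapted_meas hF a0).
  rewrite (_ : (fun _ => _) = (fun w => \sum_k S w i k * S w j k)).
    by apply: measurable_fun_sumr => k _; apply: measurable_funM; exact: (adapted_meas hF a0).
  by apply/funext => w; rewrite mxE; apply: eq_bigr => k _; rewrite mxE.
rewrite normrM ler_pM// (le_trans (mulmxT_bound _ _ _))// ler_wpM2l//.
by rewrite lerXn2r// ?nnegrE//; apply: norm_mx_le.
Qed.

(** Expectation of the expansion of h at the point Y a, with the generator
still evaluated at time a. *)
Lemma increment_expansion :
  `|\int[Q]_w (D w * h (Y c w)) - \int[Q]_w (D w * h (Y a w))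
    - (\sum_i \int[lebitv a c]_v \int[Q]_w (f1 i w * beta v w 0 i) + tau * g0)|
  <= R3 * (tau * q).
Proof.
have iI i : integ Q (fun w => f1 i w * noise_part c w 0 i) by exact: (noise_part_mean i (mf1 i) (f1b i)).1.
have iC i j : integ Q (fun w => f2 i j w * (noise_part c w 0 i * noise_part c w 0 j)).
  exact: (noise_part_cov i j (mf2 i j) (f2b i j)).1.
have E w : D w * rho w = (D w * h (Y c w) - D w * h (Y a w)) -
   (\sum_i f1 i w * drift_part c w 0 i + \sum_i f1 i w * noise_part c w 0 i +
    2^-1 * \sum_i \sum_j f2 i j w * (noise_part c w 0 i * noise_part c w 0 j)).
  rewrite /rho.
  have -> : \sum_i f1 i w * drift_part c w 0 i = D w * \sum_i drift_part c w 0 i * partial i h (Y a w).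
    by rewrite mulr_sumr; apply: eq_bigr => i _; rewrite /f1; ring.
  have -> : \sum_i f1 i w * noise_part c w 0 i = D w * \sum_i noise_part c w 0 i * partial i h (Y a w).
    by rewrite mulr_sumr; apply: eq_bigr => i _; rewrite /f1; ring.
  have -> : \sum_i \sum_j f2 i j w * (noise_part c w 0 i * noise_part c w 0 j) =
      D w * \sum_i \sum_j noise_part c w 0 i * noise_part c w 0 j * partial i (partial j h) (Y a w).
    rewrite mulr_sumr; apply: eq_bigr => i _; rewrite mulr_sumr; apply: eq_bigr => j _.
    by rewrite /f2; ring.
  by ring.
have i1 : integ Q (fun w => \sum_i f1 i w * drift_part c w 0 i) by exact: integ_sum.
have i2 : integ Q (fun w => \sum_i f1 i w * noise_part c w 0 i) by exact: integ_sum.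
have i3' : integ Q (fun w => \sum_i \sum_j f2 i j w * (noise_part c w 0 i * noise_part c w 0 j)).
  by apply: integ_sum => i _; exact: integ_sum.
have i3 := integZ 2^-1 i3'.
have i12 := integD i1 i2; have i123 := integD i12 i3.
have ihh := integB (iD_h c) (iD_h a).
have irho : integ Q (fun w => D w * rho w) by apply: (eq_integ E); exact: integB.
have V : \int[Q]_w (D w * rho w) = \int[Q]_w (D w * h (Y c w)) - \int[Q]_w (D w * h (Y a w))
    - (\sum_i \int[lebitv a c]_v \int[Q]_w (f1 i w * beta v w 0 i) + tau * g0).
  rewrite (Rint_eq _ E) RintB// RintB// RintD// RintD// RintZ//.
  rewrite !Rint_sum//; last by move=> i _; exact: integ_sum.
  congr (_ - (_ + _)).
    rewrite [X in _ + X]big1 ?addr0; last by move=> i _; exact: (noise_part_mean i (mf1 i) (f1b i)).2.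
    by apply: eq_bigr => i _; exact: (ig1 i).2.
  rewrite /g0 mulrCA; congr (_ * _); rewrite mulr_sumr; apply: eq_bigr => i _.
  rewrite Rint_sum// mulr_sumr; apply: eq_bigr => j _.
  exact: (noise_part_cov i j (mf2 i j) (f2b i j)).2.
rewrite -V.
have [iN HN] := dW_norm3 a0 (ltW ac).
have R20 : 0 <= R2 by rewrite /R2 !(mulr_ge0, addr_ge0, exprn_ge0).
have ib : integ Q (fun w => K * (R2 * (tau * q + `|dW a c w| ^+ 3))).
  by apply: integZ; apply: integZ; apply: integD => //; exact: integ_cst.
apply: (le_trans (Rint_norm_le irho ib _)).
  move=> w; rewrite normrM ler_pM//; exact: rho_bound.
rewrite RintZ; last by apply: integZ; apply: integD => //; exact: integ_cst.
rewrite RintZ; last by apply: integD => //; exact: integ_cst.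
rewrite RintD//; last exact: integ_cst.
rewrite Rint_cst /R3 -(mulrA K) -(mulrA R2); apply: ler_wpM2l => //; apply: ler_wpM2l => //.
rewrite [leRHS]mulrDl mul1r lerD2l; apply: (le_trans HN).
by rewrite -/tau -/q (exprSr q 2) qq.
Qed.

Lemma genop_measj : measurable_fun setT (fun z : measurableTypeR R * Omega =>
  genop (S z.2) (beta z.1 z.2) h (Y z.1 z.2)).
Proof.
apply: genop_meas => //.
by apply: (measurableT_comp (f := S)) => //; exact: (adapted_meas hF a0).
Qed.

Let sG := fun v w => D w * genop (S w) (beta v w) h (Y v w).
Let sG0 := fun v w => D w * genop (S w) (beta v w) h (Y a w).
Let S_norm w : `|S w| <= C. Proof. exact: norm_mx_le. Qed.
Let b_norm v w : `|beta v w| <= M.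
Proof. by apply: norm_mx_le => // i j; rewrite ord1. Qed.

Let R4 := K * (C1 * (M + C ^+ 2) * (M + m%:R * C * (1 + 32 * m%:R))).

Let msG : measurable_fun setT (fun z : measurableTypeR R * Omega => sG z.1 z.2).
Proof.
by apply: measurable_funM; [exact: (measurableT_comp (f := D))|exact: genop_measj].
Qed.

Let sG_b : exists B, forall v w, `|sG v w| <= B.
Proof.
have [B B0 HB] := genop_bound m th C0 M0; exists (K * B) => v w.
by rewrite normrM ler_pM//; exact: HB.
Qed.

Let iE (B : R) (f : Omega -> R) : measurable_fun setT f -> (forall w, `|f w| <= B) -> integ Q f.
Proof. exact: prob_integ_b. Qed.

Let if1b v i : integ Q (fun w => f1 i w * beta v w 0 i).
Proof.
apply: (@iE (K * Kh * M)) => [|w]; last by rewrite normrM ler_pM.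
apply: measurable_funM; first exact: (adapted_meas hF a0).
exact: (meas_sec2 (f := fun u w => beta u w 0 i) (beta_entry i) v).
Qed.

Let sG0E v w : sG0 v w = 2^-1 * \sum_i \sum_j f2 i j w * (S w *m (S w)^T) i j + \sum_i f1 i w * beta v w 0 i.
Proof.
rewrite /sG0 /genop mulrDr; congr (_ + _).
  rewrite mulrCA mulr_sumr; congr (_ * _); apply: eq_bigr => i _; rewrite mulr_sumr.
  by apply: eq_bigr => j _; rewrite /f2; ring.
by rewrite mulr_sumr; apply: eq_bigr => i _; rewrite /f1; ring.
Qed.

Let sG0_int v : integ Q (sG0 v) /\
  \int[Q]_w sG0 v w = g0 + \sum_i \int[Q]_w (f1 i w * beta v w 0 i).
Proof.
have i2 : integ Q (fun w => \sum_i \sum_j f2 i j w * (S w *m (S w)^T) i j).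
  by apply: integ_sum => i _; exact: integ_sum.
have i1 : integ Q (fun w => \sum_i f1 i w * beta v w 0 i) by exact: integ_sum.
split; first by apply: (eq_integ (sG0E v)); apply: integD => //; exact: integZ.
rewrite (Rint_eq _ (sG0E v)) RintD//; last exact: integZ.
rewrite RintZ// Rint_sum; last by move=> i _; exact: integ_sum.
rewrite Rint_sum// /g0; congr (_ * _ + _).
by apply: eq_bigr => i _; rewrite Rint_sum.
Qed.

Let sG_diff v : a <= v -> v <= c ->
  `|\int[Q]_w sG v w - \int[Q]_w sG0 v w| <= R4 * q.
Proof.
move=> av vc.
have [BG HG] := sG_b.
have isG : integ Q (sG v) by apply: (iE _ (HG v)); exact: (meas_sec2 msG).
have [isG0 _] := sG0_int v.
have vq : Num.sqrt (v - a) <= q by rewrite /q ler_sqrt ?subr_ge0 ?(ltW ac)// lerD2r.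
have [iN HN] := dW_norm1 q0 a0 av vq.
rewrite -RintB//.
have CC : 0 <= C1 * (M + C ^+ 2) by rewrite mulr_ge0// addr_ge0// exprn_ge0.
have ib : integ Q (fun w => K * (C1 * (M + C ^+ 2) * (M * tau + m%:R * C * `|dW a v w|))).
  by apply: integZ; apply: integZ; apply: integD; [exact: integ_cst|exact: integZ].
apply: (le_trans (Rint_norm_le (integB isG isG0) ib _)).
  move=> w; rewrite -mulrBr normrM ler_pM//; apply: (le_trans (hC1 _ _ _ _ _ _)).
  rewrite !subrr !normr0 expr0n/= mul0r !add0r -mulrA ler_wpM2l//.
  apply: ler_pM; [by rewrite addr_ge0 ?exprn_ge0|by rewrite le_min ler01 normr_ge0| |].
    by rewrite lerD// lerXn2r// nnegrE.
  rewrite ge_min; apply/orP; right; rewrite (hY w av vc) addrC addKr.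
  by rewrite (le_trans (ler_normD _ _))// lerD// ?drift_part_norm// noise_part_norm.
rewrite RintZ; last by apply: integZ; apply: integD; [exact: integ_cst|exact: integZ].
rewrite RintZ; last by apply: integD; [exact: integ_cst|exact: integZ].
rewrite RintD; [|exact: integ_cst|exact: integZ].
rewrite Rint_cst RintZ// /R4 -(mulrA K) -(mulrA (C1 * _)).
apply: ler_wpM2l => //; apply: ler_wpM2l => //; rewrite mulrDl lerD//.
  by rewrite ler_wpM2l// -qq expr2 ler_piMl// ltW.
by rewrite -!mulrA !ler_wpM2l.
Qed.

Lemma one_step_bound :
  `|\int[Q]_w (D w * h (Y c w)) - \int[Q]_w (D w * h (Y a w))
    - \int[lebitv a c]_v \int[Q]_w (D w * genop (S w) (beta v w) h (Y v w))|
  <= (R3 + R4) * (tau * q).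
Proof.
have [BG HG] := sG_b.
have [isGv _] := @ts_swap_b R _ _ Q a c sG _ msG HG.
have iS1 : integ (lebitv a c) (fun v => \sum_i \int[Q]_w (f1 i w * beta v w 0 i)).
  by apply: integ_sum => i _; exact: (ig1 i).1.
have iS : integ (lebitv a c) (fun v => g0 + \sum_i \int[Q]_w (f1 i w * beta v w 0 i)).
  apply: integD => //; exact: (integ_b (lebitv_lt a c) (measurable_cst g0) (k := `|g0|)).
have E0 : \sum_i \int[lebitv a c]_v \int[Q]_w (f1 i w * beta v w 0 i) + tau * g0 =
    \int[lebitv a c]_v (g0 + \sum_i \int[Q]_w (f1 i w * beta v w 0 i)).
  rewrite RintD//; last exact: (integ_b (lebitv_lt a c) (measurable_cst g0) (k := `|g0|)).
  rewrite lebitv_cst ?(ltW ac)// Rint_sum; last by move=> i _; exact: (ig1 i).1.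
  by rewrite addrC mulrC.
have := increment_expansion; rewrite E0 => H.
set X := \int[Q]_w (D w * h (Y c w)) - \int[Q]_w (D w * h (Y a w)) in H *.
have -> : X - \int[lebitv a c]_v \int[Q]_w (D w * genop (S w) (beta v w) h (Y v w)) =
  (X - \int[lebitv a c]_v (g0 + \sum_i \int[Q]_w (f1 i w * beta v w 0 i))) -
  (\int[lebitv a c]_v \int[Q]_w sG v w - \int[lebitv a c]_v (g0 + \sum_i \int[Q]_w (f1 i w * beta v w 0 i))).
  by rewrite /sG; ring.
apply: (le_trans (ler_normB _ _)); rewrite mulrDl lerD//.
rewrite -RintB// (mulrCA R4 tau q) (mulrC tau).
apply: (@lebitv_norm_le _ a c _ (R4 * q)); first exact: ltW.
  exact: (integ_meas (integB isGv iS)).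
by move=> v av vc; rewrite -(sG0_int v).2; exact: sG_diff.
Qed.

End Step.

(** Ito formula in expectation over a short step on which the integrand S is
constant. The terms of first order in the noise vanish by [inc_mean], those of
second order give the diffusion part by [inc_cov], and the cubic remainder is
of order (c - a)^(3/2) by the third moments. The drift enters through its
time integral against F_a-measurable factors, and its products with the noise
go to the error. *)
Lemma one_step (h : 'rV[R]_d -> R) C M K : test_function h -> 0 <= C -> 0 <= M -> 0 <= K ->
  exists2 B, 0 <= B & forall (a c : R) (S : Omega -> 'M[R]_(d, m)) (D : Omega -> R)
    (beta : R -> Omega -> 'rV[R]_d) (Y : R -> Omega -> 'rV[R]_d), 0 <= a -> a < c -> c - a <= 1 ->
  measurable_fun setT (Y a : Om a -> 'rV[R]_d) ->
  measurable_fun setT (S : Om a -> 'M[R]_(d, m)) -> (forall w i k, `|S w i k| <= C) ->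
  measurable_fun setT (D : Om a -> R) -> (forall w, `|D w| <= K) ->
  measurable_fun setT (fun z : measurableTypeR R * Omega => beta z.1 z.2) ->
  (forall v w i, `|beta v w 0 i| <= M) ->
  measurable_fun setT (fun z : measurableTypeR R * Omega => Y z.1 z.2) ->
  (forall v w, a <= v -> v <= c -> Y v w = Y a w +
     ((\row_i \int[lebitv a v]_u beta u w 0 i) + (W w v - W w a) *m (S w)^T)) ->
  `|\int[Q]_w (D w * h (Y c w)) - \int[Q]_w (D w * h (Y a w))
    - \int[lebitv a c]_v \int[Q]_w (D w * genop (S w) (beta v w) h (Y v w))|
  <= B * ((c - a) * Num.sqrt (c - a)).
Proof.
move=> th C0 M0 K0.
have [K1 K10 [H1 H2 _ _]] := test_unif th; have [K2 K20 H3] := test_bounded th.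
have [K3 K30 H4] := taylor_split th; have [C1 C10 H5] := genop_pert m th.
eexists; last first.
  move=> a c S D beta Y a0 ac ca1 mYa mS SC mD DK mb bM mY hY.
  apply: (@one_step_bound a c C M K a0 ac ca1 C0 M0 K0 S D beta Y mYa mS SC mD DK mb bM mY hY
    h (K1 + K2) K3 C1 th) => //.
  split=> [i x|i j x|x].
    + by rewrite (le_trans (H1 i x))// lerDl.
    + by rewrite (le_trans (H2 i j x))// lerDl.
    + by rewrite (le_trans (H3 x))// lerDr.
by cbv zeta; rewrite !(addr_ge0, mulr_ge0, exprn_ge0).
Qed.

End OneStep.

(** * The Ito formula for simple integrands *)

(** Subdividing into N steps bounds the total increment by a multiple of
N^(-1/2); the square avoids limits, since x N <= b for all large N forces
x = 0. *)
Lemma holder_const (R : realType) (f : R -> R) (r T B : R) : r <= T -> 0 <= B ->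
  (forall v v', r <= v -> v < v' -> v' <= T -> v' - v <= 1 ->
    `|f v' - f v| <= B * ((v' - v) * Num.sqrt (v' - v))) ->
  f T = f r.
Proof.
rewrite le_eqVlt => /orP[/eqP->//|rT] B0 H.
set L := T - r; have L0 : 0 < L by rewrite subr_gt0.
have key N : L <= N.+1%:R -> `|f T - f r| ^+ 2 * N.+1%:R <= B ^+ 2 * L ^+ 3.
  move=> LN; have N0 : 0 < N.+1%:R :> R by [].
  set e := L / N.+1%:R.
  have e0 : 0 < e by rewrite divr_gt0.
  have e1 : e <= 1 by rewrite ler_pdivrMr// mul1r.
  pose t (k : nat) := r + k%:R * e.
  have tN : t N.+1 = T by rewrite /t /e mulrC divfK ?gt_eqF// /L addrC subrK.
  have t0 : t 0%N = r by rewrite /t mul0r addr0.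
  have dt k : t k.+1 - t k = e by rewrite /t -natr1; ring.
  have rt k : r <= t k by rewrite /t lerDl mulr_ge0// ltW.
  have tT k : (k <= N)%N -> t k.+1 <= T.
    move=> kN; rewrite -tN /t lerD2l; apply: ler_wpM2r; first exact: ltW.
    by rewrite ler_nat.
  have -> : f T - f r = \sum_(k < N.+1) (f (t k.+1) - f (t k)).
    by rewrite -(big_mkord xpredT (fun k => f (t k.+1) - f (t k))) telescope_sumr// tN t0.
  have S : `|\sum_(k < N.+1) (f (t k.+1) - f (t k))| <= B * (L * Num.sqrt e).
    apply: (le_trans (ler_norm_sum _ _ _)).
    have -> : B * (L * Num.sqrt e) = \sum_(k < N.+1) (B * (e * Num.sqrt e)).
      rewrite sumr_const card_ord -mulr_natl.
      have -> : L = N.+1%:R * e by rewrite /e mulrC divfK ?gt_eqF.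
      by ring.
    apply: ler_sum => k _; rewrite -{1 2}(dt k).
    apply: H => //; first by rewrite -subr_gt0 dt.
      by apply: tT; rewrite -ltnS.
    by rewrite dt.
  apply: (@le_trans _ _ ((B * (L * Num.sqrt e)) ^+ 2 * N.+1%:R)).
    rewrite ler_wpM2r// lerXn2r// nnegrE//.
    by rewrite !mulr_ge0// ltW.
  rewrite !exprMn sqr_sqrtr; last exact: ltW.
  have eN : e * N.+1%:R = L by rewrite /e divfK ?gt_eqF.
  have -> : B ^+ 2 * (L ^+ 2 * e) * N.+1%:R = B ^+ 2 * L ^+ 2 * (e * N.+1%:R) by ring.
  by rewrite eN -mulrA -exprSr.
apply/eqP; rewrite -subr_eq0 -normr_eq0; apply: contraT => x0.
have x2 : 0 < `|f T - f r| ^+ 2 by rewrite exprn_gt0// lt_def x0 normr_ge0.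
set b := B ^+ 2 * L ^+ 3 in key; set x := `|_| ^+ 2 in key x2.
have [N HN] : exists N : nat, Num.max L (b / x + 1) <= N.+1%:R.
  exists (Num.bound (Num.max L (b / x + 1))).
  rewrite (le_trans (ltW (archi_boundP _)))// ?ler_nat//.
  by rewrite le_max ltW.
move: HN; rewrite ge_max => /andP[/key h1 h2].
have : x * (b / x + 1) <= b by apply: le_trans h1; rewrite ler_pM2l.
rewrite mulrDr mulr1 mulrC divfK ?gt_eqF//.
by rewrite gerDl leNgt x2.
Qed.

Lemma lebitv_eq_oc (R : realType) (a c : R) (f g : R -> R) :
  integ (lebitv a c) f -> integ (lebitv a c) g ->
  (forall v, a < v -> v <= c -> f v = g v) ->
  \int[lebitv a c]_v f v = \int[lebitv a c]_v g v.
Proof.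
move=> jf jg H; have mf := integ_meas jf; have mg := integ_meas jg.
have sub : `]a, c]%classic `<=` `[a, c]%classic by apply: subset_itv; rewrite bnd_simp.
rewrite !lebitv_Rint//.
rewrite -(@Rintegral_itv_obnd_cbnd _ a (BRight c)); last first.
  by apply: integrableS (lebitv_integrable jf).
rewrite -(@Rintegral_itv_obnd_cbnd _ a (BRight c)); last first.
  by apply: integrableS (lebitv_integrable jg).
apply: eq_Rintegral => v.
by rewrite inE/= in_itv/= => /andP[]; exact: H.
Qed.

Section SimpleIto.
Context (R : realType) (dO : measure_display) (Omega : measurableType dO).
Variables (Q : probability Omega R) (m d : nat) (F : R -> set (set Omega)).
Variable (W : Omega -> cpath R m 0).
Hypotheses (hF : filtration F) (hW : brownian_motion Q F W).
Notation Om a := (g_sigma_algebraType (F a)).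

Variables (n : nat) (tau : nat -> R) (xi : nat -> Omega -> 'M[R]_(d, m)) (C : R).
Variables (r T M K : R) (D : Omega -> R) (beta Y : R -> Omega -> 'rV[R]_d).
Hypotheses (C0 : 0 <= C) (M0 : 0 <= M) (K0 : 0 <= K).
Hypotheses (tau0 : 0 <= tau 0%N) (tau_mono : forall k, (k < n)%N -> tau k <= tau k.+1).
Hypotheses (t0r : tau 0%N <= r) (rT : r <= T) (tn : tau n = T).
Hypothesis mxi : forall k, (k < n)%N -> measurable_fun setT (xi k : Om (tau k) -> 'M[R]_(d, m)).
Hypothesis xiC : forall k w i j, (k < n)%N -> `|xi k w i j| <= C.
Hypotheses (mD : measurable_fun setT (D : Om r -> R)) (DK : forall w, `|D w| <= K)
  (mb : measurable_fun setT (fun z : measurableTypeR R * Omega => beta z.1 z.2))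
  (bM : forall v w i, `|beta v w 0 i| <= M)
  (mY : measurable_fun setT (fun z : measurableTypeR R * Omega => Y z.1 z.2)).
Hypothesis aY : forall v, r <= v -> v <= T -> measurable_fun setT (Y v : Om v -> 'rV[R]_d).
Hypothesis incY : forall k v v' w, (k < n)%N -> r <= v -> tau k <= v -> v <= v' -> v' <= tau k.+1 ->
  Y v' w = Y v w + ((\row_i \int[lebitv v v']_u beta u w 0 i) + (W w v' - W w v) *m (xi k w)^T).
Variables (h : 'rV[R]_d -> R).
Hypothesis th : test_function h.

Let H := simple_value n tau xi.

Lemma tau_le i j : (i <= j)%N -> (j <= n)%N -> tau i <= tau j.
Proof.
elim: j => [|j IH]; first by rewrite leqn0 => /eqP->.
rewrite leq_eqVlt => /orP[/eqP->//|ij] jn.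
by apply: (le_trans (IH ij (ltnW jn))); exact: tau_mono.
Qed.

Let tauk0 k : (k <= n)%N -> 0 <= tau k.
Proof. by move=> kn; rewrite (le_trans tau0)// tau_le. Qed.

Lemma simple_value_in k v w : (k < n)%N -> tau k < v -> v <= tau k.+1 -> H v w = xi k w.
Proof.
move=> kn kv vk; rewrite /H /simple_value (bigD1 (Ordinal kn))//= kv vk/= big1 ?addr0// => j jk.
have [jltk|kltj|jk'] := ltngtP j k.
- have : tau j.+1 <= tau k by apply: tau_le => //; exact: ltnW.
  by case: ifP => // /andP[_ vj] h1; move: kv; rewrite ltNge (le_trans vj).
- have : tau k.+1 <= tau j by apply: tau_le => //; exact: ltnW.
  by case: ifP => // /andP[jv _] h1; move: vk; rewrite leNgt (le_lt_trans h1).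
- by move: jk; rewrite -val_eqE /= jk' eqxx.
Qed.

Lemma simple_valueE v w : H v w = \sum_(k < n) blk (tau k) (tau k.+1) v *: xi k w.
Proof.
rewrite /H /simple_value; apply: eq_bigr => k _; rewrite /blk.
by case: ifP; rewrite ?scale1r ?scale0r.
Qed.

Let mxi' k : (k < n)%N -> measurable_fun setT (xi k).
Proof. by move=> kn; apply: (adapted_meas hF (tauk0 (ltnW kn))); exact: mxi. Qed.

Lemma simple_value_meas : measurable_fun setT (fun z : measurableTypeR R * Omega => H z.1 z.2).
Proof.
apply: measurable_mx => i j.
rewrite (_ : (fun _ => _) = (fun z : measurableTypeR R * Omega =>
   \sum_(k < n) blk (tau k) (tau k.+1) z.1 * xi k z.2 i j)); last first.
  by apply/funext => z; rewrite simple_valueE summxE; apply: eq_bigr => k _; rewrite mxE.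
apply: measurable_fun_sumr => k _; apply: measurable_funM.
  by apply: (measurableT_comp (f := blk (tau k) (tau k.+1))) => //; exact: blk_meas.
by apply: (measurableT_comp (f := fun w => xi k w i j)) => //; apply: measurable_entry; exact: mxi'.
Qed.

Lemma simple_value_bound v w i j : `|H v w i j| <= n%:R * C.
Proof.
rewrite simple_valueE summxE; apply: (le_trans (ler_norm_sum _ _ _)).
have -> : n%:R * C = \sum_(k < n) C by rewrite sumr_const card_ord mulr_natl.
apply: ler_sum => k _; rewrite mxE normrM /blk.
by case: ifP => _; rewrite ?normr1 ?mul1r ?normr0 ?mul0r ?xiC.
Qed.

Let r0 : 0 <= r. Proof. by rewrite (le_trans tau0). Qed.
Let psi v := \int[Q]_w (D w * genop (H v w) (beta v w) h (Y v w)).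
Let mD' : measurable_fun setT D. Proof. exact: (adapted_meas hF r0 mD). Qed.

Let nC0 : 0 <= n%:R * C. Proof. exact: mulr_ge0. Qed.

Let psi_integ a c : integ (lebitv a c) psi.
Proof.
have [B B0 HB] := genop_bound m th nC0 M0.
have mj : measurable_fun setT (fun z : measurableTypeR R * Omega =>
    D z.2 * genop (H z.1 z.2) (beta z.1 z.2) h (Y z.1 z.2)).
  apply: measurable_funM; first exact: (measurableT_comp (f := D)).
  by apply: genop_meas => //; exact: simple_value_meas.
have bj (v : R) w : `|D w * genop (H v w) (beta v w) h (Y v w)| <= K * B.
  by rewrite normrM ler_pM//; apply: HB => // i k; exact: simple_value_bound.
by have [] := @ts_swap_b R _ _ Q a c (fun v w => D w * genop (H v w) (beta v w) h (Y v w)) _ mj bj.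
Qed.

Let psik_integ a c k : (k < n)%N ->
  integ (lebitv a c) (fun v => \int[Q]_w (D w * genop (xi k w) (beta v w) h (Y v w))).
Proof.
move=> kn; have [B B0 HB] := genop_bound m th C0 M0.
have mj : measurable_fun setT (fun z : measurableTypeR R * Omega =>
    D z.2 * genop (xi k z.2) (beta z.1 z.2) h (Y z.1 z.2)).
  apply: measurable_funM; first exact: (measurableT_comp (f := D)).
  apply: genop_meas => //.
  by apply: (measurableT_comp (f := xi k)) => //; exact: mxi'.
have bj (v : R) w : `|D w * genop (xi k w) (beta v w) h (Y v w)| <= K * B.
  by rewrite normrM ler_pM//; apply: HB => // i j; exact: xiC.
by have [] := @ts_swap_b R _ _ Q a c (fun v w => D w * genop (xi k w) (beta v w) h (Y v w)) _ mj bj.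
Qed.

Let phi v := \int[Q]_w (D w * h (Y v w)) - \int[lebitv r v]_u psi u.

Let phi_step k : (k < n)%N -> phi (Num.max r (tau k.+1)) = phi (Num.max r (tau k)).
Proof.
move=> kn; have tk := tau_mono kn.
have tk0 := tauk0 (ltnW kn).
set a := Num.max r (tau k); have ra : r <= a by rewrite le_max lexx.
have ta : tau k <= a by rewrite le_max lexx orbT.
have tT : tau k.+1 <= T by rewrite -tn tau_le.
have [B B0 HB] := one_step hF hW th C0 M0 K0.
have [ct|tr] := leP (tau k.+1) r.
  by rewrite /a !max_l// (le_trans tk).
have at1 : a <= tau k.+1 by rewrite ge_max (ltW tr).
apply: (@holder_const _ _ _ _ B) => // v v' av vv vt v1.
have rv : r <= v by rewrite (le_trans ra).
have tv : tau k <= v by rewrite (le_trans ta).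
have v0 := le_trans r0 rv.
have vT : v <= T by rewrite (le_trans (ltW vv))// (le_trans vt).
have -> : phi v' - phi v = \int[Q]_w (D w * h (Y v' w)) - \int[Q]_w (D w * h (Y v w)) -
    \int[lebitv v v']_u \int[Q]_w (D w * genop (xi k w) (beta u w) h (Y u w)).
  rewrite /phi (lebitv_split rv (ltW vv))//.
  have <- : \int[lebitv v v']_u psi u =
      \int[lebitv v v']_u \int[Q]_w (D w * genop (xi k w) (beta u w) h (Y u w)).
    apply: lebitv_eq_oc; [exact: psi_integ|exact: psik_integ|].
    move=> u vu uv'; apply: Rint_eq => w.
    by rewrite (simple_value_in w kn (le_lt_trans tv vu))// (le_trans uv').
  set I1 := \int[lebitv v v']_u _; set I2 := \int[lebitv r v]_u _; set I3 := \int[Q]_w _.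
  by rewrite opprD opprB !addrA; set I4 := \int[Q]_w _; lra.
apply: (HB v v' (xi k) D beta Y v0 vv v1) => //.
- exact: aY.
- by apply: (adapted_mono hF tk0 tv); exact: mxi.
- by move=> w i j; exact: xiC.
- exact: (adapted_mono hF r0 rv).
- move=> u w vu uv'; apply: (@incY k v u w) => //.
  by rewrite (le_trans uv').
Qed.

(** The defect of the formula, as a function of the upper time, has increments
of order 3/2 on each interval of the partition by [one_step], so it is
constant by [holder_const]. *)
Lemma simple_ito :
  \int[Q]_w (D w * h (Y T w)) - \int[Q]_w (D w * h (Y r w)) =
  \int[lebitv r T]_v \int[Q]_w (D w * genop (H v w) (beta v w) h (Y v w)).
Proof.
have E k : (k <= n)%N -> phi (Num.max r (tau k)) = phi r.
  elim: k => [_|k IH kn]; first by rewrite max_l.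
  by rewrite phi_step// IH// ltnW.
have := E n (leqnn n); rewrite tn max_r// /phi.
rewrite (@lebitv_empty _ r r psi)//; last exact: (integ_meas (psi_integ 0 0)).
by rewrite subr0 => /eqP; rewrite subr_eq addrC => /eqP ->; rewrite addrK.
Qed.

End SimpleIto.

(** * Passage to the limit in the Ito formula *)

Section Tail.
Context d (T : measurableType d) (R : realType) (P : {measure set T -> \bar R}).

(** Uniform integrability of a single function, from dominated convergence. *)
Lemma integ_tail (Z : T -> R) (e : R) : 0 < e -> (forall x, 0 <= Z x) -> integ P Z ->
  exists N : nat, integ P (fun x => if N%:R < Z x then Z x else 0) /\
    \int[P]_x (if N%:R < Z x then Z x else 0) <= e.
Proof.
move=> e0 Z0 iZ; have mZ := integ_meas iZ.
pose f (N : nat) x := if N%:R < Z x then Z x else 0.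
have mf N : measurable_fun setT (f N).
  apply: measurable_fun_ifT => //.
  exact: measurable_fun_ltr.
have fi N : integ P (f N).
  apply: (integ_le (mf N) iZ) => x; rewrite /f; case: ifP => _; rewrite ?normr0//.
  by rewrite ger0_norm.
have H : (fun N => \int[P]_x (f N x)%:E)%E @ \oo --> 0%E.
  have [] // := @dominated_convergence _ _ _ P setT measurableT
    (fun N x => (f N x)%:E) (cst 0%E) (fun x => (Z x)%:E).
  - by move=> n; exact/measurable_EFinP.
  - apply: aeW => x _; apply: cvg_near_cst; near=> n.
    rewrite /f ltNge; suff -> : Z x <= n%:R by [].
    by near: n; exact: nbhs_infty_ger.
  - apply: aeW => x n _; rewrite lee_fin /f; case: ifP => _; rewrite ?normr0//.
    by rewrite ger0_norm.
  - by rewrite integral0.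
have : \forall N \near \oo, (\int[P]_x (f N x)%:E < e%:E)%E.
  apply: (H [set y | (y < e%:E)%E]).
  by apply: open_nbhs_nbhs; split; [exact: open_ereal_lt_ereal|rewrite /= lte_fin].
case=> N _ /(_ N (leqnn N)) HN; exists N; split; first exact: fi.
by rewrite -lee_fin EFin_Rint; [exact: ltW|exact: fi].
Unshelve. all: by end_near. Qed.
End Tail.

Section Slice.
Context (R : realType) (dO : measure_display) (Omega : measurableType dO).
Variables (Q : probability Omega R).

Lemma ts_slice_bound a c (G : R -> Omega -> R) eta : a <= c ->
  measurable_fun setT (fun z : measurableTypeR R * Omega => G z.1 z.2) ->
  (forall v w, 0 <= G v w) ->
  (forall v, a <= v -> v <= c -> integ Q (G v) /\ \int[Q]_w G v w <= eta) ->
  integ (lebitv a c \x Q)%E (fun z => G z.1 z.2) /\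
  \int[(lebitv a c \x Q)%E]_z G z.1 z.2 <= eta * (c - a).
Proof.
move=> ac mG G0 H.
have mGe : measurable_fun setT (fun z : measurableTypeR R * Omega => (G z.1 z.2)%:E).
  exact/measurable_EFinP.
have mF := @measurable_fun_fubini_tonelli_F _ _ _ _ R Q _ mGe (fun z => G0 z.1 z.2).
have hle : (\int[(lebitv a c \x Q)%E]_z (G z.1 z.2)%:E <= (eta * (c - a))%:E)%E.
  rewrite fubini_tonelli1//.
  rewrite lebitv_integral//.
  apply: (@le_trans _ _ (\int[@lebesgue_measure R]_(v in `[a, c]) eta%:E)%E).
    apply: ge0_le_integral => //.
    - by move=> v _; apply: integral_ge0 => w _; rewrite lee_fin.
    - exact: measurable_funTS.
    - move=> v /=; rewrite in_itv/= => /andP[av vc]; have [h1 h2] := H v av vc.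
      by rewrite /fubini_F -EFin_Rint// lee_fin.
  rewrite integral_cst//= lebesgue_measure_itv/= lte_fin.
  case: ltP => h; first by rewrite -EFinB -EFinM.
  have -> : c = a by apply/le_anti; rewrite h ac.
  by rewrite subrr mulr0 mule0.
  by move=> z; rewrite lee_fin.
have iG : integ (lebitv a c \x Q)%E (fun z => G z.1 z.2).
  apply: (integ_ge0P mG) => [z|]; first exact: G0.
  exact: (le_lt_trans hle (ltry _)).
by split=> //; rewrite -lee_fin EFin_Rint.
Qed.

End Slice.

Section Limit.
Context (R : realType) (dO : measure_display) (Omega : measurableType dO).
Variables (Q : probability Omega R) (m d : nat) (r T K : R).
Variables (D : Omega -> R) (sX : R -> Omega -> 'M[R]_(d, m)) (bX X : R -> Omega -> 'rV[R]_d).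
Hypotheses (rT : r <= T) (K0 : 0 <= K) (mD : measurable_fun setT D) (DK : forall w, `|D w| <= K).
Notation jm f := (measurable_fun setT (fun z : measurableTypeR R * Omega => f z.1 z.2)).
Notation PP := (lebitv r T \x Q)%E.
Hypotheses (msX : jm sX) (mbX : jm bX) (mX : jm X).
Hypothesis iZ : integ PP (fun z => `|bX z.1 z.2| + `|sX z.1 z.2| ^+ 2).
Variable (h : 'rV[R]_d -> R).
Hypothesis th : test_function h.

Hypothesis approx : forall eta : R, 0 < eta -> exists H beta Y,
  [/\ jm H, jm beta, jm Y,
    integ PP (fun z => D z.2 * genop (H z.1 z.2) (beta z.1 z.2) h (Y z.1 z.2)) /\
    \int[Q]_w (D w * h (Y T w)) - \int[Q]_w (D w * h (Y r w)) =
    \int[PP]_z (D z.2 * genop (H z.1 z.2) (beta z.1 z.2) h (Y z.1 z.2)) &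
   [/\ integ PP (fun z => `|H z.1 z.2 - sX z.1 z.2| ^+ 2) /\
      \int[PP]_z (`|H z.1 z.2 - sX z.1 z.2| ^+ 2) <= eta,
    integ PP (fun z => `|beta z.1 z.2 - bX z.1 z.2|) /\
      \int[PP]_z `|beta z.1 z.2 - bX z.1 z.2| <= eta &
    forall v, r <= v -> v <= T -> integ Q (fun w => `|Y v w - X v w|) /\
      \int[Q]_w `|Y v w - X v w| <= eta]].

Lemma mx_norm_comp d' (U : measurableType d') k n (f : U -> 'M[R]_(k, n)) :
  measurable_fun setT f -> measurable_fun setT (fun x => `|f x|).
Proof. exact: (measurableT_comp (@mx_norm_meas R k n)). Qed.

Lemma mx_sub_meas d' (U : measurableType d') k n (f g : U -> 'M[R]_(k, n)) :
  measurable_fun setT f -> measurable_fun setT g -> measurable_fun setT (fun x => f x - g x).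
Proof.
move=> mf mg; apply: measurable_mx => i j.
rewrite (_ : (fun _ => _) = (fun x => f x i j - g x i j)).
  by apply: measurable_funB; exact: measurable_entry.
by apply/funext => x; rewrite !mxE.
Qed.

Lemma weighted_genop_meas (S : R -> Omega -> 'M[R]_(d, m)) (B Y : R -> Omega -> 'rV[R]_d) :
  jm S -> jm B -> jm Y ->
  measurable_fun setT (fun z : measurableTypeR R * Omega => D z.2 * genop (S z.1 z.2) (B z.1 z.2) h (Y z.1 z.2)).
Proof.
by move=> mS mB mY; apply: measurable_funM; [exact: (measurableT_comp (f := D))|exact: genop_meas].
Qed.

(** The coefficients converge in L^1 for the drift and in L^2 for the diffusion,
and the processes in L^1 at each time. By [genop_pert] the only delicate term is
the product of Z = |bX| + |sX|^2 with min 1 |Y - X|, which is at most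
N |Y - X| + Z 1_{Z > N}; N is chosen first, the approximation afterwards. *)
Lemma ito_limit :
  integ PP (fun z => D z.2 * genop (sX z.1 z.2) (bX z.1 z.2) h (X z.1 z.2)) /\
  \int[Q]_w (D w * h (X T w)) - \int[Q]_w (D w * h (X r w)) =
    \int[PP]_z (D z.2 * genop (sX z.1 z.2) (bX z.1 z.2) h (X z.1 z.2)).
Proof.
have [C0 C00 HC] := genop_pert m th; have [C1 C10 HL] := genop_le m th.
have iL : integ PP (fun z => D z.2 * genop (sX z.1 z.2) (bX z.1 z.2) h (X z.1 z.2)).
  apply: (@integ_le _ _ R PP _ (fun z => K * (C1 * (`|bX z.1 z.2| + `|sX z.1 z.2| ^+ 2)))).
  - exact: weighted_genop_meas.
  - by apply: integZ; apply: integZ.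
  - by move=> z; rewrite normrM ler_pM// addrC; exact: HL.
split=> //; apply/eqP; rewrite -subr_eq0 -normr_le0; apply/ler_addgt0Pl => e0 e00; rewrite addr0.
have [Kl Kl0 Hl] := test_minlip th; have [Kb Kb0 Hb] := test_bounded th.
set Z := fun z : measurableTypeR R * Omega => `|bX z.1 z.2| + `|sX z.1 z.2| ^+ 2.
have iZ' : integ PP Z := iZ.
have Z0 z : 0 <= Z z by rewrite addr_ge0// exprn_ge0.
pose S2 := \int[PP]_z Z z; have S20 : 0 <= S2 by exact: Rint_ge0.
(* the total error will be at most 2 k1 e (1 + S2) = e0 / 2; N depends on e, and eta is chosen after N *)
pose k1 := K * Kl * 2 + K * C0 + 1.
have k10 : 0 < k1 by rewrite ltr_wpDl// !(addr_ge0, mulr_ge0).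
pose e := e0 / (4 * k1 * (1 + S2)).
have e_gt0 : 0 < e by rewrite divr_gt0// !mulr_gt0// ltr_wpDr.
have [N [iN HN]] := integ_tail e_gt0 Z0 iZ'.
pose k2 := (1 + e^-1) + 1 + N%:R * (T - r) + 1.
have k20 : 0 < k2 by rewrite ltr_wpDl// !addr_ge0 ?mulr_ge0 ?subr_ge0// invr_ge0 ltW.
pose eta := e / k2.
have eta0 : 0 < eta by rewrite divr_gt0.
have [H [beta [Y [mH mbe mY [iLY EY] [[iH HH] [ibe Hbe] HYX]]]]] := approx eta0.
have hd v : r <= v -> v <= T ->
    `|\int[Q]_w (D w * h (X v w)) - \int[Q]_w (D w * h (Y v w))| <= K * Kl * eta.
  move=> rv vT; have [i1 h1] := HYX v rv vT.
  have iD (U : R -> Omega -> 'rV[R]_d) : jm U -> integ Q (fun w => D w * h (U v w)).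
    move=> mU; apply: (@prob_integ_b _ _ _ _ _ (K * Kb)) => [|w]; last by rewrite normrM ler_pM.
    apply: measurable_funM => //; apply: measurableT_comp; first exact: test_measurable.
    exact: (meas_sec2 mU).
  rewrite -RintB; [|exact: iD|exact: iD].
  apply: (@le_trans _ _ (\int[Q]_w (K * Kl * `|Y v w - X v w|))).
    apply: Rint_norm_le; [by apply: integB; exact: iD|exact: integZ|].
    move=> w; rewrite -mulrBr normrM -mulrA ler_pM// distrC; apply: (le_trans (Hl _ _)).
    by rewrite ler_wpM2l// ge_min lexx orbT.
  by rewrite RintZ// ler_wpM2l// mulr_ge0.
have hL : `|\int[PP]_z (D z.2 * genop (H z.1 z.2) (beta z.1 z.2) h (Y z.1 z.2)) -
    \int[PP]_z (D z.2 * genop (sX z.1 z.2) (bX z.1 z.2) h (X z.1 z.2))| <=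
    K * (C0 * ((1 + e^-1) * eta + e * S2 + eta + N%:R * (eta * (T - r)) + e)).
  have mYX : jm (fun v w => `|Y v w - X v w|).
    by apply: mx_norm_comp; exact: mx_sub_meas.
  have [iYX hYX] := @ts_slice_bound _ _ _ Q _ _ (fun v w => `|Y v w - X v w|) _ rT mYX (fun v w => normr_ge0 _) HYX.
  pose B0 z := (1 + e^-1) * `|H z.1 z.2 - sX z.1 z.2| ^+ 2.
  pose B1 z := e * Z z.
  pose B2 (z : measurableTypeR R * Omega) := `|beta z.1 z.2 - bX z.1 z.2|.
  pose B3 z := N%:R * `|Y z.1 z.2 - X z.1 z.2|.
  pose B4 z := if N%:R < Z z then Z z else 0.
  have i0 : integ PP B0 by exact: integZ.
  have i1 : integ PP B1 by exact: integZ.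
  have i3 : integ PP B3 by exact: integZ.
  have i01 := integD i0 i1. have i012 := integD i01 ibe.
  have i0123 := integD i012 i3. have i04 := integD i0123 iN.
  rewrite -RintB//.
  apply: (@le_trans _ _ (\int[PP]_z (K * (C0 * (B0 z + B1 z + B2 z + B3 z + B4 z))))).
    apply: Rint_norm_le; [exact: integB|by apply: integZ; exact: integZ|].
    move=> z; rewrite -mulrBr normrM ler_pM//; apply: (le_trans (HC _ _ _ _ _ _)).
    rewrite ler_wpM2l//.
    rewrite /B0 /B1 /B2 /B3 /B4.
    set x := `|H _ _ - _|; set y := `|sX _ _|; set u := `|Y _ _ - _|; set bb := `|beta _ _ - _|.
    have x0 : 0 <= x by exact: normr_ge0.
    have y0 : 0 <= y by exact: normr_ge0.
    have u0 : 0 <= u by exact: normr_ge0.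
    have xy : x * y <= e^-1 * x ^+ 2 + e * Z z.
      apply: (@le_trans _ _ (e^-1 * x ^+ 2 + e * y ^+ 2)); last first.
        by rewrite lerD2l ler_wpM2l ?(ltW e_gt0)// /Z lerDr.
      have : 0 <= (x - e * y) ^+ 2 + (x ^+ 2 + (e * y) ^+ 2) by rewrite !addr_ge0// sqr_ge0.
      have -> : (x - e * y) ^+ 2 + (x ^+ 2 + (e * y) ^+ 2) =
         2 * e * (e^-1 * x ^+ 2 + e * y ^+ 2 - x * y) by field; rewrite gt_eqF.
      have e2 : 0 < 2 * e by rewrite mulr_gt0.
      by rewrite (pmulr_rge0 _ e2) subr_ge0.
    have zu : Z z * Num.min 1 u <= N%:R * u + (if N%:R < Z z then Z z else 0).
      case: ltP => hN.
        apply: (@le_trans _ _ (Z z)); last by rewrite lerDr mulr_ge0.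
        by rewrite ler_piMr// ge_min lexx.
      rewrite addr0; apply: ler_pM => //; first by rewrite le_min ler01.
      by rewrite ge_min lexx orbT.
    have -> : (1 + e^-1) * x ^+ 2 = x ^+ 2 + e^-1 * x ^+ 2 by ring.
    move: xy zu; rewrite -/(Z z).
    set zm := Z z * _; set zt := if _ then _ else _.
    set ez := e * Z z; set ex := e^-1 * _; set nu := _ * u; lra.
  rewrite RintZ; last exact: integZ.
  rewrite RintZ// RintD// RintD// RintD// RintD// RintZ// RintZ// RintZ//.
  apply: ler_wpM2l => //; apply: ler_wpM2l => //.
  rewrite !lerD// ler_wpM2l//; first by rewrite addr_ge0// invr_ge0 ltW.
have hT := hd T rT (lexx T); have hr := hd r (lexx r) rT.
set a1 := \int[Q]_w (D w * h (X T w)) in hT *.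
set a2 := \int[Q]_w (D w * h (X r w)) in hr *.
set b1 := \int[Q]_w (D w * h (Y T w)) in hT EY.
set b2 := \int[Q]_w (D w * h (Y r w)) in hr EY.
set L1 := \int[PP]_z _ in EY hL.
set L2 := \int[PP]_z _ in hL *.
have -> : a1 - a2 - L2 = (a1 - b1) - (a2 - b2) + (L1 - L2) by rewrite -EY; ring.
apply: (le_trans (ler_normD _ _)).
apply: (@le_trans _ _ ((K * Kl * eta + K * Kl * eta) + K * (C0 * ((1 + e^-1) * eta + e * S2 + eta + N%:R * (eta * (T - r)) + e)))).
  by apply: lerD => //; apply: (le_trans (ler_normB _ _)); exact: lerD.
have ek : eta * k2 = e by rewrite /eta divfK ?gt_eqF.
have etae : eta <= e.
  rewrite /eta ler_pdivrMr// ler_peMr ?(ltW e_gt0)// /k2 lerDr !addr_ge0 ?mulr_ge0 ?subr_ge0//.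
  by rewrite invr_ge0 ltW.
have -> : (1 + e^-1) * eta + e * S2 + eta + N%:R * (eta * (T - r)) + e =
   eta * k2 - eta + e * S2 + e by rewrite /k2; ring.
rewrite ek.
apply: (@le_trans _ _ (2 * k1 * (e * (1 + S2)))); last first.
  have -> : 2 * k1 * (e * (1 + S2)) = e0 / 2.
    rewrite /e; field; rewrite !gt_eqF//; last by rewrite ltr_wpDr.
  by lra.
have p1 : 0 <= K * Kl by rewrite mulr_ge0.
have p2 : 0 <= K * C0 by rewrite mulr_ge0.
have p3 : 0 <= e * S2 by rewrite mulr_ge0// ltW.
have q1 : K * Kl * eta <= K * Kl * (e * (1 + S2)).
  by rewrite ler_wpM2l// (le_trans etae)// mulrDr mulr1 lerDl.
have q2 : K * (C0 * (e - eta + e * S2 + e)) <= K * C0 * (2 * (e * (1 + S2))).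
  rewrite (mulrA K C0); apply: (ler_wpM2l p2).
  move: p3 eta0; set es := e * S2; move=> p3 eta0; rewrite mulrDr mulr1 -/es; move: e_gt0; lra.
have q3 : 0 <= e * (1 + S2) by rewrite mulr_ge0 ?(ltW e_gt0)// addr_ge0.
rewrite /k1; set ES := e * (1 + S2) in q1 q2 q3 *.
have -> : 2 * (K * Kl * 2 + K * C0 + 1) * ES = 4 * (K * Kl * ES) + K * C0 * (2 * ES) + 2 * ES by ring.
have : 0 <= K * Kl * ES by rewrite mulr_ge0.
lra.
Qed.

End Limit.

(** * Simple integrals up to a variable time *)

Section BoundedIntegral.
Context d (T : measurableType d) (R : realType) (P : {measure set T -> \bar R}).

(** An integral of a real function is a junk value unless the function is
integrable, so bounds are carried together with integrability. *)
Definition ibd (f : T -> R) (c : R) : Prop := integ P f /\ \int[P]_x f x <= c.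

Lemma ibd_le (f g : T -> R) c : measurable_fun setT f -> (forall x, 0 <= f x) ->
  (forall x, f x <= g x) -> ibd g c -> ibd f c.
Proof.
move=> mf f0 fg [ig Ig].
have jf : integ P f by apply: (integ_le mf ig) => x; rewrite ger0_norm.
by split=> //; apply: le_trans Ig; exact: Rint_le.
Qed.

Lemma ibdD f g a c : ibd f a -> ibd g c -> ibd (fun x => f x + g x) (a + c).
Proof. by move=> [jf If] [jg Ig]; split; [exact: integD|rewrite RintD// lerD]. Qed.

Lemma ibdZ k f a : 0 <= k -> ibd f a -> ibd (fun x => k * f x) (k * a).
Proof. by move=> k0 [jf If]; split; [exact: integZ|rewrite RintZ// ler_wpM2l]. Qed.

Lemma ibd_weaken f a c : a <= c -> ibd f a -> ibd f c.
Proof. by move=> ac [jf If]; split=> //; exact: le_trans ac. Qed.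

Lemma ibd_ereal (f : T -> R) c : measurable_fun setT f -> (forall x, 0 <= f x) ->
  (\int[P]_x (f x)%:E <= c%:E)%E -> ibd f c.
Proof.
move=> mf f0 H.
have jf : integ P f by apply: (integ_ge0P mf f0); exact: le_lt_trans H (ltry _).
by split=> //; rewrite -lee_fin EFin_Rint.
Qed.

Lemma ibd_ae (f g : T -> R) c : measurable_fun setT f -> (forall x, 0 <= f x) ->
  {ae P, forall x, f x <= g x} -> ibd g c -> ibd f c.
Proof.
move=> mf f0 fg [ig Ig]; have mg := integ_meas ig.
have mng : measurable_fun setT (fun x => `|g x|) by exact: measurableT_comp.
have g0 : (\int[P]_x (`|g x|)%:E = \int[P]_x (g x)%:E)%E.
  apply: ae_eq_integral => //.
  - exact/measurable_EFinP.
  - exact/measurable_EFinP.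
  apply: filterS fg => x fg _; congr EFin.
  by rewrite ger0_norm// (le_trans (f0 x)).
apply: ibd_ereal => //; apply: (@le_trans _ _ (\int[P]_x (`|g x|)%:E)%E).
  apply: ae_ge0_le_integral => //.
  - by move=> x _; rewrite lee_fin.
  - exact/measurable_EFinP.
  - exact/measurable_EFinP.
  apply: filterS fg => x hx _; by rewrite lee_fin (le_trans hx)// ler_norm.
by move: Ig; rewrite -lee_fin EFin_Rint// -g0.
Qed.

End BoundedIntegral.

Section Enorm.
Context (R : realType).

Lemma enorm_ge0 k n (A : 'M[R]_(k, n)) : 0 <= enorm A.
Proof. exact: sqrtr_ge0. Qed.

Lemma norm_le_enorm k n (A : 'M[R]_(k, n)) : `|A| <= enorm A.
Proof.
apply: norm_mx_le => [|i j]; first exact: enorm_ge0.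
rewrite -sqrtr_sqr ler_wsqrtr// (bigD1 i)//= (bigD1 j)//= -addrA lerDl.
by rewrite addr_ge0 ?sumr_ge0// => [j' _|i' _]; rewrite ?sqr_ge0// sumr_ge0// => ? _; rewrite sqr_ge0.
Qed.

Lemma enorm_meas k n d' (U : measurableType d') (f : U -> 'M[R]_(k, n)) :
  measurable_fun setT f -> measurable_fun setT (fun x => enorm (f x)).
Proof.
move=> mf; apply: (measurableT_comp (continuous_measurable_fun (@sqrt_continuous R))).
apply: measurable_fun_sumr => i _; apply: measurable_fun_sumr => j _.
by apply: measurable_funX; exact: measurable_entry.
Qed.

Lemma enorm_sqB k n (A B : 'M[R]_(k, n)) :
  enorm (A - B) ^+ 2 <= 2 * enorm A ^+ 2 + 2 * enorm B ^+ 2.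
Proof.
rewrite !enorm_sq !mulr_sumr -big_split/=; apply: ler_sum => i _.
rewrite !mulr_sumr -big_split/=; apply: ler_sum => j _; rewrite !mxE.
have := sqr_ge0 (A i j + B i j); nra.
Qed.

Lemma enormN k n (A : 'M[R]_(k, n)) : enorm (- A) = enorm A.
Proof. by congr Num.sqrt; apply: eq_bigr => i _; apply: eq_bigr => j _; rewrite mxE sqrrN. Qed.

(** Passes from second moments to first moments without Cauchy-Schwarz. *)
Lemma enorm_young k n (A : 'M[R]_(k, n)) e : 0 < e -> enorm A <= e + e^-1 * enorm A ^+ 2.
Proof.
move=> e0; set x := enorm A.
have -> : e + e^-1 * x ^+ 2 = e^-1 * (e ^+ 2 + x ^+ 2) by field; rewrite gt_eqF.
rewrite -ler_pdivrMl ?invr_gt0// invrK.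
by have := sqr_ge0 (e - x); have := sqr_ge0 e; have := sqr_ge0 x; nra.
Qed.

End Enorm.

Section Approximant.
Context (R : realType) (dO : measure_display) (Omega : measurableType dO).
Variables (Q : probability Omega R) (m d : nat) (F : R -> set (set Omega)).
Variable (W : Omega -> cpath R m 0).
Hypotheses (hF : filtration F) (hW : brownian_motion Q F W).
Notation Om a := (g_sigma_algebraType (F a)).
Notation jm f := (measurable_fun setT (fun z : measurableTypeR R * Omega => f z.1 z.2)).

Section Stoch.
Variables (n : nat) (tau : nat -> R) (xi : nat -> Omega -> 'M[R]_(d, m)) (C s T : R).
Hypotheses (s0 : 0 <= s) (C0 : 0 <= C).
Hypotheses (tau0 : tau 0%N = s) (tn : tau n = T)
  (tau_mono : forall k, (k < n)%N -> tau k <= tau k.+1).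
Hypothesis mxi : forall k, (k < n)%N -> measurable_fun setT (xi k : Om (tau k) -> 'M[R]_(d, m)).
Hypothesis xiC : forall k w i j, (k < n)%N -> `|xi k w i j| <= C.

Let s_tau k : (k <= n)%N -> s <= tau k.
Proof. by move=> kn; rewrite -tau0; apply: (tau_le tau_mono). Qed.

Definition trunc_a (v : R) (k : 'I_n) := Num.min (tau k) v.
Definition trunc_b (v : R) (k : 'I_n) := Num.min (tau k.+1) v.
(** The intervals (tau k, tau k.+1] are cut at v. A block that starts after v has
become empty, and its integrand is set to 0 because it is not known at
time v. *)
Definition trunc_xi (v : R) (k : 'I_n) (w : Omega) : 'M[R]_(d, m) := if tau k < v then xi k w else 0.

Lemma trunc_order v (k : 'I_n) : s <= v ->
  s <= trunc_a v k /\ trunc_a v k <= trunc_b v k /\ trunc_b v k <= v.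
Proof.
move=> sv; rewrite /trunc_a /trunc_b le_min sv s_tau ?(ltnW (ltn_ord k))//.
split=> //; split; last by rewrite ge_min lexx orbT.
by rewrite le_min !ge_min tau_mono ?lexx ?orbT.
Qed.

Lemma trunc_xi_meas v (k : 'I_n) : s <= v ->
  measurable_fun setT (trunc_xi v k : Om (trunc_a v k) -> 'M[R]_(d, m)).
Proof.
move=> sv; rewrite /trunc_xi /trunc_a; case: ltP => h; last exact: measurable_cst.
exact: mxi.
Qed.

Lemma trunc_xi_bound v (k : 'I_n) w i j : `|trunc_xi v k w i j| <= C.
Proof. by rewrite /trunc_xi; case: ifP => _; [exact: xiC|rewrite mxE normr0]. Qed.

Definition stopped_int v w : 'rV[R]_d :=
  \sum_(k < n) (W w (trunc_b v k) - W w (trunc_a v k)) *m (xi k w)^T.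

Lemma stopped_int_blk v w : stopped_int v w = blk_int W (trunc_a v) (trunc_b v) (trunc_xi v) w.
Proof.
rewrite /stopped_int /blk_int; apply: eq_bigr => k _; rewrite /trunc_xi.
case: ltP => // h; rewrite /trunc_a /trunc_b (min_r h) min_r; last first.
  by rewrite (le_trans h)// tau_mono.
by rewrite subrr mul0mx trmx0 mulmx0.
Qed.

Lemma stopped_int_adapted v : s <= v -> measurable_fun setT (stopped_int v : Om v -> 'rV[R]_d).
Proof.
move=> sv; apply: measurable_mx => i j; rewrite ord1.
rewrite (_ : (fun _ => _) = (fun w => \sum_(pk : 'I_n * 'I_m)
   trunc_xi v pk.1 w j pk.2 * increment W (trunc_a v pk.1) (trunc_b v pk.1) pk.2 w)); last first.
  by apply/funext => w; rewrite stopped_int_blk blk_intE.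
apply: measurable_fun_sumr => pk _.
have [h1 [h2 h3]] := trunc_order pk.1 sv; have a0 := le_trans s0 h1.
apply: measurable_funM.
  apply: measurable_entry; apply: (adapted_mono hF a0 (le_trans h2 h3)); exact: trunc_xi_meas.
apply: (adapted_mono hF (le_trans a0 h2) h3).
exact: (inc_adapted hF hW).
Qed.

(** Together with measurability at each time, continuity in v gives joint
measurability. *)
Lemma stopped_int_cont w i : continuous (fun v => stopped_int v w 0 i).
Proof.
rewrite (_ : (fun _ => _) = (fun v => \sum_(pk <- index_enum ('I_n * 'I_m)%type)
   xi pk.1 w i pk.2 * increment W (trunc_a v pk.1) (trunc_b v pk.1) pk.2 w)); last first.
  by apply/funext => v; rewrite -(blk_intE W (trunc_a v) (trunc_b v) (fun k : 'I_n => xi k)).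
elim: (index_enum _) => [|pk l IH] v.
  by under eq_fun do rewrite big_nil; exact: cvg_cst.
under eq_fun do rewrite big_cons; apply: cvgD; last exact: IH.
apply: cvgM; first exact: cvg_cst.
have cW (f : R -> R) : continuous f -> continuous (fun v => W w (f v) 0 pk.2).
  move=> cf u; apply: (@cvg_comp _ _ _ f (fun x => W w x 0 pk.2) _ _ _ (cf u)).
  apply: (@cvg_comp _ _ _ (W w) (fun M => M 0 pk.2) _ _ _ (@cpath_continuous _ _ _ (W w) _)).
  exact: coord_continuous.
rewrite /increment; apply: cvgB; apply: cW => u.
  by apply: (@continuous_min _ _ (fun=> _) (fun u => u)); [exact: cvg_cst|exact: cvg_id].
by apply: (@continuous_min _ _ (fun=> _) (fun u => u)); [exact: cvg_cst|exact: cvg_id].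
Qed.

Lemma stopped_int_inc (k : nat) v v' w : (k < n)%N -> tau k <= v -> v <= v' -> v' <= tau k.+1 ->
  stopped_int v' w = stopped_int v w + (W w v' - W w v) *m (xi k w)^T.
Proof.
move=> kn kv vv vk; apply/eqP; rewrite -subr_eq0 opprD addrA -sumrB/=.
rewrite (bigD1 (Ordinal kn))//= big1 => [|j jk].
  rewrite addr0 /trunc_a /trunc_b/= (min_r vk) (min_r (le_trans vv vk)) (min_l kv).
  rewrite (min_l (le_trans kv vv)) -mulmxBl.
  set x := W w v'; set y := W w v; set z := W w (tau k).
  have -> : x - z - (y - z) = x - y by rewrite opprB addrA subrK.
  by rewrite subrr.
rewrite -mulmxBl /trunc_a /trunc_b.
have [jltk|kltj|jk'] := ltngtP j k.
- have h : tau j.+1 <= tau k by apply: (tau_le tau_mono) => //; exact: ltnW.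
  have h' : tau j <= tau k by rewrite (le_trans _ h)// tau_mono.
  have kv' := le_trans kv vv.
  rewrite (min_l (le_trans h kv)) (min_l (le_trans h' kv)).
  by rewrite (min_l (le_trans h kv')) (min_l (le_trans h' kv')) subrr mul0mx.
- have h : tau k.+1 <= tau j by apply: (tau_le tau_mono) => //; exact: ltnW.
  have h' : tau k.+1 <= tau j.+1 by rewrite (le_trans h)// tau_mono.
  have vk' := le_trans vv vk.
  rewrite (min_r (le_trans vk h)) (min_r (le_trans vk h')).
  by rewrite (min_r (le_trans vk' h)) (min_r (le_trans vk' h')) !subrr mul0mx.
- by move: jk; rewrite -val_eqE /= jk' eqxx.
Qed.

End Stoch.
End Approximant.

(** * Approximation of an Ito process in mean *)

Section TonelliTS.
Context (R : realType) (dO : measure_display) (Omega : measurableType dO).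
Variables (Q : probability Omega R).
Notation jm f := (measurable_fun setT (fun z : measurableTypeR R * Omega => f z.1 z.2)).

(** Links the iterated extended integrals of the definition of a weak solution
with the product measure. *)
Lemma ts_tonelli a c (G : R -> Omega -> R) : jm G -> (forall v w, 0 <= G v w) ->
  (\int[(lebitv a c \x Q)%E]_z (G z.1 z.2)%:E =
   \int[@lebesgue_measure R]_(v in `[a, c]) \int[Q]_w (G v w)%:E)%E.
Proof.
move=> mG G0.
have mGe : measurable_fun setT (fun z : measurableTypeR R * Omega => (G z.1 z.2)%:E).
  exact/measurable_EFinP.
have mF := @measurable_fun_fubini_tonelli_F _ _ _ _ R Q _ mGe (fun z => G0 z.1 z.2).
rewrite fubini_tonelli1//; last by move=> z; rewrite lee_fin.
by rewrite lebitv_integral.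
Qed.

Lemma ts_inner_meas (G : R -> Omega -> R) : jm G -> (forall v w, 0 <= G v w) ->
  measurable_fun setT (fun v : measurableTypeR R => \int[Q]_w (G v w)%:E)%E.
Proof.
move=> mG G0.
have mGe : measurable_fun setT (fun z : measurableTypeR R * Omega => (G z.1 z.2)%:E).
  exact/measurable_EFinP.
exact: (@measurable_fun_fubini_tonelli_F _ _ _ _ R Q _ mGe (fun z => G0 z.1 z.2)).
Qed.

Lemma ts_sub a c a' c' (G : R -> Omega -> R) k : a <= a' -> c' <= c ->
  jm G -> (forall v w, 0 <= G v w) ->
  ibd (lebitv a c \x Q)%E (fun z => G z.1 z.2) k ->
  ibd (lebitv a' c' \x Q)%E (fun z => G z.1 z.2) k.
Proof.
move=> aa cc mG G0 [iG IG]; apply: ibd_ereal => //.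
move: IG; rewrite -lee_fin (EFin_Rint iG).
rewrite (@ts_tonelli a c G mG G0) (@ts_tonelli a' c' G mG G0); apply: le_trans.
apply: ge0_subset_integral => //.
- by apply: measurable_funTS; exact: ts_inner_meas.
- by move=> v _; apply: integral_ge0 => w _; rewrite lee_fin.
- by apply: subset_itv; rewrite bnd_simp.
Qed.

Lemma ts_ibd a c (G : R -> Omega -> R) k : jm G -> (forall v w, 0 <= G v w) ->
  (\int[@lebesgue_measure R]_(v in `[a, c]) \int[Q]_w (G v w)%:E <= k%:E)%E ->
  ibd (lebitv a c \x Q)%E (fun z => G z.1 z.2) k.
Proof. by move=> mG G0 H; apply: (ibd_ereal mG) => [z|]; [exact: G0|rewrite (@ts_tonelli a c G mG G0)]. Qed.

Lemma ts_ae a c (G : R -> Omega -> R) : integ (lebitv a c \x Q)%E (fun z => G z.1 z.2) ->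
  {ae Q, forall w, integ (lebitv a c) (fun v => G v w)}.
Proof.
move=> iG; have := ae_integrable2 iG.
by apply: filterS => w h; exact: h.
Qed.

End TonelliTS.

Section Process.
Context (R : realType) (dO : measure_display) (Omega : measurableType dO).
Variables (Q : probability Omega R) (m d : nat) (F : R -> set (set Omega)).
Variable (W : Omega -> cpath R m 0).
Hypotheses (hF : filtration F) (hW : brownian_motion Q F W).
Notation Om a := (g_sigma_algebraType (F a)).
Notation jm f := (measurable_fun setT (fun z : measurableTypeR R * Omega => f z.1 z.2)).

Lemma blk_fun_joint (J : finType) (a b : J -> R) (xi : J -> Omega -> 'M[R]_(d, m)) :
  (forall p, measurable_fun setT (xi p)) -> jm (blk_fun a b xi).
Proof.
move=> mxi; apply: measurable_mx => i j.
rewrite (_ : (fun _ => _) = (fun z : measurableTypeR R * Omega =>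
   \sum_p blk (a p) (b p) z.1 * xi p z.2 i j)); last first.
  by apply/funext => z; rewrite blk_funE.
apply: measurable_fun_sumr => p _; apply: measurable_funM.
  by apply: (measurableT_comp (f := blk (a p) (b p))) => //; exact: blk_meas.
by apply: (measurableT_comp (f := fun w => xi p w i j)) => //; exact: measurable_entry.
Qed.

Lemma blk_int_meas (J : finType) (a b : J -> R) lo hi (xi : J -> Omega -> 'M[R]_(d, m)) :
  0 <= lo -> (forall p, lo <= a p /\ a p <= b p /\ b p <= hi) ->
  (forall p, measurable_fun setT (xi p : Om (a p) -> 'M[R]_(d, m))) ->
  measurable_fun setT (blk_int W a b xi).
Proof.
move=> lo0 hJ mxi; apply: measurable_mx => i j; rewrite ord1.
under eq_fun do rewrite blk_intE.
apply: measurable_fun_sumr => pk _; have [h1 [h2 h3]] := hJ pk.1.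
have a0 := le_trans lo0 h1.
apply: measurable_funM; last exact: (inc_meas hF hW).
by apply: measurable_entry; exact: (adapted_meas hF a0).
Qed.

Section OneSimple.
Variables (n : nat) (tau : nat -> R) (xi : nat -> Omega -> 'M[R]_(d, m)) (C s T : R).
Hypotheses (s0 : 0 <= s) (C0 : 0 <= C).
Hypotheses (tau0 : tau 0%N = s) (tn : tau n = T)
  (tau_mono : forall k, (k < n)%N -> tau k <= tau k.+1).
Hypothesis mxi : forall k, (k < n)%N -> measurable_fun setT (xi k : Om (tau k) -> 'M[R]_(d, m)).
Hypothesis xiC : forall k w i j, (k < n)%N -> `|xi k w i j| <= C.

Variables (X0 : Omega -> 'rV[R]_d) (beta : R -> Omega -> 'rV[R]_d) (M : R).
Hypotheses (M0 : 0 <= M) (mX0 : measurable_fun setT (X0 : Om s -> 'rV[R]_d)) (mb : jm beta)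
  (bM : forall v w i, `|beta v w 0 i| <= M)
  (pb : forall v, s <= v ->
     measurable_fun setT (fun z : measurableTypeR R * Om v => beta (Num.min v z.1) z.2)).

(** Process with simple integrand and bounded drift, started like the Ito
process that it approximates. *)
Definition euler v w : 'rV[R]_d :=
  X0 w + (\row_i \int[lebitv s v]_u beta u w 0 i) + stopped_int W n tau xi v w.

Let mbi i : measurable_fun setT (fun z : measurableTypeR R * Omega => beta z.1 z.2 0 i).
Proof. exact: measurable_entry. Qed.

Lemma euler_adapted v : s <= v -> measurable_fun setT (euler v : Om v -> 'rV[R]_d).
Proof.
move=> sv; apply: measurable_mx => i j; rewrite ord1.
rewrite (_ : (fun _ => _) = (fun w => X0 w 0 j + (\int[lebitv s v]_u beta (Num.min v u) w 0 j)
   + stopped_int W n tau xi v w 0 j)); last first.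
  apply/funext => w; rewrite !mxE; congr (_ + _ + _).
  have mv := meas_sec1 (f := fun u w => beta u w 0 j) (mbi j) w.
  apply: lebitv_eq => //.
    have mm : measurable_fun setT (fun u : measurableTypeR R => (Num.min v u : measurableTypeR R)).
      by apply: measurable_minr => //; exact: measurable_cst.
    exact: (measurableT_comp mv mm).
  by move=> u _ uv; rewrite min_r.
apply: measurable_funD; last first.
  by apply: measurable_entry; apply: (stopped_int_adapted hF hW s0 tau0 tau_mono mxi).
apply: measurable_funD.
  by apply: measurable_entry; apply: (adapted_mono hF s0 sv).
apply: (@drift_meas _ _ (Om v) _ _ (fun u w => beta (Num.min v u) w 0 j) M) => //.
exact: (measurable_entry 0 j (pb sv)).
Qed.

Lemma euler_joint : jm (fun v => euler (Num.max s v)).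
Proof.
apply: measurable_mx => i j; rewrite ord1.
apply: (@measurable_joint_real _ _ _ (fun v w => euler (Num.max s v) w 0 j)) => [v|w].
  have sv : s <= Num.max s v by rewrite le_max lexx.
  apply: measurable_entry; apply: (adapted_meas hF (le_trans s0 sv)).
  exact: euler_adapted.
have ce : continuous (fun v => euler v w 0 j).
  rewrite (_ : (fun _ => _) = (fun v => X0 w 0 j + (\int[lebitv s v]_u beta u w 0 j)
     + stopped_int W n tau xi v w 0 j)); last by apply/funext => v; rewrite !mxE.
  have mv := meas_sec1 (f := fun u w => beta u w 0 j) (mbi j) w.
  move=> v; apply: cvgD; last exact: stopped_int_cont.
  apply: cvgD; first exact: cvg_cst.
  exact: (@drift_continuous R s (fun u => beta u w 0 j) M M0 mv (fun u => bM u w j) v).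
move=> v; apply: (cvg_comp (Num.max s) (fun v => euler v w 0 j)); last exact: ce.
by apply: (@continuous_max _ _ (fun=> s) (fun u => u)); [exact: cvg_cst|exact: cvg_id].
Qed.

Lemma euler_inc (k : nat) v v' w : (k < n)%N -> s <= v -> tau k <= v -> v <= v' -> v' <= tau k.+1 ->
  euler v' w = euler v w + ((\row_i \int[lebitv v v']_u beta u w 0 i) + (W w v' - W w v) *m (xi k w)^T).
Proof.
move=> kn sv kv vv vk; rewrite /euler (stopped_int_inc W xi tau_mono w kn kv vv vk).
have -> : (\row_i \int[lebitv s v']_u beta u w 0 i) = (\row_i \int[lebitv s v]_u beta u w 0 i) +
   (\row_i \int[lebitv v v']_u beta u w 0 i).
  apply/rowP => i; rewrite !mxE; apply: lebitv_split => //.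
  have mv := meas_sec1 (f := fun u w => beta u w 0 i) (mbi i) w.
  by apply: (@integ_b _ _ _ _ _ M) => //; exact: lebitv_lt.
by rewrite (addrA (X0 w)) addrACA.
Qed.

Section Gap.
Variables (X bX : R -> Omega -> 'rV[R]_d) (sX : R -> Omega -> 'M[R]_(d, m)).
Variables (v : R) (J : Omega -> 'rV[R]_d).
Hypotheses (sv : s <= v) (vT : v <= T) (mX : measurable_fun setT (X v)).
Hypotheses (mbX : jm bX) (msX : jm sX).
Hypothesis (hJ : ito_integral Q F W s v sX J).
Hypothesis XE : {ae Q, forall w, X v w = X0 w
   + \row_i (\int[@lebesgue_measure R]_(u in `[s, v]) bX u w 0 i) + J w}.

Variables (del e a : R).
Hypotheses (del0 : 0 < del) (e0 : 0 < e).
Hypothesis ibb : ibd (lebitv s T \x Q)%E (fun z => `|beta z.1 z.2 - bX z.1 z.2|) a.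
Hypothesis iss : ibd (lebitv s T \x Q)%E
  (fun z => enorm (simple_value n tau xi z.1 z.2 - sX z.1 z.2) ^+ 2) del.

Let v0 : 0 <= v. Proof. exact: le_trans sv. Qed.
Let mJ : measurable_fun setT J. Proof. by case: hJ. Qed.
Let S := stopped_int W n tau xi v.
Let mS : measurable_fun setT S.
Proof. by apply: (adapted_meas hF v0); apply: (stopped_int_adapted hF hW s0 tau0 tau_mono mxi). Qed.

(** In mean square, J is within del of the integral of some other simple integrand
on [s, v], and that integrand is within del of sX; the two simple integrands are
compared by the isometry, with the blocks of both put in one finite family. *)
Lemma stopped_int_gap : ibd Q (fun w => enorm (S w - J w)) (e + e^-1 * (10 * del)).
Proof.
have [_ [n' [tau' [xi' [hs h1 h2]]]]] := hJ.
have small (u : nat -> \bar R) : u @ \oo --> 0%E -> \forall N \near \oo, (u N < del%:E)%E.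
  move=> H; apply: (H [set y | (y < del%:E)%E]).
  by apply: open_nbhs_nbhs; split; [exact: open_ereal_lt_ereal|rewrite /= lte_fin].
have [l [/ltW l1 /ltW l2]] : exists l, (\int[@lebesgue_measure R]_(r in `[s, v]) \int[Q]_w
          (enorm (sX r w - simple_value (n' l) (tau' l) (xi' l) r w) ^+ 2)%R%:E < del%:E)%E /\
   (\int[Q]_w (enorm (J w - simple_integral W (n' l) (tau' l) (xi' l) w) ^+ 2)%:E < del%:E)%E.
  have [N _ HN] := filterI (small _ h1) (small _ h2).
  by exists N; exact: (HN N (leqnn N)).
have [t0 t1 t2 t3 [C' HC']] := hs l.
set nn := n' l in l1 l2 t0 t1 t2 t3 HC'; set tt := tau' l in l1 l2 t0 t1 t2 t3 HC'.
set xx := xi' l in l1 l2 t0 t1 t2 t3 HC'.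
have tt0 k : (k <= nn)%N -> s <= tt k by move=> kn; rewrite -t0; apply: (tau_le t2).
have ttv k : (k <= nn)%N -> tt k <= v by move=> kn; rewrite -t1; apply: (tau_le t2).
have mxx k : (k < nn)%N -> measurable_fun setT (xx k : Om (tt k) -> 'M[R]_(d, m)).
  move=> kn; apply/(measurable_wrtP (filt_sigma hF (le_trans s0 (tt0 _ (ltnW kn))))).
  exact: t3.
have xxC k w i j : (k < nn)%N -> `|xx k w i j| <= `|C'|.
  move=> kn; apply: (le_trans (entry_norm _ _ _)); apply: (le_trans (norm_le_enorm _)).
  by apply: (le_trans (HC' k w kn)); exact: ler_norm.
pose H := simple_value n tau xi; pose H' := simple_value nn tt xx.
have mH : jm H by apply: (simple_value_meas hF _ tau_mono mxi); rewrite tau0.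
have mH' : jm H' by apply: (simple_value_meas hF _ t2 mxx); rewrite t0.
pose I := simple_integral W nn tt xx.
pose aa (p : 'I_n + 'I_nn) := match p with inl k => trunc_a tau v k | inr k => tt k end.
pose bb (p : 'I_n + 'I_nn) := match p with inl k => trunc_b tau v k | inr k => tt k.+1 end.
pose zz (p : 'I_n + 'I_nn) w : 'M[R]_(d, m) :=
  match p with inl k => trunc_xi tau xi v k w | inr k => - xx k w end.
have hord p : s <= aa p /\ aa p <= bb p /\ bb p <= v.
  case: p => k /=; first exact: trunc_order.
  by split; [exact/tt0/ltnW|split; [exact: t2|exact: ttv]].
have mzz p : measurable_fun setT (zz p : Om (aa p) -> 'M[R]_(d, m)).
  case: p => k /=; first exact: trunc_xi_meas.
  apply: measurable_mx => i j.
  rewrite (_ : (fun _ => _) = (fun w => - xx k w i j)); last by apply/funext => w; rewrite mxE.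
  by apply: measurable_funN; apply: measurable_entry; exact: mxx.
have zzC p w i j : `|zz p w i j| <= C + `|C'|.
  case: p => k /=; first by apply: (le_trans (trunc_xi_bound tau C0 xiC _ _ _ _ _)); rewrite lerDl.
  by rewrite mxE normrN; apply: (le_trans (xxC _ _ _ _ (ltn_ord k))); rewrite lerDr.
have SI w : blk_int W aa bb zz w = S w - I w.
  rewrite /blk_int big_sumType/= /S (stopped_int_blk W xi tau_mono) /blk_int /I /simple_integral -sumrN.
  congr (_ + _); apply: eq_bigr => k _.
  by rewrite linearN/= mulmxN.
have HH u w : s <= u -> u <= v -> blk_fun aa bb zz u w = H u w - H' u w.
  move=> su uv; rewrite /blk_fun big_sumType/= /H /H' !simple_valueE -sumrN; congr (_ + _).
    apply: eq_bigr => k _; rewrite /blk /trunc_a /trunc_b /trunc_xi.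
    case: (ltP (tau k) v) => h.
      rewrite le_min uv andbT; by [].
    rewrite min_r ?(le_trans h) ?tau_mono//.
    by rewrite ltNge uv/= scale0r ltNge (le_trans uv h)/= scale0r.
  by apply: eq_bigr => k _; rewrite scalerN.
have [iso1 iso2] := blk_isometry hF hW s0 hord mzz zzC.
have e2 k1 k2 (A : R -> Omega -> 'M[R]_(k1, k2)) : jm A -> jm (fun u w => enorm (A u w) ^+ 2).
  by move=> mA; apply: measurable_funX; exact: enorm_meas.
have b1 : ibd (lebitv s v \x Q)%E (fun z => enorm (sX z.1 z.2 - H' z.1 z.2) ^+ 2) del.
  apply: (@ts_ibd _ _ _ Q s v (fun u w => enorm (sX u w - H' u w) ^+ 2)) => //.
  - exact: (e2 _ _ (fun u w => sX u w - H' u w) (mx_sub_meas msX mH')).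
  - by move=> u w; exact: sqr_ge0.
have b2 : ibd (lebitv s v \x Q)%E (fun z => enorm (H z.1 z.2 - sX z.1 z.2) ^+ 2) del.
  have mHs := e2 _ _ (fun u w => H u w - sX u w) (mx_sub_meas mH msX).
  have g0 u w : 0 <= enorm (H u w - sX u w) ^+ 2 by exact: sqr_ge0.
  exact: (@ts_sub _ _ _ Q s T s v (fun u w => enorm (H u w - sX u w) ^+ 2) del (lexx s) vT mHs g0 iss).
have b3 : ibd (lebitv s v \x Q)%E (fun z => enorm (H z.1 z.2 - H' z.1 z.2) ^+ 2) (4 * del).
  apply: (@ibd_weaken _ _ _ _ _ (2 * del + 2 * del)); first by lra.
  apply: ibd_le (ibdD (ibdZ _ b2) (ibdZ _ b1)) => //.
  - exact: (e2 _ _ (fun u w => H u w - H' u w) (mx_sub_meas mH mH')).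
  - by move=> z; exact: sqr_ge0.
  - move=> z; have := enorm_sqB (H z.1 z.2 - sX z.1 z.2) (H' z.1 z.2 - sX z.1 z.2).
    rewrite opprB addrA subrK => /le_trans; apply.
    by rewrite -(opprB (sX z.1 z.2) (H' z.1 z.2)) enormN.
have b4 : ibd Q (fun w => enorm (S w - I w) ^+ 2) (4 * del).
  split; first by apply: (eq_integ _ iso1) => w; rewrite SI.
  apply: le_trans b3.2.
  have [k1 k2] := @fubini12 _ _ _ _ R (lebitv s v) Q (fun u w => enorm (H u w - H' u w) ^+ 2) b3.1.
  rewrite -k2 (_ : \int[Q]_x enorm (S x - I x) ^+ 2 = \int[Q]_w (enorm (blk_int W aa bb zz w) ^+ 2)).
    rewrite iso2 le_eqVlt; apply/orP; left; apply/eqP; apply: lebitv_eq.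
    - apply: (measurableT_comp (@fine_measurable R setT measurableT)).
      apply: (@ts_inner_meas _ _ _ Q (fun u w => enorm (blk_fun aa bb zz u w) ^+ 2)) => [|u w].
        apply: e2; apply: blk_fun_joint => p.
        exact: (adapted_meas hF (le_trans s0 (hord p).1)).
      exact: sqr_ge0.
    - exact: (integ_meas k1).
    - by move=> u su uv; apply: Rint_eq => w; rewrite HH.
  by apply: Rint_eq => w; rewrite SI.
have mI : measurable_fun setT I.
  rewrite (_ : I = fun w => S w - blk_int W aa bb zz w).
    by apply: mx_sub_meas => //; exact: (blk_int_meas s0 hord mzz).
  by apply/funext => w; rewrite SI opprB addrC subrK.
have b5 : ibd Q (fun w => enorm (J w - I w) ^+ 2) del.
  apply: ibd_ereal => [|w|//]; last exact: sqr_ge0.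
  by apply: measurable_funX; apply: enorm_meas; exact: mx_sub_meas.
have b6 : ibd Q (fun w => enorm (S w - J w) ^+ 2) (10 * del).
  apply: (@ibd_weaken _ _ _ _ _ (2 * (4 * del) + 2 * del)); first by lra.
  apply: ibd_le (ibdD (ibdZ _ b4) (ibdZ _ b5)) => //.
  - by apply: measurable_funX; apply: enorm_meas; exact: mx_sub_meas.
  - by move=> z; exact: sqr_ge0.
  - move=> w; have := enorm_sqB (S w - I w) (J w - I w).
    by rewrite opprB addrA subrK.
apply: ibd_le (ibdD (_ : ibd Q (fun=> e) e) (ibdZ _ b6)).
- by apply: enorm_meas; exact: mx_sub_meas.
- by move=> w; exact: enorm_ge0.
- by move=> w; exact: enorm_young.
- by split; [exact: integ_cst|rewrite Rint_cst].
- by rewrite invr_ge0 ltW.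
Qed.

(** The drift contributes at most the L^1 distance of beta and bX, whatever v
is, and the noise is controlled by [stopped_int_gap]. *)
Lemma gap_bound : ibd Q (fun w => `|euler v w - X v w|) (a + (e + e^-1 * (10 * del))).
Proof.
pose G u w := `|beta u w - bX u w|.
have mG : jm G by apply: mx_norm_comp; exact: mx_sub_meas.
have G0 u w : 0 <= G u w by exact: normr_ge0.
have iv := @ts_sub _ _ _ Q s T s v G a (lexx s) vT mG G0 ibb.
have [f1 f2] := @fubini21 _ _ _ _ R (lebitv s v) Q G iv.1.
have b1 : ibd Q (fun w => \int[lebitv s v]_u G u w) a by split=> //; rewrite f2; exact: iv.2.
apply: ibd_ae (ibdD b1 stopped_int_gap).
- apply: mx_norm_comp; apply: mx_sub_meas => //.
  by apply: (adapted_meas hF v0); exact: euler_adapted.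
- by move=> w; exact: normr_ge0.
have aeG := ts_ae iv.1.
apply: filterS2 aeG XE => w iGw ->.
rewrite /euler -/S.
set rb := \row_i \int[lebitv s v]_u _; set rX := \row_i _.
have -> : X0 w + rb + S w - (X0 w + rX + J w) = (rb - rX) + (S w - J w).
  by apply/rowP => i; rewrite !mxE; ring.
apply: (le_trans (ler_normD _ _)); apply: lerD; last exact: norm_le_enorm.
apply: norm_mx_le => [|i j]; first by apply: Rint_ge0 => u; exact: G0.
have mbw := meas_sec1 (f := fun u w => beta u w 0 j) (mbi j) w.
have mbXi : measurable_fun setT (fun z : measurableTypeR R * Omega => bX z.1 z.2 0 j).
  exact: measurable_entry.
have mXw := meas_sec1 (f := fun u w => bX u w 0 j) mbXi w.
have ib : integ (lebitv s v) (fun u => beta u w 0 j).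
  by apply: (@integ_b _ _ _ _ _ M) => //; exact: lebitv_lt.
have iX : integ (lebitv s v) (fun u => bX u w 0 j).
  have iM : integ (lebitv s v) (fun=> M) by apply: (@integ_b _ _ _ _ _ `|M|) => //; exact: lebitv_lt.
  apply: (@integ_le _ _ R (lebitv s v) (fun u => bX u w 0 j) (fun u => M + G u w) mXw (integD iM iGw)) => u.
  have -> : bX u w 0 j = beta u w 0 j - (beta u w - bX u w) 0 j by rewrite !mxE opprB addrC subrK.
  by apply: (le_trans (ler_normB _ _)); apply: lerD => //; exact: entry_norm.
rewrite ord1 !mxE -(lebitv_Rint _ _ mXw) -RintB//.
apply: Rint_norm_le => //; first exact: integB.
by move=> u; apply: le_trans (entry_norm _ 0 j); rewrite !mxE.
Qed.

End Gap.
End OneSimple.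
End Process.

(** * The Ito formula in expectation *)

Section ItoExpectation.
Context (R : realType) (dO : measure_display) (Omega : measurableType dO).
Variables (Q : probability Omega R) (m d : nat) (F : R -> set (set Omega)).
Variable (W : Omega -> cpath R m 0).
Hypotheses (hF : filtration F) (hW : brownian_motion Q F W).
Notation Om a := (g_sigma_algebraType (F a)).
Notation jm f := (measurable_fun setT (fun z : measurableTypeR R * Omega => f z.1 z.2)).

Variables (X bX : R -> Omega -> 'rV[R]_d) (sX : R -> Omega -> 'M[R]_(d, m)) (s T : R).
Hypotheses (s0 : 0 <= s) (mX : jm X) (mbX : jm bX) (msX : jm sX).
Hypothesis aX : forall v, s <= v -> measurable_fun setT (X v : Om v -> 'rV[R]_d).
Hypothesis pbX : forall v, s <= v ->
  measurable_fun setT (fun z : measurableTypeR R * Om v => bX (Num.min v z.1) z.2).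
Hypothesis iZ : integ (lebitv s T \x Q)%E (fun z => `|bX z.1 z.2| + enorm (sX z.1 z.2) ^+ 2).
Hypothesis XE : forall v, s <= v -> v <= T -> exists2 J, ito_integral Q F W s v sX J &
  {ae Q, forall w, X v w = X s w
   + \row_i (\int[@lebesgue_measure R]_(u in `[s, v]) bX u w 0 i) + J w}.

Variables (r K : R) (D : Omega -> R) (h : 'rV[R]_d -> R).
Hypotheses (sr : s <= r) (rT : r <= T) (K0 : 0 <= K)
  (mD : measurable_fun setT (D : Om r -> R)) (DK : forall w, `|D w| <= K) (th : test_function h).

Let sT : s <= T. Proof. exact: le_trans rT. Qed.
Let mD' : measurable_fun setT D. Proof. exact: (adapted_meas hF (le_trans s0 sr) mD). Qed.

Lemma integ_ts_sub (G : R -> Omega -> R) : jm G -> (forall v w, 0 <= G v w) ->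
  integ (lebitv s T \x Q)%E (fun z => G z.1 z.2) -> integ (lebitv r T \x Q)%E (fun z => G z.1 z.2).
Proof.
move=> mG G0 iG.
by case: (@ts_sub _ _ _ Q s T r T G _ sr (lexx T) mG G0 (conj iG (lexx _))).
Qed.

Let cut (N : nat) (x : 'rV[R]_d) : 'rV[R]_d := if N%:R < `|x| then 0 else x.
Let cut_meas N : measurable_fun setT (cut N).
Proof.
apply: measurable_fun_ifT => //; apply: measurable_fun_ltr => //.
exact: mx_norm_meas.
Qed.
Let cut_bound N x i : `|cut N x 0 i| <= N%:R.
Proof.
apply: (le_trans (entry_norm _ _ _)); rewrite /cut; case: ltP => //.
by rewrite normr0.
Qed.
Let cut_diff N x : `|cut N x - x| = if N%:R < `|x| then `|x| else 0.
Proof. by rewrite /cut; case: ifP => _; rewrite ?sub0r ?normrN// subrr normr0. Qed.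

(** The drift is cut off at a level given by [integ_tail]; the integrand is one
of the simple integrands that define the stochastic integral up to the final
time T, and the same one serves all times v <= T. *)
Lemma ito_approx eta : 0 < eta -> exists H beta Y,
  [/\ jm H, jm beta, jm Y,
    integ (lebitv r T \x Q)%E (fun z => D z.2 * genop (H z.1 z.2) (beta z.1 z.2) h (Y z.1 z.2)) /\
    \int[Q]_w (D w * h (Y T w)) - \int[Q]_w (D w * h (Y r w)) =
    \int[(lebitv r T \x Q)%E]_z (D z.2 * genop (H z.1 z.2) (beta z.1 z.2) h (Y z.1 z.2)) &
   [/\ integ (lebitv r T \x Q)%E (fun z => `|(H z.1 z.2 : 'M[R]_(d, m)) - sX z.1 z.2| ^+ 2) /\
      \int[(lebitv r T \x Q)%E]_z (`|H z.1 z.2 - sX z.1 z.2| ^+ 2) <= eta,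
    integ (lebitv r T \x Q)%E (fun z => `|(beta z.1 z.2 : 'rV[R]_d) - bX z.1 z.2|) /\
      \int[(lebitv r T \x Q)%E]_z `|beta z.1 z.2 - bX z.1 z.2| <= eta &
    forall v, r <= v -> v <= T -> integ Q (fun w => `|(Y v w : 'rV[R]_d) - X v w|) /\
      \int[Q]_w `|Y v w - X v w| <= eta]].
Proof.
(* eta / 2 for the drift, and eta / 4 + 10 del / (eta / 4) <= eta / 2 for the noise *)
move=> eta0; pose e := eta / 4; pose del := Num.min eta (eta ^+ 2 / 160).
have e0 : 0 < e by rewrite divr_gt0.
have del0 : 0 < del by rewrite lt_min eta0 divr_gt0// exprn_gt0.
have eta20 : 0 < eta / 2 by rewrite divr_gt0.
have delE : eta / 2 + (e + e^-1 * (10 * del)) <= eta.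
  have : e^-1 * (10 * del) <= eta / 4.
    rewrite ler_pdivrMl// /e; have : del <= eta ^+ 2 / 160 by rewrite ge_min lexx orbT.
    by rewrite expr2; lra.
  by rewrite /e; lra.
have mbn : jm (fun u w => `|bX u w|) by exact: mx_norm_comp.
have ibn : integ (lebitv s T \x Q)%E (fun z => `|bX z.1 z.2|).
  apply: (@integ_le _ _ R (lebitv s T \x Q)%E _ _ mbn iZ) => z.
  by rewrite normr_id lerDl sqr_ge0.
have [N [iN HN]] := @integ_tail _ _ R (lebitv s T \x Q)%E (fun z => `|bX z.1 z.2|) _ eta20
   (fun z => normr_ge0 _) ibn.
pose beta u w := cut N (bX u w).
have mb : jm beta by apply: (measurableT_comp (cut_meas N)).
have pb v : s <= v -> measurable_fun setT (fun z : measurableTypeR R * Om v => beta (Num.min v z.1) z.2).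
  by move=> sv; apply: (measurableT_comp (cut_meas N)); exact: pbX.
have bM v w i : `|beta v w 0 i| <= N%:R by exact: cut_bound.
have ibb : ibd (lebitv s T \x Q)%E (fun z => `|beta z.1 z.2 - bX z.1 z.2|) (eta / 2).
  split; first by apply: (eq_integ _ iN) => z; rewrite cut_diff.
  by apply: le_trans HN; rewrite le_eqVlt; apply/orP; left; apply/eqP; apply: Rint_eq => z; rewrite cut_diff.
have [J [_ [n' [tau' [xi' [hs h1 _]]]]] _] := XE sT (lexx T).
have [l /ltW l1] : exists l, (\int[@lebesgue_measure R]_(r in `[s, T]) \int[Q]_w
          (enorm (sX r w - simple_value (n' l) (tau' l) (xi' l) r w) ^+ 2)%R%:E < del%:E)%E.
  have : \forall N \near \oo, (\int[@lebesgue_measure R]_(r in `[s, T]) \int[Q]_w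
          (enorm (sX r w - simple_value (n' N) (tau' N) (xi' N) r w) ^+ 2)%R%:E < del%:E)%E.
    apply: (h1 [set y | (y < del%:E)%E]).
    by apply: open_nbhs_nbhs; split; [exact: open_ereal_lt_ereal|rewrite /= lte_fin].
  by case=> l _ /(_ l (leqnn l)); exists l.
have [t0 t1 t2 t3 [C' HC']] := hs l.
set n := n' l in l1 t0 t1 t2 t3 HC'; set tau := tau' l in l1 t0 t1 t2 t3 HC'.
set xi := xi' l in l1 t0 t1 t2 t3 HC'.
have tt0 k : (k <= n)%N -> s <= tau k by move=> kn; rewrite -t0; apply: (tau_le t2).
have mxi k : (k < n)%N -> measurable_fun setT (xi k : Om (tau k) -> 'M[R]_(d, m)).
  move=> kn; apply/(measurable_wrtP (filt_sigma hF (le_trans s0 (tt0 _ (ltnW kn))))).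
  exact: t3.
have C0 : 0 <= `|C'| by exact: normr_ge0.
have xiC k w i j : (k < n)%N -> `|xi k w i j| <= `|C'|.
  move=> kn; apply: (le_trans (entry_norm _ _ _)); apply: (le_trans (norm_le_enorm _)).
  by apply: (le_trans (HC' k w kn)); exact: ler_norm.
have tau00 : 0 <= tau 0%N by rewrite t0.
pose H := simple_value n tau xi.
have mH : jm H by exact: (simple_value_meas hF tau00 t2 mxi).
pose E := euler W n tau xi s (X s) beta.
pose Y v := E (Num.max s v).
have EY v : s <= v -> Y v = E v by move=> sv; rewrite /Y max_r.
have mXs := aX (lexx s).
have mY : jm Y by exact: (euler_joint hF hW s0 t0 t2 mxi (ler0n R N) mXs mb bM pb).
have e2 : jm (fun u w => enorm (H u w - sX u w) ^+ 2).
  by apply: measurable_funX; apply: enorm_meas; exact: mx_sub_meas.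
have n2 : jm (fun u w => `|H u w - sX u w| ^+ 2).
  by apply: measurable_funX; apply: mx_norm_comp; exact: mx_sub_meas.
have iss : ibd (lebitv s T \x Q)%E (fun z => enorm (H z.1 z.2 - sX z.1 z.2) ^+ 2) del.
  apply: (@ts_ibd _ _ _ Q s T (fun u w => enorm (H u w - sX u w) ^+ 2) del e2).
    by move=> u w; exact: sqr_ge0.
  apply: le_trans l1; rewrite le_eqVlt; apply/orP; left; apply/eqP.
  apply: eq_integral => u _; apply: eq_integral => w _.
  by rewrite -(opprB (sX u w) (H u w)) enormN.
have dele : del <= eta by rewrite ge_min lexx.
exists H, beta, Y; split => //.
- have [B B0 HB] := genop_bound m th (mulr_ge0 (ler0n R n) C0) (ler0n R N).
  have iG : integ (lebitv r T \x Q)%E (fun z => D z.2 * genop (H z.1 z.2) (beta z.1 z.2) h (Y z.1 z.2)).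
    apply: (@ts_integ_b _ _ _ Q r T (fun v w => D w * genop (H v w) (beta v w) h (Y v w)) (K * B)).
      exact: weighted_genop_meas.
    move=> v w; rewrite normrM ler_pM//; apply: HB => // i k.
    exact: (simple_value_bound tau C0 xiC).
  split=> //.
  have [_ <-] := @fubini12 _ _ _ _ R (lebitv r T) Q (fun v w => D w * genop (H v w) (beta v w) h (Y v w)) iG.
  have tr : tau 0%N <= r by rewrite t0.
  apply: (simple_ito hF hW C0 (ler0n R N) K0 tau00 t2 tr rT t1 mxi xiC mD DK mb bM mY _ _ th).
    move=> v rv _; have sv := le_trans sr rv; rewrite EY//.
    exact: (euler_adapted hF hW s0 t0 t2 mxi mXs mb bM pb sv).
  move=> k v v' w kn rv kv vv vk; have sv := le_trans sr rv.
  rewrite (EY v sv) (EY v' (le_trans sv vv)).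
  exact: (euler_inc W xi t2 (X s) mb bM w kn sv kv vv vk).
- split.
  + apply: (@ts_sub _ _ _ Q s T r T (fun u w => `|H u w - sX u w| ^+ 2) eta sr (lexx T) n2).
      by move=> u w; exact: sqr_ge0.
    apply: (ibd_weaken dele); apply: (ibd_le n2 _ _ iss) => z; first exact: sqr_ge0.
    by rewrite lerXn2r ?nnegrE ?enorm_ge0//; exact: norm_le_enorm.
  + have eta2 : eta / 2 <= eta by lra.
    have mdb : jm (fun u w => `|beta u w - bX u w|) by apply: mx_norm_comp; exact: mx_sub_meas.
    apply: (@ts_sub _ _ _ Q s T r T (fun u w => `|beta u w - bX u w|) eta sr (lexx T) mdb).
      by move=> u w; exact: normr_ge0.
    exact: ibd_weaken eta2 ibb.
  + move=> v rv vT; have sv := le_trans sr rv.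
    have [Jv hJv XEv] := XE sv vT.
    have mXv : measurable_fun setT (X v) := adapted_meas hF (le_trans s0 sv) (aX sv).
    rewrite EY//; apply: (ibd_weaken delE).
    exact: (gap_bound hF hW s0 C0 t0 t2 mxi xiC mXs mb bM pb sv vT mXv mbX msX hJv XEv del0 e0 ibb iss).
Qed.

(** Weighted Ito formula in expectation. The weight D is measurable at
time r, so conditioning on the past of r is built in. *)
Lemma ito_expectation :
  integ (lebitv r T \x Q)%E (fun z => D z.2 * genop (sX z.1 z.2) (bX z.1 z.2) h (X z.1 z.2)) /\
  \int[Q]_w (D w * h (X T w)) - \int[Q]_w (D w * h (X r w)) =
    \int[(lebitv r T \x Q)%E]_z (D z.2 * genop (sX z.1 z.2) (bX z.1 z.2) h (X z.1 z.2)).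
Proof.
apply: (ito_limit rT K0 mD' DK msX mbX mX _ th); last exact: ito_approx.
have mE : jm (fun u w => `|bX u w| + enorm (sX u w) ^+ 2).
  apply: measurable_funD; first exact: mx_norm_comp.
  by apply: measurable_funX; exact: enorm_meas.
have mN : jm (fun u w => `|bX u w| + `|sX u w| ^+ 2).
  apply: measurable_funD; first exact: mx_norm_comp.
  by apply: measurable_funX; exact: mx_norm_comp.
have E0 u w : 0 <= `|bX u w| + enorm (sX u w) ^+ 2 by rewrite addr_ge0// sqr_ge0.
apply: (@integ_le _ _ R (lebitv r T \x Q)%E _ _ mN (integ_ts_sub mE E0 iZ)) => z.
rewrite ger0_norm ?addr_ge0 ?sqr_ge0// lerD2l lerXn2r ?nnegrE ?enorm_ge0//.
exact: norm_le_enorm.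
Qed.

End ItoExpectation.

(** * Weak topology and measurability of coefficients *)

Section PspaceTopology.
Context (R : realType) (d : nat).

Lemma pair_Cb_continuous (f : Cb R d) : continuous (fun mu : Pspace R d => \int[mu]_x sval f x).
Proof.
have c1 : continuous (@pair_Cb R d : Pspace R d -> {ptws Cb R d -> R}).
  exact: (@initial_continuous _ _ (@pair_Cb R d)).
move=> mu; apply: (@cvg_comp _ _ _ (@pair_Cb R d : Pspace R d -> {ptws Cb R d -> R})
   (fun g => g f) _ _ _ (c1 mu)).
exact: (@proj_continuous {classic (Cb R d)} (fun=> R) f (pair_Cb mu)).
Qed.

(** Convergence in the weak topology is convergence of the integrals of bounded
continuous functions, because both the initial and the product topology are
generated by the corresponding maps. *)
Lemma Pspace_cvg (T : Type) (G : set_system T) (FG : Filter G) (l : T -> Pspace R d) (mu : Pspace R d) :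
  (forall f : Cb R d, (fun t => \int[l t]_x sval f x) @ G --> \int[mu]_x sval f x) ->
  l @ G --> mu.
Proof.
move=> H.
have H1 : (fun t => @pair_Cb R d (l t) : {ptws Cb R d -> R}) @ G --> (pair_Cb mu : {ptws Cb R d -> R}).
  apply/cvg_sup => f A [V [[V2 oV <-] Vf VA]].
  have : nbhs (pair_Cb mu f) V2 by apply: open_nbhs_nbhs.
  move=> hV; apply: (@filterS _ G FG _ _ _ (H f _ hV)) => t; exact: VA.
move=> A [V [[V2 oV <-] Vmu VA]].
have : nbhs (pair_Cb mu : {ptws Cb R d -> R}) V2 by apply: open_nbhs_nbhs.
move=> hV; apply: (@filterS _ G FG _ _ _ (H1 _ hV)) => t; exact: VA.
Qed.

Lemma Pspace_continuous_meas (l : R -> Pspace R d) : continuous l -> measurable_fun setT l.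
Proof.
move=> /continuousP cl; apply: (measurability (@open (Pspace R d)) erefl).
move=> _ [U oU <-]; rewrite setTI; apply: open_measurable; exact: cl.
Qed.

End PspaceTopology.

Section Coefficients.
Context (R : realType) (d : nat).

(** A Borel coefficient is only measurable on nonnegative times; the time is
therefore given by a nonnegative measurable function. *)
Lemma coef_meas k n (f : R -> 'rV[R]_d -> Pspace R d -> 'M[R]_(k, n)) d' (U : measurableType d')
    (tm : U -> R) (x : U -> 'rV[R]_d) (l : U -> Pspace R d) :
  borel_coefficient f -> (forall u, 0 <= tm u) -> measurable_fun setT tm -> measurable_fun setT x ->
  measurable_fun setT l -> measurable_fun setT (fun u => f (tm u) (x u) (l u)).
Proof.
move=> mf tm0 mt mx ml.
apply: (@measurable_comp _ _ _ _ _ _ [set z : R * 'rV[R]_d * Pspace R d | 0 <= z.1.1]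
  (fun z => f z.1.1 z.1.2 z.2) setT (fun u => (tm u, x u, l u))) => //.
- rewrite (_ : [set _ | _] = (fun z : R * 'rV[R]_d * Pspace R d => z.1.1) @^-1` `[0, +oo[%classic).
    rewrite -[_ @^-1` _]setTI.
    have mz : measurable_fun setT (fun z : R * 'rV[R]_d * Pspace R d => z.1.1).
      by apply: (measurableT_comp (f := fst)).
    by apply: mz => //; exact: measurable_itv.
  by apply/seteqP; split=> z /=; rewrite in_itv/= andbT.
- by move=> _ [u _ <-] /=.
- by apply: measurable_fun_pair => //; exact: measurable_fun_pair.
Qed.
End Coefficients.

(** * The Ito formula for weak solutions *)

Section WeakIto.
Context (R : realType) (dO : measure_display) (Omega : measurableType dO).
Variables (Q : probability Omega R) (m d : nat) (F : R -> set (set Omega)).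
Variable (W : Omega -> cpath R m 0).
Variables (b : drift R d) (sigma : diffusion R d m) (s : R) (mu : R -> Pspace R d)
  (theta : Pspace R d) (X : Omega -> cpath R d s).
Hypotheses (s0 : 0 <= s) (hb : borel_coefficient b) (hsigma : borel_coefficient sigma)
  (cmu : {within `[s, +oo[, continuous mu}).
Hypothesis hX : weak_solution Q F W b sigma mu theta X.
Notation Om a := (g_sigma_algebraType (F a)).
Notation jm f := (measurable_fun setT (fun z : measurableTypeR R * Omega => f z.1 z.2)).

Lemma weak_filtration : filtration F. Proof. by case: hX. Qed.
Lemma weak_bm : brownian_motion Q F W. Proof. by case: hX => _ []. Qed.
Let hF := weak_filtration.
Let hW := weak_bm.

Let smax v : s <= Num.max s v. Proof. by rewrite le_max lexx. Qed.
Let max0 v : 0 <= Num.max s v. Proof. exact: le_trans (smax v). Qed.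

Lemma weak_adapted v : s <= v -> measurable_fun setT ((fun w => X w v) : Om v -> 'rV[R]_d).
Proof.
move=> sv; case: hX => _ [_ [H _ _ _]].
by apply/(measurable_wrtP (filt_sigma hF (le_trans s0 sv))); exact: H.
Qed.

Lemma cpath_max (w : cpath R d s) v : w (Num.max s v) = w v.
Proof. by have [vs|//] := ltP v s; rewrite path_before. Qed.

Lemma weak_meas v : measurable_fun setT (fun w => X w v).
Proof.
rewrite (_ : (fun w => _) = (fun w => X w (Num.max s v))); last first.
  by apply/funext => w; rewrite cpath_max.
exact: (adapted_meas hF (max0 v) (weak_adapted (smax v))).
Qed.

Lemma weak_joint : jm (fun v w => X w v).
Proof.
apply: (@measurable_joint _ _ _ _ _ (fun v w => X w v)) => [v|w]; first exact: weak_meas.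
exact: cpath_continuous.
Qed.

Let max_meas : measurable_fun setT (fun v : R => Num.max s v).
Proof. by apply: measurable_maxr => //; exact: measurable_cst. Qed.

Let mu_meas : measurable_fun setT (fun v : R => mu (Num.max s v)).
Proof. by apply: Pspace_continuous_meas; exact: continuous_clamp. Qed.

Lemma weak_coef k n (f : R -> 'rV[R]_d -> Pspace R d -> 'M[R]_(k, n)) : borel_coefficient f ->
  jm (fun v w => f (Num.max s v) (X w v) (mu (Num.max s v))).
Proof.
move=> hf; apply: (coef_meas hf) => //.
- by apply: (measurableT_comp max_meas).
- exact: weak_joint.
- by apply: (measurableT_comp mu_meas).
Qed.

(** Progressive measurability of the coefficients along the solution, from the
continuity of the solution and of the path of measures. *)
Lemma weak_coef_prog k n (f : R -> 'rV[R]_d -> Pspace R d -> 'M[R]_(k, n)) v :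
  borel_coefficient f -> s <= v ->
  measurable_fun setT (fun z : measurableTypeR R * Om v =>
    f (Num.max s (Num.min v z.1)) (X z.2 (Num.min v z.1)) (mu (Num.max s (Num.min v z.1)))).
Proof.
move=> hf sv.
have mm : measurable_fun setT (fun u : R => Num.min v u).
  by apply: measurable_minr => //; exact: measurable_cst.
have m1 : measurable_fun setT (fun z : measurableTypeR R * Om v => Num.min v z.1 : R).
  by apply: (measurableT_comp mm).
apply: (coef_meas hf) => //.
- by apply: (measurableT_comp max_meas).
- apply: (@measurable_joint _ (Om v) _ _ _ (fun u w => X w (Num.min v u))) => [u|w].
    rewrite (_ : (fun w => _) = (fun w => X w (Num.max s (Num.min v u)))); last first.
      by apply/funext => w; rewrite cpath_max.
    apply: (adapted_mono hF (max0 (Num.min v u))); first by rewrite ge_max sv ge_min lexx.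
    exact: weak_adapted.
  move=> u; apply: (cvg_comp (Num.min v) (X w)); last exact: cpath_continuous.
  by apply: (@continuous_min _ _ (fun=> v) (fun u => u)); [exact: cvg_cst|exact: cvg_id].
- by apply: (measurableT_comp mu_meas).
Qed.

Let bX v w := b (Num.max s v) (X w v) (mu (Num.max s v)).
Let sX v w := sigma (Num.max s v) (X w v) (mu (Num.max s v)).

Definition weak_size v w := enorm (bX v w) + enorm (sX v w) ^+ 2.

Lemma weak_size_meas : jm weak_size.
Proof.
apply: measurable_funD; first by apply: enorm_meas; exact: weak_coef.
by apply: measurable_funX; apply: enorm_meas; exact: weak_coef.
Qed.

Lemma weak_size_ge0 v w : 0 <= weak_size v w.
Proof. by rewrite addr_ge0 ?sqr_ge0 ?enorm_ge0. Qed.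

Lemma weak_size_integ T : s <= T -> integ (lebitv s T \x Q)%E (fun z => weak_size z.1 z.2).
Proof.
move=> sT; case: hX => _ [_ [_ _ /(_ T sT) H _]].
apply: (integ_ge0P weak_size_meas) => [z|]; first exact: weak_size_ge0.
rewrite (@ts_tonelli _ _ _ Q s T weak_size weak_size_meas weak_size_ge0).
apply: le_lt_trans H; rewrite le_eqVlt; apply/orP; left; apply/eqP.
apply: eq_integral => v; rewrite inE/= in_itv/= => /andP[sv _]; apply: eq_integral => w _.
by rewrite /weak_size /bX /sX max_r.
Qed.

Lemma weak_ito r T D K h : s <= r -> r <= T -> 0 <= K -> measurable_fun setT (D : Om r -> R) ->
  (forall w, `|D w| <= K) -> test_function h ->
  integ (lebitv r T \x Q)%E (fun z => D z.2 *
    generator b sigma (Num.max s z.1) (mu (Num.max s z.1)) h (X z.2 z.1)) /\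
  \int[Q]_w (D w * h (X w T)) - \int[Q]_w (D w * h (X w r)) =
    \int[(lebitv r T \x Q)%E]_z (D z.2 *
      generator b sigma (Num.max s z.1) (mu (Num.max s z.1)) h (X z.2 z.1)).
Proof.
move=> sr rT K0 mD DK th.
apply: (@ito_expectation _ _ _ Q m d F W hF hW (fun v w => X w v) bX sX s T s0 weak_joint
  (weak_coef hb) (weak_coef hsigma) _ _ _ _ r K D h sr rT K0 mD DK th).
- exact: weak_adapted.
- by move=> v sv; exact: weak_coef_prog.
- have mn : jm (fun v w => `|bX v w| + enorm (sX v w) ^+ 2).
    apply: measurable_funD; first by apply: mx_norm_comp; exact: weak_coef.
    by apply: measurable_funX; apply: enorm_meas; exact: weak_coef.
  apply: (@integ_le _ _ R (lebitv s T \x Q)%E _ _ mn (weak_size_integ (le_trans sr rT))) => z.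
  rewrite ger0_norm ?addr_ge0 ?sqr_ge0// lerD2r; exact: norm_le_enorm.
- move=> v sv vT; case: hX => _ [_ [_ _ _ /(_ v sv) [J HJ XE]]]; exists J.
    case: HJ => mJ [n [tau [xi [h1 h2 h3]]]]; split; first exact: mJ.
    exists n, tau, xi; split; [exact: h1| |exact: h3].
    have E (k : nat) : (\int[@lebesgue_measure R]_(r in `[s, v]) \int[Q]_w
          (enorm (sX r w - simple_value (n k) (tau k) (xi k) r w) ^+ 2)%R%:E)%E =
        (\int[@lebesgue_measure R]_(r in `[s, v]) \int[Q]_w
          (enorm (sigma r (X w r) (mu r) - simple_value (n k) (tau k) (xi k) r w) ^+ 2)%R%:E)%E.
      apply: eq_integral => u; rewrite inE/= in_itv/= => /andP[su _].
      by apply: eq_integral => w _; rewrite /sX max_r.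
    by rewrite (funext E); exact: h2.
  apply: filterS XE => w ->; congr (_ + _ + _); apply/rowP => i; rewrite !mxE.
  apply: eq_Rintegral => u; rewrite inE/= in_itv/= => /andP[su _].
  by rewrite /bX max_r.
Qed.

End WeakIto.

(** * Reweighted marginals solve the linear equation *)

Section Tilt.
Context dO (Omega : measurableType dO) (R : realType) (Q : probability Omega R).
Variable D : Omega -> R.

(** The probability with density D with respect to Q. The hypotheses are
arguments so that its structure of probability measure can be inferred. *)
Definition tilt (mD : measurable_fun setT D) (D0 : forall w, 0 <= D w)
    (D1 : \int[Q]_w D w = 1) (iD : integ Q D) (B : set Omega) : \bar R :=
  (\int[Q]_(w in B) (D w)%:E)%E.

Variables (mD : measurable_fun setT D) (D0 : forall w, 0 <= D w)
    (D1 : \int[Q]_w D w = 1) (iD : integ Q D).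

Let tilt0 : tilt mD D0 D1 iD set0 = 0%E. Proof. exact: integral_set0. Qed.

Let tilt_ge0 B : (0 <= tilt mD D0 D1 iD B)%E.
Proof. by apply: integral_ge0 => w _; rewrite lee_fin. Qed.

Let tilt_sigma : semi_sigma_additive (tilt mD D0 D1 iD).
Proof.
apply: semi_sigma_additive_nng_induced; first exact/measurable_EFinP.
by move=> w; rewrite lee_fin.
Qed.

HB.instance Definition _ := isMeasure.Build _ _ _ (tilt mD D0 D1 iD) tilt0 tilt_ge0 tilt_sigma.

Let tiltT : tilt mD D0 D1 iD setT = 1%:E.
Proof. by rewrite /tilt -EFin_Rint// D1. Qed.

HB.instance Definition _ := Measure_isProbability.Build _ _ _ (tilt mD D0 D1 iD) tiltT.

Lemma tilted_law (d : nat) (phi : Omega -> 'rV[R]_d) : measurable_fun setT phi ->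
  exists eta : Pspace R d, forall B, measurable B ->
    prob_of eta B = (\int[Q]_(w in phi @^-1` B) (D w)%:E)%E.
Proof.
move=> mphi.
pose X : {mfun Omega >-> 'rV[R]_d} := HB.pack phi (isMeasurableFun.Build _ _ _ _ _ mphi).
by exists (distribution (tilt mD D0 D1 iD) X : probability _ R).
Qed.

Variables (d : nat) (phi : Omega -> 'rV[R]_d) (eta : Pspace R d).
Hypotheses (mphi : measurable_fun setT phi)
  (Heta : forall B, measurable B -> prob_of eta B = (\int[Q]_(w in phi @^-1` B) (D w)%:E)%E).

Lemma tilted_ge0 (f : 'rV[R]_d -> \bar R) : measurable_fun setT f -> (forall x, 0 <= f x)%E ->
  (\int[eta]_x f x = \int[Q]_w (f (phi w) * (D w)%:E))%E.
Proof.
move=> mf f0.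
rewrite (@law_ge0_integral _ _ _ _ R (tilt mD D0 D1 iD) eta phi mphi)//.
apply: (@ge0_integral_density _ _ R Q (tilt mD D0 D1 iD) D (fun w => f (phi w))) => //.
exact: measurableT_comp.
Qed.

Lemma tilted_Rint (f : 'rV[R]_d -> R) : measurable_fun setT f ->
  \int[eta]_x f x = \int[Q]_w (D w * f (phi w)).
Proof.
move=> mf.
rewrite (@law_Rint _ _ _ _ R (tilt mD D0 D1 iD) eta phi mphi)//.
rewrite (@density_Rint _ _ R Q (tilt mD D0 D1 iD) D mD D0)//.
  by apply: Rint_eq => w; rewrite mulrC.
exact: measurableT_comp.
Qed.

End Tilt.

Section TiltedFP.
Context (R : realType) (dO : measure_display) (Omega : measurableType dO).
Variables (Q : probability Omega R) (m d : nat) (F : R -> set (set Omega)).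
Variable (W : Omega -> cpath R m 0).
Variables (b : drift R d) (sigma : diffusion R d m) (s : R) (mu : R -> Pspace R d)
  (theta : Pspace R d) (X : Omega -> cpath R d s).
Hypotheses (s0 : 0 <= s) (hb : borel_coefficient b) (hsigma : borel_coefficient sigma)
  (cmu : {within `[s, +oo[, continuous mu}).
Hypothesis hX : weak_solution Q F W b sigma mu theta X.
Notation Om a := (g_sigma_algebraType (F a)).

Variables (r K : R) (D : Omega -> R) (eta : R -> Pspace R d).
Hypotheses (sr : s <= r) (mD : measurable_fun setT (D : Om r -> R)) (D0 : forall w, 0 <= D w)
  (DK : forall w, D w <= K) (D1 : \int[Q]_w D w = 1).
Hypothesis Heta : forall t B, measurable B ->
  prob_of (eta t) B = (\int[Q]_(w in (fun w => X w t) @^-1` B) (D w)%:E)%E.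

Let mD' : measurable_fun setT D.
Proof. exact: (adapted_meas (weak_filtration hX) (le_trans s0 sr) mD). Qed.
Let DKn w : `|D w| <= K. Proof. by rewrite ger0_norm. Qed.
Let iD : integ Q D. Proof. exact: (@prob_integ_b _ _ R Q D K mD' DKn). Qed.
Let K0 : 0 <= K. Proof. exact: le_trans (D0 point) (DK point). Qed.
Let mX t : measurable_fun setT (fun w => X w t). Proof. exact: (weak_meas s0 hX). Qed.

(** Dominated convergence, as paths of X are continuous and D is bounded. *)
Lemma tilted_continuous : continuous eta.
Proof.
move=> t; apply: Pspace_cvg => f.
have [cf [M HM]] := svalP f.
have mf : measurable_fun setT (sval f) by exact: continuous_measurable_mx.
have E u : \int[eta u]_x sval f x = \int[Q]_w (D w * sval f (X w u)).
  exact: (tilted_Rint mD' D0 D1 iD (mX u) (Heta u)).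
rewrite (funext E) E.
have M0 : 0 <= M := le_trans (normr_ge0 _) (HM 0).
have It : t \in `]t - 1, t + 1[%classic by rewrite inE/= in_itv/= ltrBlDr ltrDl ltr01.
have mDf u : measurable_fun setT (fun w => D w * sval f (X w u)).
  by apply: measurable_funM => //; exact: measurableT_comp.
have bD u w : `|D w * sval f (X w u)| <= K * M by rewrite normrM ler_pM.
apply: (@continuity_under_integral R _ Omega Q (fun u w => D w * sval f (X w u)) setT measurableT
  (t - 1) (t + 1) _ _ (fun=> K * M) _ _ t It).
- by move=> u _; exact: (@prob_integ_b _ _ R Q _ _ (mDf u) (bD u)).
- apply: aeW => w _ u _; apply: cvgM; first exact: cvg_cst.
  by apply: (cvg_comp (X w) (sval f)); [exact: cpath_continuous|exact: cf].
- exact: integ_cst.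
- by move=> u _; apply: aeW => w _; exact: bD.
Qed.

Lemma tilted_size T : r <= T ->
  (\int[@lebesgue_measure R]_(v in `[r, T]) \int[eta v]_x
     (enorm (b v x (mu v)) + enorm (sigma v x (mu v)) ^+ 2)%:E < +oo)%E.
Proof.
move=> rT; have sT := le_trans sr rT.
pose G := weak_size b sigma mu X; have G0 := weak_size_ge0 b sigma mu X.
have mG := weak_size_meas s0 hb hsigma cmu hX.
have DG0 v w : 0 <= D w * G v w by rewrite mulr_ge0.
have mDG : measurable_fun setT (fun z : measurableTypeR R * Omega => D z.2 * G z.1 z.2).
  by apply: measurable_funM => //; apply: (measurableT_comp mD').
have iG : integ (lebitv r T \x Q)%E (fun z => D z.2 * G z.1 z.2).
  have [iG _] := @ts_sub _ _ _ Q s T r T G _ sr (lexx T) mG G0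
    (conj (weak_size_integ s0 hb hsigma cmu hX sT) (lexx _)).
  apply: (@integ_le _ _ R (lebitv r T \x Q)%E _ _ mDG (integZ K iG)) => z.
  by rewrite ger0_norm// ler_wpM2r.
have := integrableP _ _ _ iG => -[_ H].
apply: le_lt_trans H; rewrite le_eqVlt; apply/orP; left; apply/eqP.
transitivity (\int[(lebitv r T \x Q)%E]_z (D z.2 * G z.1 z.2)%:E)%E; last first.
  by apply: eq_integral => z _; rewrite /= ger0_norm.
rewrite (@ts_tonelli _ _ _ Q r T (fun v w => D w * G v w) mDG DG0).
apply: eq_integral => v; rewrite inE/= in_itv/= => /andP[rv _].
have sv := le_trans sr rv.
rewrite (tilted_ge0 mD' D0 D1 iD (mX v) (Heta v)).
- apply: eq_integral => w _; rewrite -EFinM mulrC /G /weak_size max_r//.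
- apply/measurable_EFinP.
  have cm k n (f : R -> 'rV[R]_d -> Pspace R d -> 'M[R]_(k, n)) : borel_coefficient f ->
      measurable_fun setT (fun x => f v x (mu v)).
    move=> hf; apply: (@coef_meas _ _ _ _ _ _ _ (fun=> v) id (fun=> mu v)) => //.
      by move=> _; exact: le_trans sv.
  apply: measurable_funD; first by apply: enorm_meas; exact: cm.
  by apply: measurable_funX; apply: enorm_meas; exact: cm.
- by move=> x; rewrite lee_fin addr_ge0 ?sqr_ge0 ?enorm_ge0.
Qed.

Lemma generator_meas v (h : 'rV[R]_d -> R) : s <= v -> test_function h ->
  measurable_fun setT (fun x => generator b sigma v (mu v) h x).
Proof.
move=> sv th.
have cm k n (f : R -> 'rV[R]_d -> Pspace R d -> 'M[R]_(k, n)) : borel_coefficient f ->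
    measurable_fun setT (fun x => f v x (mu v)).
  move=> hf; apply: (@coef_meas _ _ _ _ _ _ _ (fun=> v) id (fun=> mu v)) => //.
  by move=> _; exact: le_trans sv.
exact: (genop_meas th (cm _ _ _ hsigma) (cm _ _ _ hb) (@measurable_id _ _ setT)).
Qed.

(** The Ito formula weighted by D reads as the Fokker-Planck equation once the
expectations are written as integrals against the tilted laws. *)
Lemma tilted_solves_FP : solves_FP b sigma r mu eta.
Proof.
split; first by apply: continuous_subspaceT; exact: tilted_continuous.
move=> T rT; split; first exact: tilted_size.
move=> h th; have mh : measurable_fun setT h by exact: test_measurable.
have [iL E] := weak_ito s0 hb hsigma cmu hX sr rT K0 mD DKn th.
rewrite (tilted_Rint mD' D0 D1 iD (mX T) (Heta T) mh) (tilted_Rint mD' D0 D1 iD (mX r) (Heta r) mh).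
apply/eqP; rewrite addrC -subr_eq E; apply/eqP.
have [k1 <-] := @fubini12 _ _ _ _ R (lebitv r T) Q (fun v w => D w *
  generator b sigma (Num.max s v) (mu (Num.max s v)) h (X w v)) iL.
rewrite (lebitv_Rint _ _ (integ_meas k1)).
apply: eq_Rintegral => v; rewrite inE/= in_itv/= => /andP[rv _].
have sv := le_trans sr rv.
rewrite max_r// (tilted_Rint mD' D0 D1 iD (mX v) (Heta v))//.
exact: generator_meas.
Qed.

End TiltedFP.

(** * Equality of laws and weakly continuous paths *)

Section SameLaw.
Context (R : realType) (d : nat).

Lemma same_law_sym (mu nu : Pspace R d) : same_law mu nu -> same_law nu mu.
Proof. by move=> H B mB; rewrite H. Qed.

Lemma same_law_trans (mu nu la : Pspace R d) : same_law mu nu -> same_law nu la -> same_law mu la.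
Proof. by move=> H H' B mB; rewrite H// H'. Qed.

Lemma same_law_Rint (mu nu : Pspace R d) (f : 'rV[R]_d -> R) : same_law mu nu ->
  \int[mu]_x f x = \int[nu]_x f x.
Proof.
move=> H; rewrite /Rintegral; congr fine; apply: eq_measure_integral => B mB _; exact: H.
Qed.

(** Weakly open sets do not separate measures that agree on measurable sets,
and this passes to the generated sigma-algebra. *)
Lemma same_law_borel (B : set (Pspace R d)) (mu nu : Pspace R d) :
  measurable B -> same_law mu nu -> B mu -> B nu.
Proof.
move=> mB mn.
pose G := [set B : set (Pspace R d) | B mu <-> B nu].
suff : <<s @open (Pspace R d) >> `<=` G by move=> /(_ B mB)[].
apply: smallest_sub.
  split => [|C HC|C HC]; rewrite /G/=.
  - by split.
  - by split=> -[_ nC]; split=> // hC; apply: nC; exact/HC.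
  - by split=> -[k _ Ck]; exists k => //; apply/HC.
move=> U [V oV <-]; rewrite /G /=.
suff -> : pair_Cb mu = pair_Cb nu by [].
by apply/funext => f; exact: same_law_Rint.
Qed.

Lemma coef_same_law k n (f : R -> 'rV[R]_d -> Pspace R d -> 'M[R]_(k, n)) t x
    (mu nu : Pspace R d) : borel_coefficient f -> 0 <= t -> same_law mu nu ->
  f t x mu = f t x nu.
Proof.
move=> hf t0 mn; apply/matrixP => i j.
have mf : measurable_fun setT (fun la : Pspace R d => f t x la i j).
  by apply: measurable_entry; apply: (@coef_meas _ _ _ _ _ _ _ (fun=> t) (fun=> x) id).
have mB := mf measurableT _ (measurable_set1 (f t x mu i j)).
by have /= [] := same_law_borel mB mn (conj I erefl).
Qed.

Lemma generator_same_law m (b : drift R d) (sigma : diffusion R d m) t x h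
    (mu nu : Pspace R d) : borel_coefficient b -> borel_coefficient sigma ->
  0 <= t -> same_law mu nu -> generator b sigma t mu h x = generator b sigma t nu h x.
Proof.
by move=> hb hs t0 mn; rewrite /generator (coef_same_law x hb t0 mn) (coef_same_law x hs t0 mn).
Qed.

Lemma solves_FP_congr m (b : drift R d) (sigma : diffusion R d m) r (mu mu' nu : R -> Pspace R d) :
  borel_coefficient b -> borel_coefficient sigma -> 0 <= r ->
  (forall t, r <= t -> same_law (mu t) (mu' t)) ->
  solves_FP b sigma r mu nu -> solves_FP b sigma r mu' nu.
Proof.
move=> hb hs r0 mm [cn H]; split=> // t rt; have [H1 H2] := H t rt; split.
  apply: le_lt_trans H1; rewrite le_eqVlt; apply/orP; left; apply/eqP.
  apply: eq_integral => u; rewrite inE/= in_itv/= => /andP[ru _]; apply: eq_integral => x _.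
  have u0 := le_trans r0 ru; have mu_ := same_law_sym (mm u ru).
  by rewrite (coef_same_law x hb u0 mu_) (coef_same_law x hs u0 mu_).
move=> h th; rewrite (H2 h th); congr (_ + _).
apply: eq_Rintegral => u; rewrite inE/= in_itv/= => /andP[ru _]; apply: Rint_eq => x.
exact: (generator_same_law x h hb hs (le_trans r0 ru) (mm u ru)).
Qed.

End SameLaw.

Section Bump.
Context (R : realType) (d : nat).

(** Take min 1 (n dist(x, U^c)); the distance is an infimum, and the case of an
empty complement is separate because that infimum is then meaningless. *)
Lemma open_bump (U : set 'rV[R]_d) : open U -> exists f : nat -> Cb R d,
  (forall n x, 0 <= sval (f n) x <= 1) /\
  forall x, (fun n => (sval (f n) x)%:E) @ \oo --> (\1_U x : R)%:E.
Proof.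
move=> oU.
suff [D [D0 [cD HD]]] : exists D : 'rV[R]_d -> R,
    (forall x, 0 <= D x) /\ continuous D /\ forall x, U x <-> 0 < D x.
  have fP n : continuous (fun x => Num.min 1 (n%:R * D x)) /\
      exists M : R, forall x, `|Num.min 1 (n%:R * D x)| <= M.
    split; last first.
      by exists 1 => x; rewrite ger0_norm ?ge_min ?lexx// le_min ler01 mulr_ge0.
    move=> x; apply: (@continuous_min R _ (fun=> 1) (fun x => n%:R * D x)); first exact: cst_continuous.
    by apply: continuousM; [exact: cst_continuous|exact: cD].
  exists (fun n => exist (fun f : 'rV[R]_d -> R => continuous f /\ exists M : R, forall x, `|f x| <= M) _ (fP n)); split=> [n x|x] /=.
    by rewrite le_min ler01 mulr_ge0//= ge_min lexx.
  apply: cvg_near_cst; case: (pselect (U x)) => Ux.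
    rewrite indicE mem_set//; have Dx := (HD x).1 Ux.
    near=> n; rewrite min_l// -ler_pdivrMr// mul1r.
    by near: n; exact: nbhs_infty_ger.
  rewrite indicE memNset//; apply: nearW => n /=.
  have -> : D x = 0 by apply/le_anti; rewrite D0 andbT leNgt; apply/negP => /(HD x).2.
  by rewrite mulr0 min_r.
have [[y0 Uy0]|UT] := pselect (exists y, ~ U y); last first.
  exists (fun=> 1); split=> //; split; first by move=> x; exact: cst_continuous.
  by move=> x; split=> // _; apply: contrapT => Ux; apply: UT; exists x.
pose S x := [set `|x - y| | y in ~` U].
have S0 x : S x !=set0 by exists `|x - y0|; exists y0.
have lS x : has_lbound (S x) by exists 0 => _ [y _ <-].
have ubS x y : ~ U y -> inf (S x) <= `|x - y| by move=> Uy; apply: ge_inf => //; exists y.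
exists (fun x => inf (S x)); split; first by move=> x; apply: lb_le_inf => // _ [y _ <-].
have lip x x' : inf (S x) - inf (S x') <= `|x - x'|.
  rewrite lerBlDr -lerBlDl; apply: lb_le_inf => // _ [y Uy <-].
  rewrite lerBlDl; apply: (le_trans (ubS x y Uy)).
  by rewrite -(subrKA x' x) ler_normD.
split=> [x|x].
  move=> B /nbhs_ballP[e /= e0 eB]; apply/nbhs_ballP; exists e => //= x'.
  rewrite -ball_normE/= => xx; apply: eB; rewrite -ball_normE/=; apply: le_lt_trans xx.
  by rewrite ler_norml lip andbT lerNl opprB distrC lip.
split=> [Ux|Sx].
  have /nbhs_ballP[e /= e0 eU] : nbhs x U by exact: open_nbhs_nbhs.
  apply: (lt_le_trans e0); apply: lb_le_inf => // _ [y Uy <-].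
  by rewrite leNgt; apply/negP => h; apply: Uy; apply: eU; rewrite -ball_normE.
apply: contrapT => Ux; move: Sx; apply/negP; rewrite -leNgt.
by apply: (le_trans (ubS x x Ux)); rewrite subrr normr0.
Unshelve. all: by end_near. Qed.

End Bump.

Section PathKernel.
Context (R : realType) (d : nat).
Variable l : R -> Pspace R d.
Hypothesis cl : continuous l.

(** On open sets the measure is the limit of integrals of bounded continuous
functions, which are continuous in time; the class of good sets is a Dynkin
class. *)
Lemma path_measurable (B : set 'rV[R]_d) : measurable B ->
  measurable_fun setT (fun v : measurableTypeR R => prob_of (l v) B).
Proof.
apply: (@dynkin_induction _ _ (@open 'rV[R]_d) (fun B =>
  measurable_fun setT (fun v : measurableTypeR R => prob_of (l v) B))) => //.
- by move=> U V; exact: openI.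
- rewrite (_ : (fun v => _) = (fun=> 1%E)); first exact: measurable_cst.
  by apply/funext => v; rewrite probability_setT.
- move=> U oU; have [f [f01 Hf]] := open_bump oU.
  have mf n : measurable_fun setT (sval (f n)).
    by apply: continuous_measurable_mx; case: (svalP (f n)).
  apply: (@emeasurable_fun_cvg _ _ _ _ (fun n v => (\int[l v]_x sval (f n) x)%:E)).
    move=> n; apply/measurable_EFinP; apply: continuous_measurable_fun => v.
    by apply: (cvg_comp l (fun mu : Pspace R d => \int[mu]_x sval (f n) x));
      [exact: cl|exact: pair_Cb_continuous].
  move=> v _.
  have fi n : integ (l v) (sval (f n)).
    apply: (@prob_integ_b _ _ _ _ _ 1) => // x.
    by have /andP[h0 h1] := f01 n x; rewrite ger0_norm.
  rewrite (_ : (fun n => _) = (fun n => \int[l v]_x (sval (f n) x)%:E)%E); last first.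
    by apply/funext => n; rewrite EFin_Rint.
  have mU : measurable U by exact: open_measurable_mx.
  have [] // := @dominated_convergence _ _ _ (l v) setT measurableT
    (fun n x => (sval (f n) x)%:E) (fun x => (\1_U x)%:E) (fun=> 1%E).
  - by move=> n; exact/measurable_EFinP.
  - by apply/measurable_EFinP; exact: measurable_indic.
  - by apply: aeW => x _; exact: Hf.
  - exact: (integ_cst (l v) 1).
  - apply: aeW => x n _; have /andP[h0 h1] := f01 n x.
    by rewrite /= ger0_norm// lee_fin.
  - by move=> _ _; rewrite integral_indic// setIT.
- move=> S mS HS; rewrite (_ : (fun v => _) = (fun v => 1 - prob_of (l v) S)%E).
    by apply: emeasurable_funB => //; exact: measurable_cst.
  by apply/funext => v; rewrite probability_setC.
- move=> G mG tG HG.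
  rewrite (_ : (fun v => _) = (fun v => \sum_(i <oo) prob_of (l v) (G i))%E).
    by apply: ge0_emeasurable_sum => // k v _ _; exact: measure_ge0.
  apply/funext => v; apply: measure_semi_bigcup => //; exact: bigcupT_measurable.
Qed.

Definition path_kernel (_ : continuous l) : measurableTypeR R -> {measure set 'rV[R]_d -> \bar R} :=
  fun v => prob_of (l v).

HB.instance Definition _ := isKernel.Build _ _ _ _ _ (path_kernel cl) path_measurable.

Let path_kernelT v : path_kernel cl v setT = 1%E.
Proof. exact: probability_setT. Qed.

HB.instance Definition _ := Kernel_isProbability.Build _ _ _ _ _ (path_kernel cl) path_kernelT.

Notation jmx f := (measurable_fun setT (fun z : measurableTypeR R * 'rV[R]_d => f z.1 z.2)).

Lemma path_integral_meas (G : R -> 'rV[R]_d -> \bar R) :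
  jmx G -> (forall v x, 0 <= G v x)%E ->
  measurable_fun setT (fun v : measurableTypeR R => \int[l v]_x G v x)%E.
Proof.
move=> mG G0.
exact: (@measurable_fun_integral_finite_kernel _ _ _ _ R (fun z : measurableTypeR R * 'rV[R]_d => G z.1 z.2) (path_kernel cl)
  (fun z => G0 z.1 z.2) mG).
Qed.

Lemma path_Rint_meas (G : R -> 'rV[R]_d -> R) : jmx G ->
  measurable_fun setT (fun v : measurableTypeR R => \int[l v]_x G v x).
Proof.
move=> mG; apply: (measurableT_comp (@fine_measurable R setT measurableT)).
under eq_fun do rewrite integralE.
have mGe : measurable_fun setT (fun z : measurableTypeR R * 'rV[R]_d => (G z.1 z.2)%:E).
  exact/measurable_EFinP.
apply: emeasurable_funB.
  apply: (path_integral_meas (G := fun v => (EFin \o G v)^\+%E)) => //.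
  rewrite (_ : (fun z => _) = (fun z : measurableTypeR R * 'rV[R]_d => (G z.1 z.2)%:E)^\+%E); last first.
    by apply/funext => z; rewrite !unlock.
  exact: measurable_funepos.
apply: (path_integral_meas (G := fun v => (EFin \o G v)^\-%E)) => //.
rewrite (_ : (fun z => _) = (fun z : measurableTypeR R * 'rV[R]_d => (G z.1 z.2)%:E)^\-%E); last first.
  by apply/funext => z; rewrite !unlock.
exact: measurable_funeneg.
Qed.

End PathKernel.

(** * Restarting a solution *)

Section Restart.
Context (R : realType) (m d : nat).
Variables (b : drift R d) (sigma : diffusion R d m).
Hypotheses (hb : borel_coefficient b) (hsigma : borel_coefficient sigma).

Notation jmx f := (measurable_fun setT (fun z : measurableTypeR R * 'rV[R]_d => f z.1 z.2)).

(** Holds for non-integrable functions as well, the right-hand side being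
infinite. *)
Lemma ge0_Rint_le_ereal dT (T : measurableType dT) (P : {measure set T -> \bar R}) (f : T -> R) :
  measurable_fun setT f -> ((`|\int[P]_x f x|)%:E <= \int[P]_x (`|f x|)%:E)%E.
Proof.
move=> mf; have [H|] := ltP (\int[P]_x (`|f x|)%:E)%E +oo%E; last first.
  by rewrite leye_eq => /eqP ->; exact: leey.
have jf : integ P f by apply/integrableP; split; [exact/measurable_EFinP|].
by rewrite -EFin_Rint ?lee_fin; [exact: Rint_norm|exact: integ_norm].
Qed.

Variables (s r : R) (mu nu : R -> Pspace R d).
Hypotheses (s0 : 0 <= s) (sr : s <= r) (cmu : {within `[s, +oo[, continuous mu}).

Let mus v := mu (Num.max s v).
Let nus v := nu (Num.max s v).
Let tm v : R := Num.max s v.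

Let coef_jm k n (f : R -> 'rV[R]_d -> Pspace R d -> 'M[R]_(k, n)) : borel_coefficient f ->
  jmx (fun v x => f (tm v) x (mus v)).
Proof.
have max_meas : measurable_fun setT (fun v : R => Num.max s v).
  by apply: measurable_maxr => //; exact: measurable_cst.
have mu_meas : measurable_fun setT (fun v : R => mu (Num.max s v)).
  by apply: Pspace_continuous_meas; exact: continuous_clamp.
move=> hf; apply: (coef_meas hf) => //.
- by move=> z; rewrite (le_trans s0)// le_max lexx.
- by apply: (measurableT_comp max_meas).
- by apply: (measurableT_comp mu_meas).
Qed.

(** Subtract the equation at r from the equation at t. This requires the time
integral to be additive, hence the inner integral to be measurable and
integrable in time; it is measurable along a weakly continuous path, and
dominated by the integral of the coefficients. *)
Lemma solves_FP_restart : solves_FP b sigma s mu nu -> solves_FP b sigma r mu nu.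
Proof.
move=> [cn H].
have cnus : continuous nus by exact: continuous_clamp.
split.
  apply: continuous_subspaceW cn; apply: subset_itv => //; by rewrite bnd_simp.
move=> t rt; have st := le_trans sr rt; have [Ht Et] := H t st; have [_ Er] := H r sr.
pose sz v x := enorm (b (tm v) x (mus v)) + enorm (sigma (tm v) x (mus v)) ^+ 2.
have sz0 v x : 0 <= sz v x by rewrite addr_ge0 ?sqr_ge0 ?enorm_ge0.
have msz : jmx sz.
  apply: measurable_funD; first by apply: enorm_meas; exact: coef_jm.
  by apply: measurable_funX; apply: enorm_meas; exact: coef_jm.
pose I v := (\int[nus v]_x (sz v x)%:E)%E.
have mI : measurable_fun setT (I : measurableTypeR R -> _).
  apply: (path_integral_meas cnus (G := fun v x => (sz v x)%:E)); first exact/measurable_EFinP.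
  by move=> v x; rewrite lee_fin.
have I0 v : (0 <= I v)%E by apply: integral_ge0 => x _; rewrite lee_fin.
have IE v : s <= v -> I v = (\int[nu v]_x (enorm (b v x (mu v)) + enorm (sigma v x (mu v)) ^+ 2)%:E)%E.
  by move=> sv; rewrite /I /nus /sz /tm /mus max_r.
have It : (\int[@lebesgue_measure R]_(v in `[s, t]) I v < +oo)%E.
  apply: le_lt_trans Ht; rewrite le_eqVlt; apply/orP; left; apply/eqP.
  by apply: eq_integral => u; rewrite inE/= in_itv/= => /andP[su _]; exact: IE.
split.
  apply: le_lt_trans It.
  rewrite (_ : (\int[_]_(v in _) _)%E = \int[@lebesgue_measure R]_(v in `[r, t]) I v)%E; last first.
    apply: eq_integral => u; rewrite inE/= in_itv/= => /andP[ru _].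
    by rewrite IE// (le_trans sr).
  apply: ge0_subset_integral => //; first exact: measurable_funTS.
  by apply: subset_itv; rewrite bnd_simp.
move=> h th.
pose g v x := generator b sigma (tm v) (mus v) h x.
have mg : jmx g.
  exact: (genop_meas th (coef_jm hsigma) (coef_jm hb) measurable_snd).
pose J v := \int[nus v]_x g v x.
have mJ : measurable_fun setT (J : measurableTypeR R -> R) by exact: path_Rint_meas.
have [C C0 HC] := genop_le m th.
have gsz v x : `|g v x| <= C * sz v x.
  apply: (le_trans (HC _ _ _)); rewrite ler_wpM2l// addrC; apply: lerD; first exact: norm_le_enorm.
  rewrite lerXn2r ?nnegrE ?enorm_ge0//; exact: norm_le_enorm.
have JI v : ((`|J v|)%:E <= C%:E * I v)%E.
  have mgv : measurable_fun setT (g v) by exact: (meas_sec2 mg).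
  have mszv : measurable_fun setT (sz v) by exact: (meas_sec2 msz).
  apply: (le_trans (ge0_Rint_le_ereal _ mgv)).
  rewrite -ge0_integralZl_EFin//; [|by move=> x _; rewrite lee_fin|exact/measurable_EFinP].
  apply: ge0_le_integral => //.
  - by apply/measurable_EFinP; exact: measurableT_comp.
  - by apply/measurable_EFinP; exact: measurable_funM.
  - by move=> x _; rewrite -EFinM lee_fin.
have iJ : integ (lebitv s t) J.
  apply/integrableP; split; first exact/measurable_EFinP.
  apply: (@le_lt_trans _ _ (\int[lebitv s t]_v (C%:E * I v))%E).
    apply: ge0_le_integral => //.
    - by apply: measurableT_comp => //; exact/measurable_EFinP.
    - by apply: emeasurable_funM => //; exact: measurable_cst.
    - by move=> v _; exact: JI.
  rewrite ge0_integralZl_EFin//.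
  rewrite lebitv_integral//.
  by apply: lte_mul_pinfty; rewrite ?lee_fin.
have JE u v : s <= u -> \int[@lebesgue_measure R]_(w in `[u, v]) \int[nu w]_x generator b sigma w (mu w) h x =
    \int[lebitv u v]_w J w.
  move=> su; rewrite lebitv_Rint//; apply: eq_Rintegral => w; rewrite inE/= in_itv/= => /andP[uw _].
  by rewrite /J /g /nus /tm /mus max_r// (le_trans su).
rewrite (Et h th) (Er h th) !JE// (lebitv_split sr rt iJ).
by rewrite addrA.
Qed.

End Restart.

(** * Bounded densities and disintegration *)

Section BoundedDensity.
Context dT (T : measurableType dT) (R : realType) (P P' : probability T R) (c : R).
Hypotheses (c0 : 0 <= c) (le : forall B, measurable B -> (P' B <= c%:E * P B)%E).

(** The Radon-Nikodym density exceeds c only on a null set, so it may be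
replaced by its minimum with c; a bound everywhere is needed to use it as a
weight. *)
Lemma bounded_density : exists rho : T -> R, [/\ measurable_fun setT rho,
  forall x, 0 <= rho x, forall x, rho x <= c &
  forall B, measurable B -> (P' B = \int[P]_(x in B) (rho x)%:E)%E].
Proof.
have dom : P' `<< P.
  move=> N HN A mA AN; apply/eqP; rewrite -measure_le0 (le_trans (le mA))//.
  by rewrite (HN A mA AN) mule0.
have [f [f0 ff fi HF]] := radon_nikodym_sigma_finite dom.
pose g x := fine (f x).
have gE x : (g x)%:E = f x by rewrite /g fineK.
have fE : f = EFin \o g by apply/funext => x; rewrite /= gE.
have g0 x : 0 <= g x by exact: fine_ge0.
have ig : integ P g by rewrite /integ -fE.
have mg := integ_meas ig.
exists (fun x => Num.min c (g x)); split.
- by apply: measurable_minr => //; exact: measurable_cst.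
- by move=> x; rewrite le_min c0 g0.
- by move=> x; rewrite ge_min lexx.
pose N := [set x | c < g x].
have mN : measurable N.
  rewrite (_ : N = g @^-1` `]c, +oo[%classic); last by apply/seteqP; split=> x /=; rewrite in_itv/= andbT.
  by rewrite -[_ @^-1` _]setTI; apply: mg => //; exact: measurable_itv.
(* the positive part of g - c has integral P' N - c P N <= 0 *)
pose k x := (g x - c) * \1_N x.
have k0 x : 0 <= k x.
  rewrite /k indicE; case: (boolP (x \in N)); rewrite ?inE /N/= => h; last by rewrite mulr0.
  by rewrite mulr1 subr_ge0 ltW.
have mk : measurable_fun setT k.
  by apply: measurable_funM; [exact: measurable_funB|exact: measurable_indic].
have i1 : integ P (fun x => g x * \1_N x).
  apply: (@integ_le _ _ R P _ g) => // [|x]; first by apply: measurable_funM => //; exact: measurable_indic.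
  rewrite indicE; case: (_ \in _); rewrite ?mulr1 ?mulr0 ?normr0// ger0_norm//.
have i2 : integ P (fun x => c * \1_N x).
  apply: (@prob_integ_b _ _ R P _ c) => [|x]; first by apply: measurable_funM => //; exact: measurable_indic.
  by rewrite indicE; case: (_ \in _); rewrite ?mulr1 ?mulr0 ?normr0// ger0_norm.
have kE x : k x = g x * \1_N x - c * \1_N x by rewrite /k mulrBl.
have ik : integ P k by apply: (eq_integ _ (integB i1 i2)) => x; rewrite kE.
have Ik : \int[P]_x k x <= 0.
  rewrite (Rint_eq _ kE) RintB// subr_le0 -lee_fin !EFin_Rint//.
  apply: (@le_trans _ _ (P' N)).
    rewrite HF// [leRHS]integral_mkcond le_eqVlt; apply/orP; left; apply/eqP.
    by apply: eq_integral => x _; rewrite epatch_indic fE.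
  apply: (le_trans (le mN)).
  rewrite le_eqVlt; apply/orP; left; apply/eqP.
  under [RHS]eq_integral do rewrite EFinM.
  rewrite ge0_integralZl_EFin//; last by apply/measurable_EFinP; exact: measurable_indic.
  by rewrite integral_indic// setIT.
have Ik0 : (\int[P]_x `|(k x)%:E| = 0)%E.
  rewrite (eq_integral (EFin \o k)); last by move=> x _; rewrite /= ger0_norm.
  rewrite -EFin_Rint//; congr EFin; apply/le_anti; rewrite Ik; exact: Rint_ge0.
have kae : ae_eq P setT (EFin \o k) (cst 0%E).
  by apply/ae_eq_integral_abs => //; exact/measurable_EFinP.
move=> B mB; rewrite HF//; apply: ae_eq_integral => //.
- by apply: measurable_funTS; rewrite fE; exact/measurable_EFinP.
- apply: measurable_funTS; apply/measurable_EFinP.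
  by apply: measurable_minr => //; exact: measurable_cst.
apply: filterS kae => x /(_ I) /= [kx] _; rewrite fE /=; congr EFin.
rewrite min_r// leNgt; apply/negP => h.
have : 0 < k x by rewrite /k indicE mem_set// mulr1 subr_gt0.
by rewrite kx ltxx.
Qed.

End BoundedDensity.

Section Disintegration.
Context dX dY (X : measurableType dX) (Y : measurableType dY) (R : realType).
Variables (nu : probability X R) (p : R.-pker X ~> Y) (P : probability Y R).
Hypothesis dis : forall B, measurable B -> (P B = \int[nu]_x p x B)%E.

Definition first_kernel : unit -> {measure set X -> \bar R} := fun=> nu.
Let first_meas U : measurable U -> measurable_fun setT (first_kernel ^~ U).
Proof. by move=> _; exact: measurable_cst. Qed.
HB.instance Definition _ := isKernel.Build _ _ _ _ _ first_kernel first_meas.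
Let first_prob x : first_kernel x setT = 1%E. Proof. exact: probability_setT. Qed.
HB.instance Definition _ := Kernel_isProbability.Build _ _ _ _ _ first_kernel first_prob.

(** The kernel p in the form expected by composition of kernels, with a dummy
first component. *)
Definition second_kernel : unit * X -> {measure set Y -> \bar R} := fun z => p z.2.
Let second_meas U : measurable U -> measurable_fun setT (second_kernel ^~ U).
Proof.
move=> mU; apply: (measurableT_comp (f := p ^~ U)) => //.
exact: measurable_kernel.
Qed.
HB.instance Definition _ := isKernel.Build _ _ _ _ _ second_kernel second_meas.
Let second_prob x : second_kernel x setT = 1%E. Proof. exact: prob_kernel. Qed.
HB.instance Definition _ := Kernel_isProbability.Build _ _ _ _ _ second_kernel second_prob.

Lemma disint_ge0 (f : Y -> \bar R) : measurable_fun setT f -> (forall y, 0 <= f y)%E ->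
  (\int[P]_y f y = \int[nu]_x \int[p x]_y f y)%E.
Proof.
move=> mf f0.
rewrite -[RHS](@integral_kcomp _ _ _ _ _ _ R first_kernel second_kernel tt f f0 mf).
by apply: eq_measure_integral => B mB _; exact: (dis mB).
Qed.

Lemma pker_integ_b (f : Y -> R) k x : measurable_fun setT f -> (forall y, `|f y| <= k) -> integ (p x) f.
Proof.
by move=> mf fk; apply: (@integ_b _ _ _ _ _ k) => //; rewrite prob_kernel ltry.
Qed.

Lemma pker_cst k x : \int[p x]_y k = k.
Proof.
rewrite /Rintegral integral_cst//.
transitivity (fine (k%:E * 1)%E); last by rewrite mule1.
by congr (fine (_ * _)%E); exact: prob_kernel.
Qed.

Lemma pker_meas (f : Y -> R) k : measurable_fun setT f -> (forall y, `|f y| <= k) ->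
  measurable_fun setT (fun x => \int[p x]_y f y).
Proof.
move=> mf fk.
have mfk : measurable_fun setT (fun y => f y + k) by exact: measurable_funD.
have fk0 y : 0 <= f y + k.
  by rewrite -lerBlDr sub0r; have := fk y; rewrite ler_norml => /andP[].
rewrite (_ : (fun x => _) = (fun x => fine (\int[p x]_y (f y + k)%:E)%E - k)); last first.
  apply/funext => x; rewrite -/(Rintegral (p x) setT (fun y => f y + k)).
  rewrite RintD; [|exact: (pker_integ_b x mf fk)|exact: (@pker_integ_b (fun=> k) `|k|)].
  by rewrite pker_cst addrK.
apply: measurable_funB => //; apply: (measurableT_comp (@fine_measurable R setT measurableT)).
apply: (@measurable_fun_integral_kernel _ _ _ _ R p (measurable_kernel p)) => [y|].
  by rewrite lee_fin.
exact/measurable_EFinP.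
Qed.

Lemma pker_bound (f : Y -> R) k x : measurable_fun setT f -> (forall y, `|f y| <= k) ->
  `|\int[p x]_y f y| <= k.
Proof.
move=> mf fk; rewrite -[leRHS](pker_cst k x).
apply: Rint_norm_le => //; first exact: (pker_integ_b x mf fk).
exact: (@pker_integ_b (fun=> k) `|k|).
Qed.

(** Adding the bound k reduces to nonnegative functions. *)
Lemma disint_Rint (f : Y -> R) k : measurable_fun setT f -> (forall y, `|f y| <= k) ->
  \int[P]_y f y = \int[nu]_x \int[p x]_y f y.
Proof.
move=> mf fk.
have mfk : measurable_fun setT (fun y => f y + k) by exact: measurable_funD.
have fk0 y : 0 <= f y + k.
  by rewrite -lerBlDr sub0r; have := fk y; rewrite ler_norml => /andP[].
have ifP : integ P f by exact: (@prob_integ_b _ _ R P f k mf fk).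
have ikx x : integ (p x) (fun y => f y + k).
  by apply: integD; [exact: (pker_integ_b x mf fk)|exact: (@pker_integ_b (fun=> k) `|k|)].
have E x : \int[p x]_y (f y + k) = \int[p x]_y f y + k.
  rewrite RintD; [|exact: (pker_integ_b x mf fk)|exact: (@pker_integ_b (fun=> k) `|k|)].
  by rewrite pker_cst.
have inu : integ nu (fun x => \int[p x]_y f y).
  by apply: (@prob_integ_b _ _ R nu _ k (pker_meas mf fk)) => x; exact: pker_bound.
apply: (addIr k).
have <- : \int[P]_y (f y + k) = \int[P]_y f y + k.
  by rewrite RintD ?Rint_cst//; exact: integ_cst.
have <- : \int[nu]_x (\int[p x]_y f y + k) = \int[nu]_x \int[p x]_y f y + k.
  by rewrite RintD ?Rint_cst//; exact: integ_cst.
rewrite /Rintegral; congr fine.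
rewrite disint_ge0 => [|//|y]; [|exact/measurable_EFinP|by rewrite lee_fin].
by apply: eq_integral => x _; rewrite -EFin_Rint// E.
Qed.

End Disintegration.

(** * Path space and reweighted solutions *)

Section CanonicalPaths.
Context (R : realType) (d : nat) (s : R).

Lemma eval_meas u : s <= u -> measurable_fun setT (fun w : cpath R d s => w u).
Proof.
move=> su _ B mB; rewrite setTI; apply: sub_sigma_algebra.
by exists u, B; split => //=; rewrite in_itv/= su.
Qed.

Lemma history_meas r : @history R d s r `<=` measurable.
Proof.
apply: sub_sigma_algebra2 => A [u [B [us mB ->]]]; exists u, B; split=> //.
by move: us; rewrite /= !in_itv/= andbT => /andP[].
Qed.

Lemma history_eval r B : s <= r -> measurable B -> history s r [set w : cpath R d s | B (w r)].
Proof.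
move=> sr mB; apply: sub_sigma_algebra; exists r, B; split=> //=.
by rewrite in_itv/= sr lexx.
Qed.
End CanonicalPaths.

Section WeakPath.
Context (R : realType) (dO : measure_display) (Omega : measurableType dO).
Variables (Q : probability Omega R) (m d : nat) (F : R -> set (set Omega)).
Variable (W : Omega -> cpath R m 0).
Variables (b : drift R d) (sigma : diffusion R d m) (s : R) (mu : R -> Pspace R d)
  (theta : Pspace R d) (X : Omega -> cpath R d s).
Hypotheses (s0 : 0 <= s) (hX : weak_solution Q F W b sigma mu theta X).
Let hF := weak_filtration hX.

Lemma weak_path_meas : measurable_fun setT X.
Proof.
apply: (measurability (cylinders `[s, +oo[) erefl).
move=> _ [A [u [B [us mB ->]]] <-].
by apply: (weak_meas s0 hX u) mB.
Qed.

(** Events of the history pull back to events of the filtration: the preimages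
form a sigma-algebra that contains the cylinders. *)
Lemma weak_history r B : s <= r -> history s r B -> F r (X @^-1` B).
Proof.
move=> sr; have [S0 SC SU] := filt_sigma hF (le_trans s0 sr).
have : history s r `<=` [set B | F r (X @^-1` B)].
  apply: smallest_sub.
    split=> [|A HA|A HA] /=.
    - by rewrite preimage_set0.
    - by have := SC _ HA; rewrite !setTD preimage_setC.
    - by rewrite preimage_bigcup; exact: SU.
  move=> _ [u [C [us mC ->]]] /=.
  move: us; rewrite /= in_itv/= => /andP[su ur].
  apply: (filt_mono hF (le_trans s0 su) ur).
  by case: hX => _ [_ [H _ _ _]]; exact: (H u su C mC).
exact.
Qed.

End WeakPath.

Section TiltedSolution.
Context (R : realType) (dO : measure_display) (Omega : measurableType dO).
Variables (Q : probability Omega R) (m d : nat) (F : R -> set (set Omega)).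
Variable (W : Omega -> cpath R m 0).
Variables (b : drift R d) (sigma : diffusion R d m) (s : R) (mu : R -> Pspace R d)
  (theta : Pspace R d) (X : Omega -> cpath R d s).
Hypotheses (s0 : 0 <= s) (hb : borel_coefficient b) (hsigma : borel_coefficient sigma)
  (cmu : {within `[s, +oo[, continuous mu}).
Hypothesis hX : weak_solution Q F W b sigma mu theta X.
Notation Om a := (g_sigma_algebraType (F a)).
Variables (P0 : set (Pspace R d)) (A : set (R -> Pspace R d)) (l : R -> Pspace R d).
Hypotheses (hP : property_P P0 A) (hl : A l)
  (law_l : forall t, 0 <= t -> is_law Q (X ^~ (s + t)) (l t)).

(** Property (P) keeps the tilted marginals in the class: they are dominated by K
times the marginals of X shifted to start at r. *)
Lemma tilted_solution r K (D : Omega -> R) : s <= r -> 0 < K -> measurable_fun setT (D : Om r -> R) ->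
  (forall w, 0 <= D w) -> (forall w, D w <= K) -> \int[Q]_w D w = 1 ->
  exists eta : R -> Pspace R d,
  [/\ solves_FP b sigma r mu eta, A (fun t => eta (r + t)), P0 (eta r),
    forall t B, measurable B -> prob_of (eta t) B = (\int[Q]_(w in (fun w => X w t) @^-1` B) (D w)%:E)%E &
    forall t f, measurable_fun setT f -> \int[eta t]_x f x = \int[Q]_w (D w * f (X w t))].
Proof.
move=> sr K0 mD D0 DK D1; have r0 := le_trans s0 sr.
have mD' : measurable_fun setT (D : Omega -> R) := adapted_meas (weak_filtration hX) r0 mD.
have iD : integ Q D by apply: (@prob_integ_b _ _ R Q D K mD') => w; rewrite ger0_norm.
have mX t : measurable_fun setT (fun w => X w t) := weak_meas s0 hX t.
have /choice[eta Heta] : forall t, exists e : Pspace R d, forall B, measurable B ->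
    prob_of e B = (\int[Q]_(w in (fun w => X w t) @^-1` B) (D w)%:E)%E.
  by move=> t; exact: (tilted_law mD' D0 D1 iD (mX t)).
have ceta : continuous eta := tilted_continuous s0 hX sr mD D0 DK D1 Heta.
have [_ AC PD AS AD] := hP.
have hl' : A (fun t => l ((r - s) + t)) by apply: AS => //; rewrite subr_ge0.
have dom t : 0 <= t -> dominated K (eta (r + t)) (l ((r - s) + t)).
  move=> t0 B mB; rewrite Heta// (law_l _ mB); last by rewrite addr_ge0// subr_ge0.
  rewrite (_ : s + (r - s + t) = r + t); last by ring.
  have mXB : measurable ((fun w => X w (r + t)) @^-1` B) by rewrite -[_ @^-1` _]setTI; exact: mX.
  rewrite -integral_cst//; apply: ge0_le_integral => //.
  - by move=> w _; rewrite lee_fin.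
  - by apply: measurable_funTS; exact/measurable_EFinP.
  - by move=> w _; rewrite lee_fin.
have P0eta t : 0 <= t -> P0 (eta (r + t)).
  move=> t0; apply: (PD (l (r - s + t)) _ K) => //; last exact: dom.
  have /AC[_] := hl; apply; by rewrite addr_ge0// subr_ge0.
exists eta; split=> //.
- exact: (tilted_solves_FP s0 hb hsigma cmu hX sr mD D0 DK D1 Heta).
- apply: (AD _ _ K hl') => //; split=> //.
  apply: continuous_subspaceT => t; apply: (cvg_comp (fun t => r + t) eta); last exact: ceta.
  by apply: cvgD; [exact: cvg_cst|exact: cvg_id].
- by have := P0eta 0 (lexx 0); rewrite addr0.
- move=> t f mf; exact: (tilted_Rint mD' D0 D1 iD (mX t) (Heta t)).
Qed.

End TiltedSolution.

(** * Flow property and Markov property *)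

Section Flow.
Context (R : realType) (d m : nat) (b bb : drift R d) (sigma bs : diffusion R d m).
Variables (P0 tP0 : set (Pspace R d)) (A tA : set (R -> Pspace R d)).
Variables (mu : R -> Pspace R d -> R -> Pspace R d)
  (nu : R -> Pspace R d -> Pspace R d -> R -> Pspace R d).
Hypotheses (hb : borel_coefficient b) (hsigma : borel_coefficient sigma)
  (hbb : borel_coefficient bb) (hbs : borel_coefficient bs)
  (hP : property_P P0 A) (htP : property_P tP0 tA)
  (hFP : well_posed b sigma bb bs P0 A tP0 tA mu nu).
Variables (s : R) (zeta : Pspace R d) (r : R).
Hypotheses (s0 : 0 <= s) (hzeta : P0 zeta) (sr : s <= r).

Lemma flow_continuous : {within `[s, +oo[, continuous (mu s zeta)}.
Proof. by case: hFP => /(_ s zeta s0 hzeta)[[[]]]. Qed.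

Let flow_A : A (fun t => mu s zeta (r + t)).
Proof.
case: hFP => /(_ s zeta s0 hzeta)[[_ _ hA] _ _ _ _].
case: hP => _ _ _ AS _; have := AS _ (r - s) hA; rewrite subr_ge0 => /(_ sr).
by rewrite (_ : (fun t => _) = (fun t => mu s zeta (r + t)))//; apply/funext => t; congr (mu s zeta _); ring.
Qed.

Lemma flow_P0 : P0 (mu s zeta r).
Proof.
case: hP => _ AC _ _ _; have [_ /(_ 0 (lexx 0))] := AC _ flow_A.
by rewrite addr0.
Qed.

(** The restarted path solves the nonlinear equation from r and stays in A by
the shift clause of property (P), so uniqueness applies. *)
Lemma flow_property t : r <= t -> same_law (mu s zeta t) (mu r (mu s zeta r) t).
Proof.
have r0 := le_trans s0 sr.
case: hFP => H _ _ _; have [[hs _ _] _] := H s zeta s0 hzeta.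
have [_ uniq] := H r (mu s zeta r) r0 flow_P0.
move=> rt; apply: (uniq (mu s zeta) _ t rt); split; [|by []|exact: flow_A].
exact: (solves_FP_restart hb hsigma s0 sr flow_continuous hs).
Qed.

Section Marginal.
Context (dO : measure_display) (Omega : measurableType dO).
Variables (Q : probability Omega R) (F : R -> set (set Omega)) (W : Omega -> cpath R m 0).
Variables (theta : Pspace R d) (X : Omega -> cpath R d s) (l : R -> Pspace R d).
Hypotheses (htheta : tP0 theta) (hX : weak_solution Q F W bb bs (mu s zeta) theta X)
  (hl : tA l) (law_l : forall t, 0 <= t -> is_law Q (X ^~ (s + t)) (l t)).

(** [tilted_solution] with the constant weight 1, together with uniqueness. *)
Lemma weak_marginal : is_law Q (X ^~ r) (nu s zeta theta r).
Proof.
have D1 : \int[Q]_w (1 : R) = 1 by exact: Rint_cst.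
have [eta [h1 h2 h3 h4 _]] := tilted_solution s0 hbb hbs flow_continuous hX htP hl law_l
  (D := fun=> 1) (lexx s) ltr01 (measurable_cst _) (fun=> ler01) (fun=> lexx 1) D1.
have E t B : measurable B -> prob_of (eta t) B = Q ((X ^~ t) @^-1` B).
  move=> mB; rewrite h4// integral_cst ?mul1e//.
  by rewrite -[X in measurable X]setTI; exact: (weak_meas s0 hX t).
have [_ _ /(_ s theta zeta s0 htheta hzeta)[_ uniq] _] := hFP.
have etas : same_law (eta s) theta.
  by move=> B mB; rewrite E//; case: hX => _ [_ [_ -> ]].
have H := uniq eta (And3 h1 etas h2) r sr.
by move=> B mB; rewrite -E// H.
Qed.

End Marginal.
End Flow.

Lemma ae_full dT (T : measurableType dT) (R : realType) (P : {measure set T -> \bar R}) (S : set T) :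
  measurable S -> P setT = 1%E -> P S = 1%E -> {ae P, forall x, S x}.
Proof.
move=> mS PT PS; exists (~` S); split=> //; first exact: measurableC.
have E : P setT = (P S + P (~` S))%E.
  by rewrite -measureU ?setUv// ?setICr//; exact: measurableC.
by move: E; rewrite PT PS; case: (P (~` S)) => [y| |]//= [E]; congr EFin; lra.
Qed.

Lemma mx_set1_meas (R : realType) k n (x : 'M[R]_(k, n)) : measurable [set x].
Proof.
have mf : measurable_fun setT (fun y : 'M[R]_(k, n) => `|y - x|).
  by apply: mx_norm_comp; apply: mx_sub_meas => //; exact: measurable_cst.
have := mf measurableT _ (measurable_set1 0); rewrite setTI; congr measurable.
apply/seteqP; split=> y /=; first by move=> /eqP; rewrite normr_eq0 subr_eq0 => /eqP.
by move=> ->; rewrite subrr normr0.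
Qed.

Theorem theorem4p5 (R : realType) (d m : nat)
  (b bb : drift R d) (sigma bs : diffusion R d m)
  (hb : borel_coefficient b) (hbb : borel_coefficient bb)
  (hsigma : borel_coefficient sigma) (hbs : borel_coefficient bs)
  (P0 tP0 : set (Pspace R d)) (A tA : set (R -> Pspace R d))
  (hP : property_P P0 A) (htP : property_P tP0 tA)
  (mu : R -> Pspace R d -> R -> Pspace R d)
  (nu : R -> Pspace R d -> Pspace R d -> R -> Pspace R d)
  (hFP : well_posed b sigma bb bs P0 A tP0 tA mu nu)
  (s : R) (theta zeta : Pspace R d) (r : R)
  (hs : 0 <= s) (htheta : tP0 theta) (hzeta : P0 zeta) (hr : s <= r)
  (Ps : probability (cpath R d s) R) (Pr : probability (cpath R d r) R)
  (hPs : weak_solution_law bb bs tA (mu s zeta) theta Ps)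
  (hPr : weak_solution_law bb bs tA (mu r (mu s zeta r)) (nu s zeta theta r) Pr)
  (p : R.-pker 'rV[R]_d ~> cpath R d r)
  (hp : forall x : 'rV[R]_d, p x [set w : cpath R d r | w r = x] = 1%E)
  (hdis : forall B : set (cpath R d r), measurable B ->
    Pr B = (\int[nu s zeta theta r]_x p x B)%E)
  (g : 'rV[R]_d -> R) (hg : measurable_fun setT g)
  (hgb : exists M : R, forall x, `|g x| <= M)
  (t : R) (ht : r <= t) :
  cond_expectation Ps (history s r) (fun w => g (w t))
    (fun w => \int[p (w r)]_w' g (w' t)).
Proof.
have [M gM] := hgb; have r0 := le_trans hs hr; have st := le_trans hr ht.
set zeta' := mu s zeta r; set nur := nu s zeta theta r.
have hzeta' : P0 zeta' := flow_P0 hP hFP hs hzeta hr.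
pose f (w' : cpath R d r) := g (w' t); pose G x := \int[p x]_w' f w'.
have mf : measurable_fun setT f by apply: (measurableT_comp hg); exact: eval_meas.
have fM w' : `|f w'| <= M by exact: gM.
have mG : measurable_fun setT G := pker_meas p mf fM.
have GM x : `|G x| <= M := pker_bound p x mf fM.
have mGr : measurable_fun setT (fun w : cpath R d s => G (w r)).
  by apply: (measurableT_comp mG); exact: eval_meas.
have mgt : measurable_fun setT (fun w : cpath R d s => g (w t)).
  by apply: (measurableT_comp hg); exact: eval_meas.
have iG : integ Ps (fun w => G (w r)) by exact: (@prob_integ_b _ _ R Ps _ M mGr (fun w => GM (w r))).
have ig : integ Ps (fun w => g (w t)) by exact: (@prob_integ_b _ _ R Ps _ M mgt (fun w => gM (w t))).
split; [|exact: iG|].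
  move=> B mB; apply: (@history_eval R d s r (G @^-1` B) hr).
  by rewrite -[_ @^-1` _]setTI; exact: mG.
move=> B HB; have mB : measurable B := history_meas HB.
have [/eqP q0|q0] := eqVneq (Ps B) 0%E.
  rewrite !null_set_integral//; try exact/eqP.
  - by apply: measurable_funTS; exact/measurable_EFinP.
  - by apply: measurable_funTS; exact/measurable_EFinP.
suff E : \int[Ps]_w (\1_B w * G (w r)) = \int[Ps]_w (\1_B w * g (w t)).
  have ib (k : cpath R d s -> R) : measurable_fun setT k -> (forall w, `|k w| <= M) ->
      (\int[Ps]_(w in B) (k w)%:E)%E = (\int[Ps]_w (\1_B w * k w))%:E.
    move=> mk kM; rewrite EFin_Rint; last first.
      apply: (@prob_integ_b _ _ R Ps _ M) => [|w].
        by apply: measurable_funM => //; exact: measurable_indic.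
      by rewrite indicE; case: (_ \in _); rewrite ?mul1r// mul0r normr0 (le_trans _ (kM w)).
    rewrite [LHS]integral_mkcond; apply: eq_integral => w _.
    by rewrite epatch_indic EFinM muleC.
  by rewrite (ib (fun w => G (w r)) mGr (fun w => GM (w r))) (ib (fun w => g (w t)) mgt (fun w => gM (w t))) E.
have PsT : (Ps setT < +oo)%E by rewrite probability_setT ltry.
pose q := fine (Ps B).
have qE : q%:E = Ps B by rewrite /q fineK// fin_num_measure.
have q_gt0 : 0 < q by rewrite -lte_fin qE lt0e q0 measure_ge0.
have iq0 : 0 < q^-1 by rewrite invr_gt0.
case: hPs => dO [Om [Q [F [W [X [hX [l hl law_l] lawX]]]]]].
have mX : measurable_fun setT X := weak_path_meas hs hX.
have cmu := flow_continuous hFP hs hzeta.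
(* density of Q conditioned on the event B *)
pose D w := q^-1 * \1_(X @^-1` B) w.
have mXB : measurable (X @^-1` B) by rewrite -[_ @^-1` _]setTI; exact: mX.
have D0 w : 0 <= D w by rewrite mulr_ge0 ?invr_ge0 ?(ltW q_gt0).
have DK w : D w <= q^-1.
  by rewrite /D indicE; case: (_ \in _); rewrite ?mulr1// mulr0 ltW.
have mD : measurable_fun setT (D : g_sigma_algebraType (F r) -> R).
  apply: measurable_funM => //; apply: measurable_indic.
  by apply: sub_sigma_algebra; exact: (weak_history hs hX hr HB).
have lawB : Q (X @^-1` B) = q%:E by rewrite qE -lawX.
have D1 : \int[Q]_w D w = 1.
  have iI : integ Q (\1_(X @^-1` B) : Om -> R).
    apply: (@prob_integ_b _ _ R Q _ 1) => [|w]; first exact: measurable_indic.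
    by rewrite indicE; case: (_ \in _); rewrite ?normr1 ?normr0.
  rewrite /D RintZ//.
  rewrite (_ : \int[Q]_w \1_(X @^-1` B) w = q) ?mulVf ?gt_eqF//.
  have -> : \int[Q]_w \1_(X @^-1` B) w = fine (Q (X @^-1` B)).
    by rewrite /Rintegral integral_indic// setIT.
  by have := lawB; move=> ->.
have [eta1 [fp1 A1 p1 law1 int1]] := tilted_solution hs hbb hbs cmu hX htP hl law_l hr iq0 mD D0 DK D1.
have E1 u (h : 'rV[R]_d -> R) : measurable_fun setT h -> (forall x, `|h x| <= M) -> s <= u ->
    \int[eta1 u]_x h x = q^-1 * \int[Ps]_w (\1_B w * h (w u)).
  move=> mh hM su.
  have mk : measurable_fun setT (fun w : cpath R d s => \1_B w * h (w u)).
    apply: measurable_funM; first exact: measurable_indic.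
    by apply: (measurableT_comp mh); exact: eval_meas.
  have ik : integ Ps (fun w => \1_B w * h (w u)).
    apply: (@prob_integ_b _ _ R Ps _ M mk) => w.
    by rewrite indicE; case: (_ \in _); rewrite ?mul1r// mul0r normr0 (le_trans _ (hM (w u))).
  rewrite int1// -(RintZ _ ik).
  rewrite (@law_Rint _ _ _ _ R Q Ps X mX lawX (fun w => q^-1 * (\1_B w * h (w u)))).
    by apply: Rint_eq => w; rewrite /D -mulrA; congr (_ * (_ * _)).
  exact: measurable_funM.
have marg := weak_marginal hbb hbs htP hFP hs hzeta hr htheta hX hl law_l.
have le1 C : measurable C -> (prob_of (eta1 r) C <= (q^-1)%:E * prob_of nur C)%E.
  move=> mC; rewrite law1// (marg _ mC).
  have mXC : measurable ((fun w => X w r) @^-1` C).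
    by rewrite -[_ @^-1` _]setTI; apply: (weak_meas hs hX r).
  rewrite -integral_cst//; apply: ge0_le_integral => //.
  - by move=> w _; rewrite lee_fin.
  - apply: measurable_funTS; apply/measurable_EFinP.
    exact: (adapted_meas (weak_filtration hX) r0 mD).
  - by move=> w _; rewrite lee_fin.
have [rho [mrho rho0 rhoc rhoE]] := bounded_density (ltW iq0) le1.
case: hPr => dO' [Om' [Q' [F' [W' [X' [hX' [l' hl' law_l'] lawX']]]]]].
have law'r : is_law Q' (X' ^~ r) nur by case: hX' => _ [_ []].
have cmu' := flow_continuous hFP r0 hzeta'.
have mX' : measurable_fun setT X' := weak_path_meas r0 hX'.
have mX'r := weak_meas r0 hX' r.
(* gives the restarted solution the law of eta1 at time r *)
pose D' w := rho (X' w r).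
have mD' : measurable_fun setT (D' : g_sigma_algebraType (F' r) -> R).
  by apply: (measurableT_comp mrho); exact: (weak_adapted r0 hX' (lexx r)).
have D'1 : \int[Q']_w D' w = 1.
  rewrite /D' -(@law_Rint _ _ _ _ R Q' nur _ mX'r law'r rho mrho) /Rintegral -rhoE//.
  by have -> : prob_of (eta1 r) setT = 1%E by exact: probability_setT.
have [eta2 [fp2 A2 p2 law2 int2]] := tilted_solution r0 hbb hbs cmu' hX' htP hl' law_l' (lexx r) iq0 mD'
  (fun w => rho0 _) (fun w => rhoc _) D'1.
have eq_r : same_law (eta2 r) (eta1 r).
  move=> C mC; rewrite law2// rhoE// [LHS]integral_mkcond [RHS]integral_mkcond.
  under [LHS]eq_integral do rewrite epatch_indic.
  under [RHS]eq_integral do rewrite epatch_indic.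
  rewrite (@law_ge0_integral _ _ _ _ R Q' nur _ mX'r law'r (fun x => (rho x)%:E * (\1_C x)%:E)%E)//.
    by apply: emeasurable_funM; apply/measurable_EFinP => //; exact: measurable_indic.
  by move=> x; rewrite -EFinM lee_fin mulr_ge0.
have fp1' : solves_FP bb bs r (mu r zeta') eta1.
  apply: (solves_FP_congr hbb hbs r0 _ fp1) => u ru.
  exact: (flow_property hb hsigma hP hFP hs hzeta hr ru).
(* uniqueness for the linear equation started at (r, eta1 r) *)
have same : same_law (eta1 t) (eta2 t).
  have [_ _ /(_ r (eta1 r) zeta' r0 p1 hzeta')[_ uniq] _] := hFP.
  have u1 := uniq eta1 (And3 fp1' (fun B _ => erefl) A1) t ht.
  have u2 := uniq eta2 (And3 fp2 eq_r A2) t ht.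
  exact: same_law_trans u1 (same_law_sym u2).
(* p x is carried by paths with w r = x, so the weight rho (w r) is constant under it *)
have E2 : \int[eta2 t]_x g x = \int[eta1 r]_x G x.
  have mrg : measurable_fun setT (fun w : cpath R d r => rho (w r) * g (w t)).
    apply: measurable_funM; last exact: mf.
    by apply: (measurableT_comp mrho); exact: eval_meas.
  have brg (w : cpath R d r) : `|rho (w r) * g (w t)| <= q^-1 * M.
    by rewrite normrM ler_pM// ger0_norm.
  rewrite (int2 t g hg) -(@law_Rint _ _ _ _ R Q' Pr X' mX' lawX' (fun w => rho (w r) * g (w t)) mrg).
  rewrite (disint_Rint hdis mrg brg).
  rewrite (@density_Rint _ _ R nur (eta1 r) rho mrho rho0 rhoE G mG).
  apply: Rint_eq => x.
  have ipf : integ (p x) f := pker_integ_b p x mf fM.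
  rewrite mulrC -(RintZ _ ipf); apply: Rint_ae; [exact: mrg|exact: measurable_funM|].
  have mS : measurable [set w : cpath R d r | w r = x].
    have := eval_meas (lexx r) measurableT (mx_set1_meas x).
    by rewrite setTI.
  have := ae_full mS (prob_kernel x) (hp x).
  by apply: filterS => w /= ->.
apply: (mulfI (lt0r_neq0 iq0)).
rewrite -(E1 r G mG GM hr) -(E1 t g hg gM st) -E2.
by apply: same_law_Rint; exact: same_law_sym.
Qed.
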